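(* Let $b$ be a symmetric bilinear form on $V$. Then the linear operator $\mathrm{e}^{\Delta_b}=\sum_{t=0}^\infty\frac1{t!}(\Delta_b)^t$ on $\mathcal{T}^\bullet(V)$, as well as its restriction to $\mathcal{S}^\bullet(V)$, are continuous if and only if $b$ is of Hilbert-Schmidt type. In this case $$\mathrm{e}^{\Delta_b}\big(X\star_\Lambda Y\big)=\big(\mathrm{e}^{\Delta_b}X\big)\star_{\Lambda+b}\big(\mathrm{e}^{\Delta_b}Y\big)$$ holds for all $X,Y\in\mathcal{S}^\bullet(V)$ and all continuous bilinear forms $\Lambda$ on $V$. Hence $\mathrm{e}^{\Delta_b}$ describes an isomorphism of the locally convex algebras $\big(\mathcal{S}^\bullet(V),\star_\Lambda\big)$ and $\big(\mathcal{S}^\bullet(V),\star_{\Lambda+b}\big)$. Moreover, for fixed $X\in\mathcal{S}^\bullet(V)^{\mathrm{cpl}}$, the series $\mathrm{e}^{z\Delta_b}X$ converges absolutely and locally uniformly in $z\in\mathbb{C}$ and thus depends holomorphically on $z$.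
   Context: $V$ is a complex Hausdorff locally convex space whose topology is given by its continuous Hilbert seminorms: let $\mathcal{I}_V$ be the set of continuous positive Hermitian forms $\langle\cdot\,|\,\cdot\rangle_\alpha$ on $V$ (sesquilinear, antilinear in the first argument, Hermitian, positive semi-definite), put $\|v\|_\alpha:=\sqrt{\langle v|v\rangle_\alpha}$, and let $\mathcal{P}_V$ be the set of all these seminorms; it is assumed that $\mathcal{P}_V$ is cofinal in the set of all continuous seminorms on $V$. Let $\mathcal{T}^k_{\mathrm{alg}}(V)$ be the algebraic $k$-th tensor power ($\mathcal{T}^0_{\mathrm{alg}}(V)=\mathbb{C}$), $\mathcal{T}^\bullet_{\mathrm{alg}}(V)=\bigoplus_{k\ge 0}\mathcal{T}^k_{\mathrm{alg}}(V)$, and $\langle X\rangle_k$ the degree-$k$ component of $X$. Each $\langle\cdot|\cdot\rangle_\alpha\in\mathcal{I}_V$ is extended to a positive Hermitian form $\langle X|Y\rangle_\alpha^\bullet:=\sum_{k}\langle\langle X\rangle_k|\langle Y\rangle_k\rangle_\alpha^\bullet$ on $\mathcal{T}^\bullet_{\mathrm{alg}}(V)$, where $\langle x_1\otimes\cdots\otimes x_k|y_1\otimes\cdots\otimes y_k\rangle_\alpha^\bullet:=k!\prod_{m=1}^k\langle x_m|y_m\rangle_\alpha$; set $\|X\|_\alpha^\bullet:=\sqrt{\langle X|X\rangle_\alpha^\bullet}$. $\mathcal{T}^\bullet(V)$ is $\mathcal{T}^\bullet_{\mathrm{alg}}(V)$ with the locally convex topology defined by all seminorms $\|\cdot\|_\alpha^\bullet$,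 $\|\cdot\|_\alpha\in\mathcal{P}_V$. Let $\mathrm{Sym}^\bullet$ be the symmetrisation operator, $\mathrm{Sym}^\bullet(x_1\otimes\cdots\otimes x_k)=\frac1{k!}\sum_{\sigma\in\mathfrak{S}_k}x_{\sigma(1)}\otimes\cdots\otimes x_{\sigma(k)}$, and let $\mathcal{S}^\bullet(V)$ be its image (the symmetric tensors) with the subspace topology; $\mathcal{S}^\bullet(V)^{\mathrm{cpl}}$ is its completion. Continuous maps are extended to completions by continuity. For a continuous bilinear form $\Lambda$ on $V$, let $P_\Lambda$ be the linear endomorphism of $\mathcal{T}^\bullet(V)\otimes\mathcal{T}^\bullet(V)$ (outer tensor product) with $P_\Lambda\big((x_1\otimes\cdots\otimes x_k)\otimes(y_1\otimes\cdots\otimes y_\ell)\big)=k\ell\,\Lambda(x_k,y_1)\,(x_1\otimes\cdots\otimes x_{k-1})\otimes(y_2\otimes\cdots\otimes y_\ell)$ for $k,\ell\ge1$, and zero if $k=0$ or $\ell=0$ (the tensor sign between the two brackets is the outer one). With $\mu_\vee(X\otimes Y):=\mathrm{Sym}^\bullet(X\otimes Y)$ (product in the tensor algebra on the right), $X\star_\Lambda Y:=\sum_{t=0}^\infty\frac1{t!}\mu_\vee\big((P_\Lambda)^t(X\otimes Y)\big)$ for $X,Y\in\mathcal{S}^\bullet(V)$; this makes $\mathcal{S}^\bullet(V)$ a locally convex algebra. For a symmetric bilinear form $b$ on $V$, the Laplace operator $\Delta_b:\mathcal{T}^\bullet(V)\to\mathcal{T}^{\bullet-2}(V)$ is the linear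 map with $\Delta_b(x_1\otimes\cdots\otimes x_k):=\frac{k(k-1)}2\,b(x_1,x_2)\,x_3\otimes\cdots\otimes x_k$ for $k\ge2$ and zero in degrees $0,1$; it maps symmetric tensors to symmetric tensors. A bilinear form $b:V\times V\to\mathbb{C}$ is of Hilbert-Schmidt type if there is $\|\cdot\|_\alpha\in\mathcal{P}_V$ such that (i) $b(v,w)=0$ whenever $\|v\|_\alpha=0$ or $\|w\|_\alpha=0$; and (ii) $\sum_{i,j=1}^d|b(e_i,e_j)|^2\le1$ for every $d\in\mathbb{N}$ and every $\langle\cdot|\cdot\rangle_\alpha$-orthonormal tuple $e\in V^d$. *)

(* Defs.v *)
From HB Require Import structures.
From mathcomp Require Import all_boot all_order all_algebra all_fingroup.
From mathcomp Require Import freeg complex sesquilinear ring_quotient.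
From mathcomp Require Import boolp classical_sets functions cardinality fsbigop.
From mathcomp Require Import reals interval_inference topology normedtype.
From mathcomp Require Import sequences generic_quotient.

Set Implicit Arguments.
Unset Strict Implicit.
Unset Printing Implicit Defensive.

Import Order.TTheory GRing.Theory Num.Theory numFieldNormedType.Exports.

Local Open Scope classical_set_scope.
Local Open Scope quotient_scope.
Local Open Scope ring_scope.

Section LinearSpan.
Variables (K : fieldType) (M : lmodType K).

Definition linear_span (N : set M) : {pred M} := fun x =>
  `[< forall P : set M, P 0 -> (forall a u v, P u -> P v -> P (a *: u + v)) ->
      N `<=` P -> P x >].

Lemma in_linear_span (N : set M) x :
  reflect (forall P : set M, P 0 -> (forall a u v, P u -> P v -> P (a *: u + v)) ->
            N `<=` P -> P x) (x \in linear_span N).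
Proof. by rewrite unfold_in; exact: asboolP. Qed.

Lemma linear_spanP (N : set M) : GRing.submod_closed (linear_span N).
Proof.
split=> [|a u v /in_linear_span Nu /in_linear_span Nv];
  apply/in_linear_span => P P0 Plin NP //.
by apply: (Plin); [exact: Nu|exact: Nv].
Qed.

HB.instance Definition _ (N : set M) :=
  GRing.isSubmodClosed.Build K M (linear_span N) (linear_spanP N).

Lemma linear_span_sub (N : set M) x : N x -> x \in linear_span N.
Proof. by move=> Nx; apply/in_linear_span => P _ _; exact. Qed.

End LinearSpan.

Section Presented.
Variables (K : fieldType) (G : choiceType).

Definition presented (rel : set {freeg G / K}) : Type :=
  Quotient.quot (linear_span rel).

Section Structure.
Variable rel : set {freeg G / K}.
Local Notation Q := (presented rel).

HB.instance Definition _ := GRing.Zmodule.on Q.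
HB.instance Definition _ := EqQuotient.on Q.

Definition pscale (a : K) (x : Q) : Q := \pi_Q (a *: repr x).

Lemma pscale_pi a u : pscale a (\pi_Q u) = \pi_Q (a *: u).
Proof.
apply/eqP; rewrite -Quotient.idealrBE -scalerBr.
by apply: rpredZ; rewrite Quotient.idealrBE reprK.
Qed.

Lemma pi_add (u v : {freeg G / K}) : \pi_Q (u + v) = \pi_Q u + \pi_Q v.
Proof. exact: Quotient.pi_add. Qed.

Fact pscaleA a b x : pscale a (pscale b x) = pscale (a * b) x.
Proof. by elim/quotW: x => u; rewrite (pscale_pi b) !pscale_pi scalerA. Qed.
Fact pscale1 : left_id 1 pscale.
Proof. by move=> x; rewrite -[x]reprK pscale_pi scale1r. Qed.
Fact pscaleDr : right_distributive pscale +%R.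
Proof.
by move=> a x y; rewrite -[x]reprK -[y]reprK -pi_add !pscale_pi scalerDr pi_add.
Qed.
Fact pscaleDl x : {morph pscale^~ x : a b / a + b}.
Proof. by move=> a b; rewrite -[x]reprK !pscale_pi scalerDl pi_add. Qed.

HB.instance Definition _ :=
  GRing.Zmodule_isLmodule.Build K Q pscaleA pscale1 pscaleDr pscaleDl.

Lemma pi_is_linear : linear (\pi_Q : {freeg G / K} -> Q).
Proof. by move=> a u v; rewrite pi_add -pscale_pi. Qed.

Lemma pi0 : \pi_Q 0 = 0 :> Q.
Proof. by apply: (addrI (\pi_Q 0)); rewrite -pi_add !addr0. Qed.

Lemma pi_rel u v : rel (u - v) -> \pi_Q u = \pi_Q v :> Q.
Proof.
by move=> ruv; apply/eqP; rewrite -Quotient.idealrBE; exact: linear_span_sub.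
Qed.

Definition pgen (g : G) : Q := \pi_Q << g >>.

(* The value on a representative; independent of it as soon as [fglift f]
   kills [rel], see [plift_is_linear] and [plift_gen]. *)
Definition plift (W : lmodType K) (f : G -> W) (x : Q) : W :=
  fglift f (repr x).

Section Lift.
Variables (W : lmodType K) (f : G -> W).

Lemma fglift_is_linear : linear (fglift f).
Proof.
have fgliftB := lift_is_additive f.
have fglift0 : fglift f 0 = 0 by rewrite -[0 in LHS](subrr 0) fgliftB subrr.
have fgliftN u : fglift f (- u) = - fglift f u by rewrite -sub0r fgliftB fglift0 sub0r.
have fgliftD u v : fglift f (u + v) = fglift f u + fglift f v.
  by rewrite -[v in LHS]opprK fgliftB fgliftN opprK.
have fglift_sum (s : seq G) (h : G -> {freeg G / K}) :
    fglift f (\sum_(x <- s) h x) = \sum_(x <- s) fglift f (h x).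
  by elim: s => [|x s IH]; rewrite ?big_nil// !big_cons fgliftD IH.
move=> a u v; rewrite fgliftD; congr (_ + _).
rewrite -[in RHS](freeg_sumE u) [in LHS]/GRing.scale/= /fgscale !fglift_sum.
by rewrite scaler_sumr; apply: eq_bigr => x _; rewrite !liftU scalerA.
Qed.

Definition respects := forall r, rel r -> fglift f r = 0.

Hypothesis fP : respects.

Lemma plift_pi u : plift f (\pi_Q u) = fglift f u.
Proof.
have : repr (\pi_Q u) - u \in linear_span rel by rewrite Quotient.idealrBE reprK.
move=> /in_linear_span/(_ [set w | fglift f w = 0])/= H.
have {H} : fglift f (repr (\pi_Q u) - u) = 0.
  apply: H => //; last 1 first.
  - by move=> a x y fx fy; rewrite fglift_is_linear fx fy scaler0 addr0.
  - have := fglift_is_linear (-1) 0 0.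
    by rewrite scaler0 addr0 scaleN1r => ->; rewrite addNr.
by rewrite lift_is_additive => /subr0_eq.
Qed.

Lemma plift_is_linear : linear (plift f).
Proof.
move=> a x y; rewrite -[x]reprK -[y]reprK.
rewrite -[a *: _]/(pscale a _) pscale_pi -pi_add !plift_pi.
exact: fglift_is_linear.
Qed.

Lemma plift_gen g : plift f (pgen g) = f g.
Proof. by rewrite plift_pi liftU scale1r. Qed.

End Lift.

Lemma presented_ind (P : Q -> Prop) : P 0 ->
  (forall a g x, P x -> P (a *: pgen g + x)) -> forall x, P x.
Proof.
move=> P0 Pg x; rewrite -[x]reprK -(freeg_sumE (repr x)).
elim: (dom _) => [|g s IH].
  by rewrite big_nil pi0.
rewrite big_cons pi_add.
suff -> : \pi_Q << coeff g (repr x) *g g >> = coeff g (repr x) *: pgen g.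
  exact: Pg.
rewrite -[RHS]/(pscale _ _) pscale_pi; congr (\pi_Q _).
by apply/eqP/freeg_eqP => h; rewrite coeffZ !coeffU mul1r.
Qed.

End Structure.
End Presented.

Section TensorAlgebra.
Variables (K : fieldType) (V : lmodType K).

Definition multilinear (W : lmodType K) (f : seq V -> W) := forall s t a x y,
  f (s ++ (a *: x + y) :: t) = a *: f (s ++ x :: t) + f (s ++ y :: t).

Definition multilinear_rel : set {freeg (seq V) / K} :=
  [set r | exists s t a x y,
     r = << s ++ (a *: x + y) :: t >>
         - (a *: << s ++ x :: t >> + << s ++ y :: t >>)].

(* Generated by the words [x_1; ..; x_k] in V, subject to linearity in every
   letter: this is the direct sum over k of the k-th tensor powers of V, the
   word [x_1; ..; x_k] being x_1 (x) .. (x) x_k. *)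
Definition tensor : Type := presented multilinear_rel.

HB.instance Definition _ := GRing.Lmodule.on tensor.

Definition word (s : seq V) : tensor := pgen multilinear_rel s.

Section Lift.
Variables (W : lmodType K) (f : seq V -> W).

Definition tlift (X : tensor) : W := plift f X.

Hypothesis fP : multilinear f.

Let fR : respects multilinear_rel f.
Proof.
move=> _ [s [t [a [x [y ->]]]]]; rewrite lift_is_additive fglift_is_linear.
by rewrite !liftU !scale1r fP subrr.
Qed.

Lemma tlift_is_linear : linear tlift. Proof. exact: plift_is_linear. Qed.

Lemma tlift_word s : tlift (word s) = f s. Proof. exact: plift_gen. Qed.

End Lift.

Lemma word_multilinear : multilinear word.
Proof.
move=> s t a x y; rewrite -pi_is_linear; apply: pi_rel.
by exists s, t, a, x, y.
Qed.

Lemma tensor_ind (P : tensor -> Prop) : P 0 ->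
  (forall a s X, P X -> P (a *: word s + X)) -> forall X, P X.
Proof. exact: presented_ind. Qed.

Lemma eq_tensor (W : lmodType K) (f g : tensor -> W) :
  linear f -> linear g -> (forall s, f (word s) = g (word s)) -> f =1 g.
Proof.
move=> fl gl fg; elim/tensor_ind => [|a s X IH]; last by rewrite fl gl fg IH.
have h0 (h : tensor -> W) : linear h -> h 0 = 0.
  by move=> /(_ (-1) 0 0); rewrite scaler0 addr0 scaleN1r addNr.
by rewrite !h0.
Qed.

End TensorAlgebra.

Section BilinearWords.
Variables (K : fieldType) (V W : lmodType K).

Definition tlift2 (f : seq V -> seq V -> W) (X Y : tensor V) : W :=
  tlift (fun s => tlift (f s) Y) X.

Variable f : seq V -> seq V -> W.
Hypothesis fl : forall t, multilinear (f^~ t).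
Hypothesis fr : forall s, multilinear (f s).

Let fl' Y : multilinear (fun s => tlift (f s) Y).
Proof.
move=> s t a x y; elim/tensor_ind: Y => [|b w Y IH].
  have h0 u : tlift (f u) 0 = 0.
    have := tlift_is_linear (fr u) (-1) 0 0.
    by rewrite scaler0 addr0 scaleN1r => ->; rewrite addNr.
  by rewrite !h0 scaler0 addr0.
rewrite !(tlift_is_linear (fr _)) !tlift_word// IH fl !scalerDr !scalerA.
by rewrite [a * b]mulrC !addrA; congr (_ + _); rewrite addrAC.
Qed.

Lemma tlift2_is_linearl Y : linear (tlift2 f ^~ Y).
Proof. exact: tlift_is_linear. Qed.

Lemma tlift2_is_linearr X : linear (tlift2 f X).
Proof.
move=> a Y Z; elim/tensor_ind: X => [|b w X IH].
  have h0 U : tlift2 f 0 U = 0.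
    have := tlift2_is_linearl U (-1) 0 0.
    by rewrite scaler0 addr0 scaleN1r => ->; rewrite addNr.
  by rewrite !h0 scaler0 addr0.
rewrite !tlift2_is_linearl IH /tlift2 !tlift_word//.
rewrite (tlift_is_linear (fr _)) !scalerDr !scalerA [a * b]mulrC !addrA.
by congr (_ + _); rewrite addrAC.
Qed.

Lemma tlift2_word s t : tlift2 f (word s) (word t) = f s t.
Proof. by rewrite /tlift2 !tlift_word. Qed.

End BilinearWords.

Section OuterTensor.
Variables (K : fieldType) (M N : lmodType K).

Definition bilinear_rel : set {freeg (M * N)%type / K} :=
  [set r | (exists a x x' y, r = << (a *: x + x', y) >>
                                - (a *: << (x, y) >> + << (x', y) >>))
        \/ (exists a x y y', r = << (x, a *: y + y') >>
                                - (a *: << (x, y) >> + << (x, y') >>))].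

Definition outer : Type := presented bilinear_rel.

HB.instance Definition _ := GRing.Lmodule.on outer.

Definition otimes (x : M) (y : N) : outer := pgen bilinear_rel (x, y).

Lemma otimes_linearl y : linear (otimes^~ y).
Proof.
move=> a x x'; rewrite -pi_is_linear; apply: pi_rel.
by left; exists a, x, x', y.
Qed.

Lemma otimes_linearr x : linear (otimes x).
Proof.
move=> a y y'; rewrite -pi_is_linear; apply: pi_rel.
by right; exists a, x, y, y'.
Qed.

Variables (W : lmodType K) (f : M -> N -> W).

Definition olift (Z : outer) : W := plift (fun p => f p.1 p.2) Z.

Hypothesis fl : forall y, linear (f^~ y).
Hypothesis fr : forall x, linear (f x).

Let fR : respects bilinear_rel (fun p : M * N => f p.1 p.2).
Proof.
move=> _ [[a [x [x' [y ->]]]]|[a [x [y [y' ->]]]]];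
  rewrite lift_is_additive fglift_is_linear !liftU !scale1r /=.
  by rewrite fl subrr.
by rewrite fr subrr.
Qed.

Lemma olift_is_linear : linear olift. Proof. exact: plift_is_linear. Qed.

Lemma olift_otimes x y : olift (otimes x y) = f x y.
Proof. exact: plift_gen. Qed.

End OuterTensor.

Section Operations.
Variables (K : fieldType) (V : lmodType K).
Local Notation T := (tensor V).

Definition tmul : T -> T -> T := tlift2 (fun s t => word (s ++ t)).

Let cat_multilinearl t : multilinear (fun s : seq V => word (s ++ t)).
Proof. by move=> s u a x y; rewrite -!catA !cat_cons word_multilinear. Qed.

Let cat_multilinearr s : multilinear (fun t : seq V => word (s ++ t)).
Proof. by move=> t u a x y; rewrite !catA word_multilinear. Qed.

Lemma tmul_linearl Y : linear (tmul^~ Y).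
Proof. exact: (tlift2_is_linearl cat_multilinearl cat_multilinearr). Qed.

Lemma tmul_linearr X : linear (tmul X).
Proof. exact: (tlift2_is_linearr cat_multilinearl cat_multilinearr). Qed.

Lemma tmul_word s t : tmul (word s) (word t) = word (s ++ t).
Proof. exact: (tlift2_word cat_multilinearl cat_multilinearr). Qed.

Definition permute k (sigma : 'S_k) (s : seq V) : seq V :=
  [seq s`_(sigma i) | i <- enum 'I_k].

Definition sym_word (s : seq V) : T :=
  (size s)`!%:R^-1 *: \sum_(sigma : 'S_(size s)) word (permute sigma s).

Definition Sym : T -> T := tlift sym_word.

Lemma permute_cat k (sigma : 'S_k) (s t : seq V) : (size s + (size t).+1)%N = k ->
  exists s' t', forall x, permute sigma (s ++ x :: t) = s' ++ x :: t'.
Proof.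
move=> sk; have ik : (size s < k)%N by rewrite -sk -addSnnS leq_addr.
pose i0 := (sigma^-1)%g (Ordinal ik).
rewrite /permute; have := enum_uniq 'I_k.
have : i0 \in enum 'I_k by rewrite mem_enum.
case/splitPr => p1 p2; rewrite cat_uniq /= negb_or => /and3P[_ /andP[i1 _] /andP[i2 _]].
have f0 x i : i != i0 -> (s ++ x :: t)`_(sigma i) = (s ++ 0 :: t)`_(sigma i).
  move=> ii0; rewrite !nth_cat; case: ltnP => // si.
  have /prednK <- : (0 < sigma i - size s)%N; last by [].
  rewrite subn_gt0 ltn_neqAle si andbT; apply: contra ii0 => /eqP si'.
  rewrite -(inj_eq (@perm_inj _ sigma)) permKV; apply/eqP/val_inj.
  by rewrite /= si'.
exists [seq (s ++ 0 :: t)`_(sigma i) | i <- p1],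
       [seq (s ++ 0 :: t)`_(sigma i) | i <- p2] => x.
rewrite map_cat /= permKV nth_cat ltnn subnn /=; congr (_ ++ _ :: _).
  by apply/eq_in_map => i ip1; apply: f0; apply: contraNneq i1 => <-.
by apply/eq_in_map => i ip2; apply: f0; apply: contraNneq i2 => <-.
Qed.

Lemma sym_word_multilinear : multilinear sym_word.
Proof.
move=> s t a x y; rewrite /sym_word.
have sz z : size (s ++ z :: t) = (size s + (size t).+1)%N by rewrite size_cat.
rewrite !sz scalerA mulrC -scalerA -scalerDr; congr (_ *: _).
rewrite scaler_sumr -big_split /=; apply: eq_bigr => sigma _.
have [//|s' [t' e]] := @permute_cat _ sigma s t.
by rewrite !e word_multilinear.
Qed.

Lemma Sym_is_linear : linear Sym.
Proof. exact: (tlift_is_linear sym_word_multilinear). Qed.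

HB.instance Definition _ := GRing.isLinear.Build K T T _ Sym Sym_is_linear.

Lemma Sym_word s : Sym (word s) =
  (size s)`!%:R^-1 *: \sum_(sigma : 'S_(size s)) word (permute sigma s).
Proof. exact: (tlift_word sym_word_multilinear). Qed.

Section Laplace.
Variable b : {biscalar V}.

Definition laplace_word (s : seq V) : T :=
  if s is x1 :: x2 :: s'
  then ((size s * (size s).-1)%:R / 2 * b x1 x2) *: word s' else 0.

Definition laplace : T -> T := tlift laplace_word.

Lemma laplace_word_multilinear : multilinear laplace_word.
Proof.
move=> [|x1 [|x2 s]] t a x y /=.
- case: t => [|x2 t] /=; first by rewrite scaler0 addr0.
  by rewrite linearPl/= mulrDr scalerDl scalerA mulrCA.
- by rewrite linearPr/= mulrDr scalerDl scalerA mulrCA.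
- rewrite !size_cat /= word_multilinear scalerDr; congr (_ + _).
  by rewrite !scalerA [a * _]mulrC.
Qed.

Lemma laplace_is_linear : linear laplace.
Proof. exact: (tlift_is_linear laplace_word_multilinear). Qed.

HB.instance Definition _ := GRing.isLinear.Build K T T _ laplace laplace_is_linear.

Lemma laplace_word_cons2 x1 x2 s : laplace (word [:: x1, x2 & s]) =
  (((size s).+2 * (size s).+1)%:R / 2 * b x1 x2) *: word s.
Proof. exact: (tlift_word laplace_word_multilinear). Qed.

Lemma laplace_word_small s : (size s < 2)%N -> laplace (word s) = 0.
Proof.
by rewrite /laplace (tlift_word laplace_word_multilinear); case: s => [|? [|]].
Qed.

End Laplace.

Section Contraction.
Variable L : {biscalar V}.

Definition contract_word (s t : seq V) : outer T T :=
  match s, t with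
  | x0 :: s', y :: t' => ((size s * size t)%:R * L (last x0 s') y)
                           *: otimes (word (belast x0 s')) (word t')
  | _, _ => 0
  end.

Definition contract : outer T T -> outer T T := olift (tlift2 contract_word).

Arguments contract_word : simpl never.

Lemma contract_word_rcons s x y t : contract_word (rcons s x) (y :: t) =
  (((size s).+1 * (size t).+1)%:R * L x y) *: otimes (word s) (word t).
Proof.
case: s => [//|x0 s]; rewrite /contract_word /=.
by rewrite last_rcons belast_rcons size_rcons.
Qed.

Lemma contract_word_nilr s : contract_word s [::] = 0.
Proof. by case: s. Qed.

Let contract_wordl t : multilinear (contract_word^~ t).
Proof.
move=> s u a x y /=; case: t => [|z t].
  by rewrite !contract_word_nilr scaler0 addr0.
case/lastP: u => [|u w].
  rewrite !cats1 !contract_word_rcons (linearPl L z a x y) /=.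
  by rewrite mulrDr scalerDl scalerA mulrCA.
rewrite -!rcons_cons -!rcons_cat !contract_word_rcons !size_cat /=.
rewrite word_multilinear otimes_linearl scalerDr; congr (_ + _).
by rewrite !scalerA [a * _]mulrC.
Qed.

Let contract_wordr s : multilinear (contract_word s).
Proof.
move=> t u a x y; case/lastP: s => [|s z].
  by rewrite /contract_word scaler0 addr0.
case: t => [|w t].
  rewrite /= !contract_word_rcons (linearPr L z a x y) /=.
  by rewrite mulrDr scalerDl scalerA mulrCA.
rewrite !cat_cons !contract_word_rcons !size_cat /=.
rewrite word_multilinear otimes_linearr scalerDr; congr (_ + _).
by rewrite !scalerA [a * _]mulrC.
Qed.

Lemma contract_is_linear : linear contract.
Proof.
apply: olift_is_linear => [Y|X]; first exact: tlift2_is_linearl.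
exact: tlift2_is_linearr.
Qed.

HB.instance Definition _ :=
  GRing.isLinear.Build K (outer T T) (outer T T) _ contract contract_is_linear.

Lemma contract_otimes_word s t :
  contract (otimes (word s) (word t)) = contract_word s t.
Proof.
rewrite /contract olift_otimes ?tlift2_word// => [Y|X].
  exact: tlift2_is_linearl.
exact: tlift2_is_linearr.
Qed.

End Contraction.

Definition mu : outer T T -> T := olift tmul.

Lemma mu_is_linear : linear mu.
Proof.
by apply: olift_is_linear => [Y|X]; [exact: tmul_linearl|exact: tmul_linearr].
Qed.

HB.instance Definition _ := GRing.isLinear.Build K (outer T T) T _ mu mu_is_linear.

Lemma mu_otimes X Y : mu (otimes X Y) = tmul X Y.
Proof.
by apply: olift_otimes => [Z|Z]; [exact: tmul_linearl|exact: tmul_linearr].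
Qed.

End Operations.

Section Symmetric.
Variables (K : numFieldType) (V : lmodType K).
Local Notation T := (tensor V).

Let linZ (M N : lmodType K) (f : M -> N) : linear f -> forall a x, f (a *: x) = a *: f x.
Proof.
move=> fl a x; have f0 : f 0 = 0.
  by have := fl (-1) 0 0; rewrite scaler0 addr0 scaleN1r addNr.
by rewrite -[a *: x]addr0 fl f0 addr0.
Qed.

Let lin_sum (M N : lmodType K) (f : M -> N) (I : Type) (r : seq I) (F : I -> M) :
  linear f -> f (\sum_(i <- r) F i) = \sum_(i <- r) f (F i).
Proof.
move=> fl; have f0 : f 0 = 0.
  by have := fl (-1) 0 0; rewrite scaler0 addr0 scaleN1r addNr.
elim: r => [|i r IH]; first by rewrite !big_nil.
by rewrite !big_cons -IH -[X in f (X + _)]scale1r fl scale1r.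
Qed.

Let Sym0 : Sym 0 = 0 :> T.
Proof. by have := linZ (@Sym_is_linear K V) 0 0; rewrite !scale0r. Qed.

Definition symmetric : {pred T} := fun X => `[< range (@Sym K V) X >].

Lemma in_symmetric X : reflect (range (@Sym K V) X) (X \in symmetric).
Proof. by rewrite unfold_in; exact: asboolP. Qed.

Lemma Sym_symmetric X : Sym X \in symmetric.
Proof. by apply/in_symmetric; exists X. Qed.

Lemma symmetric_submod : GRing.submod_closed symmetric.
Proof.
split=> [|a _ _ /in_symmetric[X _ <-] /in_symmetric[Y _ <-]].
  by apply/in_symmetric; exists 0 => //; exact: Sym0.
by apply/in_symmetric; exists (a *: X + Y) => //; exact: Sym_is_linear.
Qed.

HB.instance Definition _ := GRing.isSubmodClosed.Build K T symmetric symmetric_submod.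

Definition symtensor : Type := {X : T | X \in symmetric}.

HB.instance Definition _ := SubType.on symtensor.
HB.instance Definition _ := [Choice of symtensor by <:].
HB.instance Definition _ := [SubChoice_isSubLmodule of symtensor by <:].

Definition toSym (X : T) : symtensor := exist _ (Sym X) (Sym_symmetric X).

Lemma laplace_Sym (b : {biscalar V}) X :
  Sym (laplace b (Sym X)) = laplace b (Sym X).
Proof.
apply: (@eq_tensor _ _ _ (fun X => Sym (laplace b (Sym X)))
  (fun X => laplace b (Sym X))) => [a Y Z|a Y Z|s].
- by rewrite !(Sym_is_linear, laplace_is_linear).
- by rewrite !(Sym_is_linear, laplace_is_linear).
rewrite Sym_word !(linZ (@Sym_is_linear _ _), linZ (laplace_is_linear b)).
congr (_ *: _).
rewrite (lin_sum _ _ (laplace_is_linear b)) (lin_sum _ _ (@Sym_is_linear _ _)).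
have [s2|] := ltnP (size s) 2.
  have l0 (sigma : 'S_(size s)) : laplace b (word (permute sigma s)) = 0.
    by rewrite laplace_word_small// size_map size_enum_ord.
  by rewrite !big1// => sigma _; rewrite l0 ?Sym0.
case: (size s) => [//|[//|m]] _.
pose b' (sigma : 'S_m.+2) := b s`_(sigma ord0) s`_(sigma (fintype.lift ord0 ord0)).
pose G (sigma : 'S_m.+2) :=
  [seq s`_(sigma (fintype.lift ord0 (fintype.lift ord0 j))) | j <- enum 'I_m].
have sizeG sigma : size (G sigma) = m by rewrite size_map size_enum_ord.
pose c : K := (m.+2 * m.+1)%:R / 2.
have lapE sigma : laplace b (word (permute sigma s)) =
    (c * b' sigma) *: word (G sigma).
  rewrite /permute !enum_ordSl !map_cons.
  rewrite laplace_word_cons2 3!size_map size_enum_ord.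
  by rewrite -2!map_comp.
have swapZ (x y : K) (Y : T) : x *: (y *: Y) = y *: (x *: Y).
  by rewrite !scalerA mulrC.
under eq_bigr => sigma _.
  rewrite lapE (linZ (@Sym_is_linear _ _)) Sym_word sizeG swapZ scaler_sumr.
  over.
under [RHS]eq_bigr do rewrite lapE.
rewrite -scaler_sumr exchange_big /=.
pose lft (tau : 'S_m) : 'S_m.+2 := lift_perm ord0 ord0 (lift_perm ord0 ord0 tau).
have lftb tau sigma : b' (lft tau * sigma)%g = b' sigma.
  by rewrite /b' !permM /lft !(lift_perm_id, lift_perm_lift).
have lftG (tau : 'S_m) sigma : permute tau (G sigma) = G (lft tau * sigma)%g.
  rewrite /permute /G; apply: eq_map => i.
  rewrite (nth_map i) ?size_enum_ord// nth_ord_enum.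
  by rewrite permM /lft !lift_perm_lift.
have inner (tau : 'S_m) : \sum_sigma (c * b' sigma) *: word (permute tau (G sigma)) =
    \sum_sigma (c * b' sigma) *: word (G sigma).
  rewrite [RHS](reindex_inj (mulgI (lft tau))) /=.
  by apply: eq_bigr => sigma _; rewrite lftb lftG.
under eq_bigr do rewrite inner.
rewrite sumr_const card_Sn -[X in _ *: X]scaler_nat scalerA mulVf ?scale1r//.
Qed.

Lemma laplace_symmetric (b : {biscalar V}) X :
  X \in symmetric -> laplace b X \in symmetric.
Proof.
by move=> /in_symmetric[Y _ <-]; rewrite -laplace_Sym; exact: Sym_symmetric.
Qed.

Definition laplaceS (b : {biscalar V}) (X : symtensor) : symtensor :=
  exist _ (laplace b (val X)) (laplace_symmetric b (valP X)).

End Symmetric.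

(* [\sum_(t \in setT)] is the sum of a finitely supported family; the operators
   it is used for are locally nilpotent on tensors, see [laplace_nilpotent] and
   [contract_nilpotent]. *)
Definition exp_op (K : fieldType) (M : lmodType K) (f : M -> M) (X : M) : M :=
  \sum_(t \in [set: nat]) t`!%:R^-1 *: iter t f X.

Section Exp.
Variables (K : numFieldType) (V : lmodType K).

Let iter_linear (M : lmodType K) (f : M -> M) t : linear f -> linear (iter t f).
Proof. by move=> fl; elim: t => [//|t IH] a x y /=; rewrite IH fl. Qed.

Let linear_at0 (M N : lmodType K) (f : M -> N) : linear f -> f 0 = 0.
Proof. by move=> /(_ (-1) 0 0); rewrite scaler0 addr0 scaleN1r addNr. Qed.

Lemma laplace_nilpotent (b : {biscalar V}) X :
  exists n, forall t, (n <= t)%N -> iter t (laplace b) X = 0.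
Proof.
have it t := iter_linear t (laplace_is_linear b).
have nil_word t s : (size s < t)%N -> iter t (laplace b) (word s) = 0.
  elim: t s => // t IH s st; rewrite iterSr.
  have [s2|] := ltnP (size s) 2.
    by rewrite laplace_word_small//; exact: linear_at0.
  case: s st => [//|x [//|y s]] st _; rewrite laplace_word_cons2.
  rewrite -[_ *: _]addr0 it IH ?scaler0 ?add0r; first exact: linear_at0.
  by move: st; rewrite /= ltnS; apply: leq_trans; rewrite ltnS leqnSn.
elim/tensor_ind: X => [|a s X [n nX]].
  by exists 0%N => t _; exact: linear_at0.
exists (maxn n (size s).+1) => t; rewrite geq_max => /andP[nt st].
by rewrite it nX// nil_word// scaler0 addr0.
Qed.

Lemma contract_nilpotent (L : {biscalar V}) X Y :
  exists n, forall t, (n <= t)%N -> iter t (contract L) (otimes X Y) = 0.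
Proof.
have it t := iter_linear t (contract_is_linear L).
have nil_word t s u : (size s < t)%N ->
    iter t (contract L) (otimes (word s) (word u)) = 0.
  elim: t s u => // t IH s u st; rewrite iterSr contract_otimes_word.
  case: u => [|y u]; first by rewrite contract_word_nilr; exact: linear_at0.
  case/lastP: s st => [|s x] st.
    by rewrite /contract_word; exact: linear_at0.
  rewrite contract_word_rcons -[_ *: _]addr0 it IH ?scaler0 ?add0r.
    exact: linear_at0.
  by move: st; rewrite size_rcons ltnS.
elim/tensor_ind: X => [|a s X [n nX]].
  exists 0%N => t _; rewrite (linear_at0 (otimes_linearl Y)).
  exact: linear_at0.
have [m mY] : exists m, forall t, (m <= t)%N ->
    iter t (contract L) (otimes (word s) Y) = 0.
  exists (size s).+1 => t st; elim/tensor_ind: Y {nX} => [|c u Y IH].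
    by rewrite (linear_at0 (otimes_linearr _)); exact: linear_at0.
  by rewrite otimes_linearr it IH nil_word// scaler0 addr0.
exists (maxn n m) => t; rewrite geq_max => /andP[nt mt].
by rewrite otimes_linearl it nX// mY// scaler0 addr0.
Qed.

Let finite_support_eq0 (M N : zmodType) (F : nat -> M) (G : nat -> N) :
  (forall t, F t = 0 <-> G t = 0) ->
  finite_support 0 [set: nat] F = finite_support 0 [set: nat] G.
Proof.
move=> FG; rewrite /finite_support !unlock.
rewrite (_ : F @^-1` [set~ 0] = G @^-1` [set~ 0])//.
by apply/seteqP; split=> t /= H /FG.
Qed.

Lemma val_exp_laplaceS (b : {biscalar V}) (X : symtensor V) :
  val (exp_op (laplaceS b) X) = exp_op (laplace b) (val X).
Proof.
have valE t : val (t`!%:R^-1 *: iter t (laplaceS b) X) =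
    t`!%:R^-1 *: iter t (laplace b) (val X).
  by rewrite linearZ/=; congr (_ *: _); elim: t => //= t ->.
rewrite /exp_op (finite_support_eq0 (G := fun t => t`!%:R^-1 *: iter t (laplace b) (val X))).
  by rewrite linear_sum; apply: eq_bigr => t _; exact: valE.
move=> t; rewrite -valE; split=> [->|H]; first by rewrite linear0.
by apply: val_inj; rewrite H linear0.
Qed.

Definition star (L : {biscalar V}) (X Y : symtensor V) : symtensor V :=
  \sum_(t \in [set: nat])
    t`!%:R^-1 *: toSym (mu (iter t (contract L) (otimes (val X) (val Y)))).

End Exp.

Section HilbertSeminorms.
Variables (R : realType) (V : tvsType R[i]).
Local Notation C := R[i].

(* The set I_V; as in the source, and unlike in [sesquilinear.v], the form is
   antilinear in the first argument. *)
Record herm_form := HermForm {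
  herm_fun :> V -> V -> C ;
  herm_linear : forall v, linear (herm_fun v : V -> C^o) ;
  herm_sym : forall v w, herm_fun w v = (herm_fun v w)^* ;
  herm_ge0 : forall v, 0 <= herm_fun v v ;
  herm_continuous : continuous (fun p : V * V => herm_fun p.1 p.2 : C^o) }.

Definition herm_norm (alpha : herm_form) (v : V) : R :=
  Num.sqrt (complex.Re (alpha v v)).

Definition seminorm (p : V -> R) :=
  (forall v w, p (v + w) <= p v + p w) /\
  (forall a v, p (a *: v) = complex.Re `|a| * p v).

Definition hilbert_seminorms_cofinal := forall p : V -> R,
  seminorm p -> continuous p ->
  exists alpha : herm_form, forall v, p v <= herm_norm alpha v.

Definition hilbert_schmidt (b : {biscalar V}) := exists alpha : herm_form,
  (forall v w, herm_norm alpha v = 0 \/ herm_norm alpha w = 0 -> b v w = 0) /\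
  (forall d (e : 'I_d -> V), (forall i j, alpha (e i) (e j) = (i == j)%:R) ->
     \sum_(i < d) \sum_(j < d) `|b (e i) (e j)| ^+ 2 <= 1).

Definition continuous_bilinear (L : {biscalar V}) :=
  continuous (fun p : V * V => L p.1 p.2 : C^o).

Section TensorForm.
Variable alpha : herm_form.

Definition herm_word (s t : seq V) : C :=
  if size s == size t
  then (size s)`!%:R * \prod_(p <- zip s t) alpha p.1 p.2 else 0.

(* [tlift] extends linearly, while the form is antilinear in its first
   argument, whence the two conjugations. *)
Definition tensor_herm (X Y : tensor V) : C :=
  (tlift (fun s => (tlift (herm_word s : seq V -> C^o) Y)^* : C^o) X)^*.

Lemma herm_word_sym s t : herm_word t s = (herm_word s t)^*.
Proof.
rewrite /herm_word [RHS]fun_if rmorph0 rmorphM rmorph_nat rmorph_prod /=.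
rewrite [size t == _]eq_sym; case: eqP => // st; congr (_ * _); first by rewrite st.
elim: s t st => [|x s IH] [|y t] //=; first by rewrite !big_nil.
by move=> [st]; rewrite !big_cons IH//= herm_sym.
Qed.

Lemma herm_word_multilinear s : multilinear (herm_word s : seq V -> C^o).
Proof.
move=> t u a x y; rewrite /herm_word !size_cat /=.
case: eqP => [st|_]; last by rewrite scaler0 addr0.
have st' : (size t < size s)%N by rewrite st addnS ltnS leq_addr.
rewrite -(cat_take_drop (size t) s) (drop_nth 0 st').
rewrite !zip_cat ?size_take ?st'//= !big_cat /= !big_cons /=.
rewrite herm_linear /GRing.scale /= !(mulrDl, mulrDr).
by congr (_ + _); rewrite -!mulrA !(mulrCA a).
Qed.

Let herm_word_antilinear Y :
  multilinear (fun s => (tlift (herm_word s : seq V -> C^o) Y)^* : C^o).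
Proof.
move=> t u a x y; elim/tensor_ind: Y => [|c w Y IH].
  have h0 s : tlift (herm_word s : seq V -> C^o) 0 = 0.
    have := tlift_is_linear (herm_word_multilinear s) (-1) 0 0.
    by rewrite scaler0 addr0 scaleN1r => ->; rewrite addNr.
  by rewrite !h0 rmorph0 scaler0 addr0.
rewrite !(tlift_is_linear (herm_word_multilinear _)).
rewrite !(tlift_word (herm_word_multilinear _)).
have conjD (z z' : C) : (z + z')^* = z^* + z'^* by exact: rmorphD.
have conjZ (z z' : C) : (z *: (z' : C^o) : C)^* = z^* * z'^* by exact: rmorphM.
rewrite !conjD !conjZ IH -!herm_word_sym herm_word_multilinear.
rewrite /GRing.scale /= !mulrDr (mulrCA a) !addrA; congr (_ + _).
by rewrite addrAC.
Qed.

Lemma tensor_herm_word s t : tensor_herm (word s) (word t) = herm_word s t.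
Proof.
rewrite /tensor_herm (tlift_word (herm_word_antilinear _)) conjCK.
exact: (tlift_word (herm_word_multilinear s)).
Qed.

Lemma tensor_herm_antilinear a X Y Z :
  tensor_herm (a *: X + Y) Z = a^* * tensor_herm X Z + tensor_herm Y Z.
Proof.
have conjD (z z' : C) : (z + z')^* = z^* + z'^* by exact: rmorphD.
have conjZ (z z' : C) : (z *: (z' : C^o) : C)^* = z^* * z'^* by exact: rmorphM.
by rewrite /tensor_herm (tlift_is_linear (herm_word_antilinear Z)) conjD conjZ.
Qed.

Lemma tensor_herm_linear X : linear (tensor_herm X : tensor V -> C^o).
Proof.
move=> a Y Z; elim/tensor_ind: X => [|c w X IH].
  have h0 U : tensor_herm 0 U = 0.
    have := tensor_herm_antilinear (-1) 0 0 U.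
    by rewrite scaler0 addr0 rmorphN rmorph1 mulN1r addNr.
  by rewrite !h0 scaler0 addr0.
rewrite !tensor_herm_antilinear IH /tensor_herm.
rewrite !(tlift_word (herm_word_antilinear _)) !conjCK.
rewrite (tlift_is_linear (herm_word_multilinear w)) /GRing.scale /=.
by rewrite !mulrDr (mulrCA a) !addrA; congr (_ + _); rewrite addrAC.
Qed.

Lemma tensor_herm_sym X Y : tensor_herm Y X = (tensor_herm X Y)^*.
Proof.
have conjD (z z' : C) : (z + z')^* = z^* + z'^* by exact: rmorphD.
have conjM (z z' : C) : (z * z')^* = z^* * z'^* by exact: rmorphM.
have h0l U : tensor_herm 0 U = 0.
  have := tensor_herm_antilinear (-1) 0 0 U.
  by rewrite scaler0 addr0 rmorphN rmorph1 mulN1r addNr.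
have h0r U : tensor_herm U 0 = 0.
  have := tensor_herm_linear U (-1) 0 0.
  by rewrite scaler0 addr0 scaleN1r => ->; rewrite addNr.
elim/tensor_ind: X Y => [|a s X IH] Y; first by rewrite h0l h0r rmorph0.
rewrite tensor_herm_antilinear tensor_herm_linear IH conjD conjM conjCK.
congr (_ * _ + _); elim/tensor_ind: Y => [|c t Y IHY].
  by rewrite h0l h0r rmorph0.
rewrite tensor_herm_antilinear tensor_herm_linear IHY conjD conjM.
by rewrite !tensor_herm_word herm_word_sym.
Qed.

Definition tensor_norm (X : tensor V) : R :=
  Num.sqrt (complex.Re (tensor_herm X X)).

End TensorForm.

Definition tensor_balls : set (set (tensor V)) :=
  [set U | exists (alpha : herm_form) (X : tensor V) (r : R),
     0 < r /\ U = [set Y | tensor_norm alpha (Y - X) < r]].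

HB.instance Definition _ :=
  isSubBaseTopological.Build (tensor V) tensor_balls id.

HB.instance Definition _ :=
  Topological.copy (symtensor V)
    (initial_topology (val : symtensor V -> tensor V)).

End HilbertSeminorms.

Section Completion.
Variables (R : realType) (S : preTopologicalLmodType R[i]) (E : tvsType R[i]).
Local Notation C := R[i].

(* Cauchy filters are taken with respect to the neighbourhoods of 0: a
   [tvsType] may carry entourages that are not translation invariant. *)
Definition tvs_complete := forall F : set_system E, ProperFilter F ->
  (forall U, nbhs (0 : E) U ->
     exists2 A, F A & forall x y, A x -> A y -> U (x - y)) ->
  exists l : E, F --> l.

(* [iota : S -> E] is a Hausdorff completion of the Hausdorff space S: a linear
   homeomorphism of S onto a dense subspace of a complete space. *)
Definition is_completion (iota : S -> E) :=
  [/\ linear iota, injective iota,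
      (forall X A, nbhs X A <->
         exists2 B, nbhs (iota X) B & iota @^-1` B `<=` A),
      closure (range iota) = [set: E] &
      hausdorff_space E /\ tvs_complete].

Definition extends_to (iota : S -> E) (f : S -> S) (g : E -> E) :=
  continuous g /\ forall X, g (iota X) = iota (f X).

Definition locally_uniform_cvg (s : nat -> C -> E) (F : C -> E) :=
  forall z0 : C, exists2 W : set C, nbhs (z0 : C^o) W &
    forall U, nbhs (0 : E) U ->
      \forall n \near \oo, forall z, W z -> U (s n z - F z).

Definition holomorphic (F : C -> E) := forall z : C, exists l : E,
  h^-1 *: (F (z + h) - F z) @[h --> (0 : C^o)^'] --> l.

Definition absolute_cvg (u : nat -> E) := forall p : E -> R,
  seminorm p -> continuous p -> cvgn (series (fun t => p (u t))).

End Completion.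

Definition lc_algebra_iso (K : numFieldType) (S : preTopologicalLmodType K)
    (m1 m2 : S -> S -> S) (f : S -> S) :=
  [/\ linear f, (forall X Y, f (m1 X Y) = m2 (f X) (f Y)), continuous f &
      exists g : S -> S, [/\ cancel f g, cancel g f & continuous g]].

Section AddBilinear.
Variables (K : fieldType) (V : lmodType K) (L b : {biscalar V}).

Definition add_form (v w : V) : K := L v w + b v w.

Lemma add_form_is_bilinear : bilinear_for *%R *%R add_form.
Proof.
split=> u a x y; rewrite /add_form.
  by rewrite (linearPl L u a x y) (linearPl b u a x y) /= mulrDr addrACA.
by rewrite (linearPr L u a x y) (linearPr b u a x y) /= mulrDr addrACA.
Qed.

HB.instance Definition _ :=
  bilinear_isBilinear.Build K V V K *%R *%R add_form add_form_is_bilinear.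

End AddBilinear.

(* Main.v *)
From mathcomp Require Import all_fingroup.
Require Import Defs.
From HB Require Import structures.
From mathcomp Require Import all_boot all_order all_algebra.
From mathcomp Require Import complex sesquilinear.
From mathcomp Require Import boolp classical_sets functions reals topology.
From mathcomp Require Import normedtype sequences.
From mathcomp Require Import fsbigop finmap ring lra.

Import Order.TTheory GRing.Theory Num.Theory numFieldNormedType.Exports.

Set Implicit Arguments.
Unset Strict Implicit.
Unset Printing Implicit Defensive.

Local Open Scope classical_set_scope.
Local Open Scope ring_scope.

(** The theorem rests on one inequality, obtained by comparing positive
    semi-definite kernels.

    Say that alpha bounds b if |b(X)|^2 <= <X|X> holds for all X in the tensor
    square of (V, alpha), that is, if the kernel
    alpha(x, x') alpha(y, y') - conj(b(x, y)) b(x', y') on V * V is positive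
    semi-definite ([bounds_bilinear]). A form is of Hilbert-Schmidt type iff
    some alpha bounds it: one direction is Gram-Schmidt and Cauchy-Schwarz
    ([hilbert_schmidt_bounds]), the other tests the bound on the tensor with
    coefficients conj(b(e_i, e_j)) ([bounds_hilbert_schmidt]).

    By the Schur product theorem ([psdM]) the comparison of kernels survives
    multiplication with the kernel of the remaining tensor factors. Hence
    |Delta X|^2 <= k (k - 1) / 4 |X|^2 in degree k, and after t steps
      |Delta^t X|_alpha / t! <= s^-t |X|_((1 + s) alpha)   for all s > 0,
    because C(2t, t) <= 4^t and C(k, 2t) s^2t <= (1 + s)^k ([iter_laplace_le]).
    With s >= 2 |z| the exponential series of z Delta is dominated by a
    geometric one. This gives the continuity of exp (z Delta), and the bounds on
    remainders behind the convergence statements. Conversely, the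
    exponential adds the scalar 2 b(x, y) to x (x) y + y (x) x, so continuity
    bounds b on symmetrised tensors, which suffices as b is symmetric
    ([explapS_continuous_bounds]).

    For the products, symmetric tensors are spanned by powers
    ([symmetric_span]), and on divided powers v^n / n! the operators Delta and
    P_Lambda are multiples of shifts of degree. They commute there, and
    Delta (X Y) is the symmetric product applied to
    (Delta (x) 1 + 1 (x) Delta + P_b) (X (x) Y) ([laplace_symmu]). The
    identity for the star products is then the functional equation of the
    exponential for commuting operators ([exp_add]); the same equation yields
    the inverse exp (- Delta).

    On a completion every continuous linear operator extends ([extension]), and
    the closures of the images of seminorm balls ([hull]) are a basis of
    neighbourhoods of 0, so each estimate on symmetric tensors carries over
    to the extended operators ([hull_map]). *)

(** * Positive semi-definite kernels *)

Section Kernels.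
Variable C : numClosedFieldType.

(** The coefficients travel with their points, so that a tensor given as a
    combination of words is itself an argument. *)
Definition qform (S : Type) (K : S -> S -> C) (l : seq (C * S)) : C :=
  \sum_(p <- l) \sum_(q <- l) p.1^* * q.1 * K p.2 q.2.

Definition psd (S : Type) (K : S -> S -> C) : Prop :=
  (forall x y, K y x = (K x y)^*) /\ forall l, 0 <= qform K l.

Lemma eq_qform (S : Type) (K1 K2 : S -> S -> C) l :
  (forall x y, K1 x y = K2 x y) -> qform K1 l = qform K2 l.
Proof. by move=> e; do 2!(apply: eq_bigr => ? _); rewrite e. Qed.

Lemma eq_psd (S : Type) (K1 K2 : S -> S -> C) :
  (forall x y, K1 x y = K2 x y) -> psd K1 -> psd K2.
Proof.
move=> e [h p]; split=> [x y|l]; first by rewrite -!e h.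
by rewrite -(eq_qform _ e).
Qed.

Lemma qformD (S : Type) (K1 K2 : S -> S -> C) l :
  qform (fun x y => K1 x y + K2 x y) l = qform K1 l + qform K2 l.
Proof.
rewrite /qform -big_split; apply: eq_bigr => p _; rewrite -big_split.
by apply: eq_bigr => q _; rewrite mulrDr.
Qed.

Lemma qformZ (S : Type) (K : S -> S -> C) c l :
  qform (fun x y => c * K x y) l = c * qform K l.
Proof.
rewrite /qform mulr_sumr; apply: eq_bigr => p _; rewrite mulr_sumr.
by apply: eq_bigr => q _; rewrite mulrCA.
Qed.

Lemma psdD (S : Type) (K1 K2 : S -> S -> C) :
  psd K1 -> psd K2 -> psd (fun x y => K1 x y + K2 x y).
Proof.
move=> [h1 p1] [h2 p2]; split=> [x y|l]; first by rewrite h1 h2 rmorphD.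
by rewrite qformD addr_ge0.
Qed.

Lemma psd_pull (S S' : Type) (f : S' -> S) (K : S -> S -> C) :
  psd K -> psd (fun x y => K (f x) (f y)).
Proof.
move=> [h p]; split=> [x y|l]; first by rewrite h.
have := p [seq (q.1, f q.2) | q <- l].
by rewrite /qform big_map; under eq_bigr do rewrite big_map.
Qed.

Lemma psd_scale (S : Type) (u : S -> C) (K : S -> S -> C) :
  psd K -> psd (fun x y => (u x)^* * u y * K x y).
Proof.
move=> [h p]; split=> [x y|l].
  by rewrite h !rmorphM /= conjCK [u x * _]mulrC.
have := p [seq (q.1 * u q.2, q.2) | q <- l].
rewrite /qform big_map; congr (_ <= _); apply: eq_bigr => p0 _.
rewrite big_map; apply: eq_bigr => q _ /=.
by rewrite rmorphM /=; ring.
Qed.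

Lemma qform_rank1 (S : Type) (u : S -> C) l :
  qform (fun x y => (u x)^* * u y) l = `|\sum_(q <- l) q.1 * u q.2| ^+ 2.
Proof.
rewrite normCKC rmorph_sum mulr_suml; apply: eq_bigr => p _.
rewrite mulr_sumr; apply: eq_bigr => q _.
by rewrite rmorphM /= mulrACA.
Qed.

Lemma psd_rank1 (S : Type) (u : S -> C) : psd (fun x y => (u x)^* * u y).
Proof.
split=> [x y|l]; first by rewrite rmorphM /= conjCK mulrC.
by rewrite qform_rank1 exprn_ge0.
Qed.

Lemma qform_cons (S : Type) (K : S -> S -> C) a x l :
  qform K ((a, x) :: l) = a^* * a * K x x + a^* * (\sum_(q <- l) q.1 * K x q.2)
    + (\sum_(q <- l) q.1^* * K q.2 x) * a + qform K l.
Proof.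
rewrite /qform big_cons /= big_cons /= -addrA -!addrA; congr (_ + _).
rewrite mulr_sumr; under eq_bigr do rewrite -mulrA.
congr (_ + _).
under eq_bigr do rewrite big_cons /=.
rewrite big_split /=; congr (_ + _).
by rewrite mulr_suml; apply: eq_bigr => q _; rewrite mulrAC.
Qed.

Lemma psd_diag_ge0 (S : Type) (K : S -> S -> C) x : psd K -> 0 <= K x x.
Proof.
move=> [_ /(_ [:: (1, x)])].
by rewrite /qform !big_seq1 /= conjC1 !mul1r.
Qed.

(** Along the points p and x with coefficients (- t K(p, x), 1) the form is affine
    in t with slope - 2 |K(p, x)|^2, hence negative for large t unless the slope
    vanishes. *)
Lemma psd_null (S : Type) (K : S -> S -> C) p x :
  psd K -> K p p = 0 -> K p x = 0.
Proof.
move=> pK Kp0; apply/eqP/negP => /negP Kpx.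
have Kx0 := psd_diag_ge0 x pK.
have [h p0] := pK.
pose k := `|K p x| ^+ 2; have k0 : 0 < k by rewrite exprn_gt0// normr_gt0.
(* this t makes the form equal to - (K x x + 2) *)
pose t := (K x x + 1) / k.
have tr : t^* = t.
  by apply/CrealP/ger0_real; rewrite divr_ge0 ?(ltW k0)// addr_ge0.
have := p0 [:: (- t * K p x, p); (1, x)].
rewrite qform_cons /qform !big_seq1 /= Kp0 mulr0 add0r conjC1 !mul1r.
rewrite rmorphM rmorphN /= tr (h p x).
have kE : t * ((K p x)^* * K p x) = K x x + 1.
  by rewrite -normCKC divfK ?gt_eqF.
rewrite (_ : _ + _ = - (t * ((K p x)^* * K p x)) *+ 2 + K x x); last by ring.
rewrite kE (_ : _ + _ = - (K x x + 2)); last by ring.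
rewrite oppr_ge0 => /le_gtF; suff -> : 0 < K x x + 2 by [].
by rewrite ltr_wpDl ?ltr0n.
Qed.

(** Completion of the square: the coefficient given to p is the minimizing one. *)
Lemma qform_schur (S : Type) (K : S -> S -> C) p l : psd K -> K p p != 0 ->
  qform (fun x y => K x y - K x p * K p y / K p p) l =
  qform K ((- (\sum_(q <- l) q.1 * K p q.2) / K p p, p) :: l).
Proof.
move=> pK Kp0; have [h _] := pK.
set A := \sum_(q <- l) _.
have AJ : \sum_(q <- l) q.1^* * K q.2 p = A^*.
  by rewrite rmorph_sum; apply: eq_bigr => q _; rewrite rmorphM /= h.
have KpJ : (K p p)^* = K p p by rewrite -h.
rewrite qform_cons -/A AJ rmorphM rmorphN fmorphV /= KpJ.
rewrite (eq_qform (K2 := fun x y =>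
    K x y + - (K p p)^-1 * ((K p x)^* * K p y))); last first.
  by move=> x y; rewrite -h mulNr [_^-1 * _]mulrC.
rewrite qformD qformZ qform_rank1 -/A normCKC.
by field.
Qed.

Lemma psd_cauchy_schwarz (S : Type) (K : S -> S -> C) x y : psd K ->
  `|K x y| ^+ 2 <= K x x * K y y.
Proof.
move=> pK; have [Kx0|Kx0] := eqVneq (K x x) 0.
  by rewrite psd_null// Kx0 normr0 expr0n mul0r.
have Kx : 0 < K x x by rewrite lt_def Kx0 psd_diag_ge0.
have := pK.2 ((- (\sum_(q <- [:: (1, y)]) q.1 * K x q.2) / K x x, x) :: [:: (1, y)]).
rewrite -qform_schur// /qform !big_seq1 /= conjC1 !mul1r subr_ge0.
by rewrite ler_pdivrMr// (pK.1 x y) -normCKC mulrC.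
Qed.

(** Positivity involves finitely many points at a time, so a kernel may be
    replaced by a different expression on every finite set. *)
Lemma psd_local (S : eqType) (K : S -> S -> C) :
  (forall l : seq S, exists2 K', psd K' & {in l &, forall x y, K x y = K' x y}) ->
  psd K.
Proof.
move=> loc; split=> [x y|l].
  have [K' pK' KE] := loc [:: x; y].
  by rewrite !KE ?inE ?eqxx ?orbT// pK'.1.
have [K' pK' KE] := loc [seq q.2 | q <- l].
have -> : qform K l = qform K' l; last exact: pK'.2.
rewrite /qform !big_seq; apply: eq_bigr => p pl.
rewrite !big_seq; apply: eq_bigr => q ql.
by rewrite KE//; apply: map_f.
Qed.

Lemma psdB_le (S : Type) (K1 K2 : S -> S -> C) l :
  psd (fun x y => K2 x y - K1 x y) -> qform K1 l <= qform K2 l.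
Proof.
move=> [_ p0]; rewrite -subr_ge0.
suff <- : qform (fun x y => K2 x y - K1 x y) l = qform K2 l - qform K1 l by [].
transitivity (qform (fun x y => K2 x y + -1 * K1 x y) l).
  by apply: eq_qform => x y; rewrite mulN1r.
by rewrite qformD (qformZ K1) mulN1r.
Qed.

(** Cholesky factorization, one point at a time. A treated point is null for the
    kernel that remains, so the later factors may be set to 0 there. *)
Lemma psd_gram (S : eqType) (K : S -> S -> C) (L : seq S) : psd K ->
  exists F : seq (S -> C), forall x y, x \in L -> y \in L ->
    K x y = \sum_(f <- F) (f x)^* * f y.
Proof.
elim: L K => [|p L IH] K pK; first by exists [::].
have [h _] := pK.
have [Kp0|Kp0] := eqVneq (K p p) 0.
  have [F FE] := IH _ pK.
  exists [seq (fun x => if x == p then 0 else f x) | f <- F] => x y.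
  rewrite !inE big_map; have [->|xp] /= := eqVneq x p.
    by move=> _ _; rewrite psd_null// big1// => f _; rewrite conjC0 mul0r.
  have [->|yp] /= := eqVneq y p.
    move=> _ _; rewrite h psd_null// conjC0 big1// => f _.
    by rewrite mulr0.
  by move=> xL yL; rewrite FE.
pose K' x y := K x y - K x p * K p y / K p p.
have pK' : psd K'.
  split=> [x y|l]; last by rewrite qform_schur//; exact: pK.2.
  rewrite /K' rmorphB !rmorphM fmorphV /= -!h; congr (_ - _ / _).
  exact: mulrC.
have [F FE] := IH _ pK'.
have K'p y : K' p y = 0 by rewrite /K' mulrAC divff// mul1r subrr.
have K'p' x : K' x p = 0 by rewrite pK'.1 K'p conjC0.
have r0 : 0 <= K p p := psd_diag_ge0 p pK.
pose g x := K p x / sqrtC (K p p).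
exists (g :: [seq (fun x => if x == p then 0 else f x) | f <- F]) => x y xL yL.
rewrite big_cons big_map.
have -> : (g x)^* * g y = K x p * K p y / K p p.
  rewrite /g rmorphM /= -h fmorphV /= (conj_Creal (ger0_real _)) ?sqrtC_ge0//.
  by rewrite mulrACA -invfM -expr2 sqrtCK.
rewrite [LHS](_ : _ = K x p * K p y / K p p + K' x y); last first.
  by rewrite /K' addrC subrK.
congr (_ + _).
move: xL yL; rewrite !inE; have [->|xp] /= := eqVneq x p.
  by move=> _ _; rewrite K'p big1// => f _; rewrite conjC0 mul0r.
have [->|yp] /= := eqVneq y p.
  by move=> _ _; rewrite K'p' big1// => f _; rewrite mulr0.
exact: FE.
Qed.

(** The Schur product theorem: factoring K1 on the points in play turns K1 K2
    into a sum of kernels conj(f x) f y K2 x y. *)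
Lemma psdM (S : eqType) (K1 K2 : S -> S -> C) :
  psd K1 -> psd K2 -> psd (fun x y => K1 x y * K2 x y).
Proof.
move=> p1 p2; split=> [x y|l]; first by rewrite p1.1 p2.1 rmorphM.
have [F FE] := psd_gram [seq q.2 | q <- l] p1.
have -> : qform (fun x y => K1 x y * K2 x y) l =
    \sum_(f <- F) qform (fun x y => (f x)^* * f y * K2 x y) l.
  rewrite /qform [RHS]exchange_big /= !big_seq; apply: eq_bigr => p pl.
  rewrite [RHS]exchange_big /= !big_seq; apply: eq_bigr => q ql.
  rewrite -mulr_sumr -mulr_suml; congr (_ * (_ * _)).
  by apply: FE; apply: map_f.
apply: sumr_ge0 => f _; exact: (psd_scale f p2).2.
Qed.

Section WordKernel.
Variable U : choiceType.
Implicit Types (k : U -> U -> C) (s t : seq U).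

(** The form induced by k on all tensor powers at once, up to the factors k! of
    [herm_word]. *)
Fixpoint word_ker k s t : C :=
  match s, t with
  | [::], [::] => 1
  | x :: s', y :: t' => k x y * word_ker k s' t'
  | _, _ => 0
  end.

(** The truncation of [word_ker] at length n, written as sums and products of
    pulled-back kernels so that [psdD], [psdM] and [psd_pull] apply. *)
Fixpoint word_ker_upto (u0 : U) k n s t : C :=
  let: b0 := (nilp s)%:R^* * (nilp t)%:R in
  if n isn't n'.+1 then b0 else
  b0 + (~~ nilp s)%:R^* * (~~ nilp t)%:R *
    (k (head u0 s) (head u0 t) * word_ker_upto u0 k n' (behead s) (behead t)).

Lemma word_ker_uptoE u0 k n s t :
  (size s <= n)%N -> word_ker_upto u0 k n s t = word_ker k s t.
Proof.
elim: n s t => [|n IH] [|x s] [|y t] //= sn;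
  rewrite ?(conjC0, conjC1, mul0r, mulr0, mul1r, addr0, add0r)//.
by rewrite IH.
Qed.

Lemma psd_word_ker_upto u0 k n : psd k -> psd (word_ker_upto u0 k n).
Proof.
move=> pk; elim: n => [|n IH]; first exact: psd_rank1.
apply: psdD; first exact: psd_rank1.
apply: psd_scale; apply: psdM; first exact: psd_pull.
exact: psd_pull.
Qed.

Lemma psd_word_ker (u0 : U) k : psd k -> psd (word_ker k).
Proof.
move=> pk; apply: psd_local => l.
exists (word_ker_upto u0 k (\max_(s <- l) size s)); first exact: psd_word_ker_upto.
by move=> s t sl tl; rewrite word_ker_uptoE// (leq_bigmax_seq s).
Qed.

(** Telescoping: k2 K2 - k1 K1 = (k2 - k1) K2 + k1 (K2 - K1), where K1 and K2 are
    the kernels of the remaining letters. *)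
Lemma psd_word_kerB (u0 : U) k1 k2 : psd k1 -> psd k2 ->
  psd (fun x y => k2 x y - k1 x y) ->
  psd (fun s t => word_ker k2 s t - word_ker k1 s t).
Proof.
move=> p1 p2 p12; apply: psd_local => l.
have [n nl] : exists n, forall s, s \in l -> (size s <= n)%N.
  by exists (\max_(s <- l) size s)%N => s sl; rewrite (leq_bigmax_seq s).
exists (fun s t => word_ker_upto u0 k2 n s t - word_ker_upto u0 k1 n s t); last first.
  by move=> s t sl tl; rewrite !word_ker_uptoE// nl.
elim: n {nl} => [|n IH].
  apply: (eq_psd (K1 := fun _ _ => 0^* * 0)); last exact: (psd_rank1 (fun=> 0)).
  by move=> s t /=; rewrite mulr0 subrr.
apply: (eq_psd (K1 := fun s t => (~~ nilp s)%:R^* * (~~ nilp t)%:R *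
    ((k2 (head u0 s) (head u0 t) - k1 (head u0 s) (head u0 t)) *
       word_ker_upto u0 k2 n (behead s) (behead t) +
     k1 (head u0 s) (head u0 t) * (word_ker_upto u0 k2 n (behead s) (behead t) -
       word_ker_upto u0 k1 n (behead s) (behead t))))).
  by move=> s t /=; ring.
apply: psd_scale; apply: psdD; apply: psdM.
- exact: (psd_pull (head u0) p12).
- exact/(psd_pull behead)/psd_word_ker_upto.
- exact: (psd_pull (head u0) p1).
- exact: (psd_pull behead IH).
Qed.

Lemma word_ker_size k s t : size s != size t -> word_ker k s t = 0.
Proof.
elim: s t => [|x s IH] [|y t] //=; rewrite eqSS => st.
by rewrite IH// mulr0.
Qed.

(** As K vanishes between words of different lengths, h (size s) may be split as
    sqrt (h (size s)) sqrt (h (size t)). *)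
Lemma psd_weighted (K : seq U -> seq U -> C) (h : nat -> C) :
  (forall s t, size s != size t -> K s t = 0) -> psd K ->
  (forall n, 0 <= h n) -> psd (fun s t => h (size s) * K s t).
Proof.
move=> K0 pK h0; apply: eq_psd (psd_scale (fun s => sqrtC (h (size s))) pK).
move=> s t; have [st|/K0 ->] := eqVneq (size s) (size t); last by rewrite !mulr0.
rewrite (conj_Creal (ger0_real _)) ?sqrtC_ge0// st.
by rewrite -expr2 sqrtCK.
Qed.

Lemma word_kerZ k c s t :
  word_ker (fun x y => c * k x y) s t = c ^+ size s * word_ker k s t.
Proof.
elim: s t => [|x s IH] [|y t] //=; rewrite ?mulr0 ?mulr1//.
by rewrite IH exprS mulrACA.
Qed.

End WordKernel.

End Kernels.

(** * Hermitian forms on tensors and the one-step Laplace estimate *)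

Section LinearBasics.
Variables (K : fieldType) (M N : lmodType K) (f : M -> N).
Hypothesis fl : linear f.

Lemma lin0 : f 0 = 0.
Proof. by move: (fl (-1) 0 0); rewrite scaler0 addr0 scaleN1r addNr. Qed.

Lemma linD x y : f (x + y) = f x + f y.
Proof. by rewrite -[x in LHS]scale1r fl scale1r. Qed.

Lemma linZ a x : f (a *: x) = a *: f x.
Proof. by rewrite -[a *: x]addr0 fl lin0 addr0. Qed.

Lemma linB x y : f (x - y) = f x - f y.
Proof. by rewrite linD -scaleN1r linZ scaleN1r. Qed.

Lemma lin_sum (I : Type) (r : seq I) (P : pred I) (F : I -> M) :
  f (\sum_(i <- r | P i) F i) = \sum_(i <- r | P i) f (F i).
Proof. exact: (big_morph f linD lin0). Qed.

End LinearBasics.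

Definition lincomb (K : fieldType) (M : lmodType K) (l : seq (K * M)) : M :=
  \sum_(q <- l) q.1 *: q.2.

Section TensorLists.
Variables (K : fieldType) (V : lmodType K).

Definition tens (l : seq (K * seq V)) : tensor V :=
  lincomb [seq (p.1, word p.2) | p <- l].

Lemma tens_surj X : exists l, X = tens l.
Proof.
elim/tensor_ind: X => [|a s X [l ->]]; first by exists [::]; rewrite /tens /lincomb big_nil.
by exists ((a, s) :: l); rewrite /tens /lincomb big_cons.
Qed.

(** Written with [head], so that words of all lengths are treated alike; below
    length 2 the numerical factor vanishes. *)
Definition laplace_coef (b : {biscalar V}) (s : seq V) : K :=
  (size s * (size s).-1)%:R / 2 * b (head 0 s) (head 0 (behead s)).

Definition laplace_pair (b : {biscalar V}) (p : K * seq V) : K * seq V :=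
  (p.1 * laplace_coef b p.2, behead (behead p.2)).

Lemma laplace_tens b l : laplace b (tens l) = tens (map (laplace_pair b) l).
Proof.
rewrite /tens /lincomb (lin_sum (laplace_is_linear b)) !big_map.
apply: eq_bigr => -[a s] _; rewrite (linZ (laplace_is_linear b)) /=.
case: s => [|x1 [|x2 s]].
- by rewrite laplace_word_small// /laplace_coef /= !mul0r mulr0 scaler0 scale0r.
- by rewrite laplace_word_small// /laplace_coef /= !mul0r mulr0 scaler0 scale0r.
by rewrite laplace_word_cons2 scalerA.
Qed.

Lemma iter_laplace_tens b t l :
  iter t (laplace b) (tens l) = tens (iter t (map (laplace_pair b)) l).
Proof. by elim: t => //= t ->; rewrite laplace_tens. Qed.

End TensorLists.

Section SesquilinearForm.
Variables (K : numClosedFieldType) (M : lmodType K) (k : M -> M -> K).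
Hypothesis kl : forall x, linear (k x : M -> K^o).
Hypothesis ks : forall x y, k y x = (k x y)^*.

Lemma sesqui_qform (l : seq (K * M)) :
  k (lincomb l) (lincomb l) = qform k l.
Proof.
rewrite ks /lincomb (lin_sum (kl _)) rmorph_sum; apply: eq_bigr => p _.
rewrite (linZ (kl _)) rmorphM /= -ks (lin_sum (kl _)) mulr_sumr.
by apply: eq_bigr => q _; rewrite (linZ (kl _)) mulrA.
Qed.

End SesquilinearForm.

Section LaplaceWeight.
Variable F : numFieldType.

(** How a weight h on the degrees changes when one Laplace step is absorbed into
    it, see [qform_laplace_le]. *)
Definition laplace_weight (h : nat -> F) (k : nat) : F :=
  ((k * k.-1)%:R / 2) ^+ 2 * h k.-2.

Lemma laplace_weight_ge0 h : (forall k, 0 <= h k) -> forall k, 0 <= laplace_weight h k.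
Proof. by move=> h0 k; rewrite mulr_ge0// exprn_ge0// divr_ge0. Qed.

Lemma iter_laplace_weight t k :
  iter t laplace_weight (fun n => n`!%:R) k = k`!%:R * (k ^_ t.*2)%:R / 4 ^+ t.
Proof.
elim: t k => [|t IH] k; first by rewrite /= ffactn0 expr0 mulr1 divr1.
rewrite iterS /laplace_weight IH; case: k => [|[|k]].
- by rewrite !mul0r expr0n mul0r doubleS ffact0n mulr0 mul0r.
- by rewrite /= muln0 !mul0r expr0n mul0r doubleS ffactSS ffact0n muln0 mulr0 mul0r.
rewrite /= doubleS 2!ffactSS 2!factS !natrM [4 ^+ t.+1]exprS.
have : (4 ^+ t : F) != 0 by rewrite expf_neq0// pnatr_eq0.
by move=> ?; field.
Qed.

Lemma central_binomial_le t : ((t.*2)`! <= 4 ^ t * (t`! * t`!))%N.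
Proof.
have tt : (t <= t.*2)%N by rewrite -addnn leq_addr.
rewrite -(bin_fact tt) -addnn addnK leq_mul// addnn.
have -> : (4 ^ t = 2 ^ t.*2)%N by rewrite -mul2n expnM.
rewrite -[2%N]/(1 + 1)%N expnDn.
have lt2 : (t < (t.*2).+1)%N by rewrite ltnS.
rewrite (bigD1 (Ordinal lt2))//= !exp1n !muln1.
exact: leq_addr.
Qed.

Lemma binomial_term_le (s : F) n k : 0 <= s -> 'C(n, k)%:R * s ^+ k <= (1 + s) ^+ n.
Proof.
move=> s0; have [kn|nk] := leqP k n; last by rewrite bin_small// mul0r exprn_ge0// addr_ge0.
rewrite exprDn (bigD1 (inord k))//= inordK ?ltnS// expr1n mul1r mulr_natl lerDl.
by apply: sumr_ge0 => i _; rewrite mulrn_wge0// mulr_ge0// ?exprn_ge0.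
Qed.

(** The free parameter s trades the growth in the degree k, through
    C(k, 2t) <= s^-2t (1 + s)^k, for a factor that is geometric in t. *)
Lemma iter_laplace_weight_le s t k : 0 < s ->
  iter t laplace_weight (fun n => n`!%:R) k <=
    (t`!%:R / s ^+ t) ^+ 2 * (k`!%:R * (1 + s) ^+ k).
Proof.
move=> s0; rewrite iter_laplace_weight mulrCA -mulrA ler_wpM2l//.
have -> : (k ^_ t.*2)%:R / 4 ^+ t =
    ((t.*2)`!%:R / 4 ^+ t) * ('C(k, t.*2)%:R * s ^+ t.*2 / s ^+ t.*2) :> F.
  rewrite -bin_ffact natrM; field.
  by rewrite !expf_neq0 ?gt_eqF.
have -> : (t`!%:R / s ^+ t) ^+ 2 * (1 + s) ^+ k =
    (t`! * t`!)%:R * ((1 + s) ^+ k / s ^+ t.*2) :> F.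
  rewrite -addnn exprD natrM; field.
  by rewrite expf_neq0// gt_eqF.
apply: ler_pM.
- by rewrite divr_ge0// exprn_ge0.
- by rewrite divr_ge0 ?exprn_ge0 ?(ltW s0)// mulr_ge0// exprn_ge0 ?(ltW s0).
- rewrite ler_pdivrMr ?exprn_gt0 ?ltr0n// -natrX -natrM ler_nat mulnC.
  exact: central_binomial_le.
rewrite ler_pM2r ?invr_gt0 ?exprn_gt0//.
exact/binomial_term_le/ltW.
Qed.

End LaplaceWeight.

Section HermForms.
Variables (R : realType) (V : tvsType R[i]).
Local Notation C := R[i].
Implicit Types (alpha beta gamma : herm_form V) (X Y : tensor V).

Lemma herm_suml alpha (I : Type) (r : seq I) (F : I -> V) y :
  alpha (\sum_(i <- r) F i) y = \sum_(i <- r) alpha (F i) y.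
Proof.
rewrite herm_sym (lin_sum (herm_linear alpha y)) rmorph_sum.
by apply: eq_bigr => i _; rewrite /= -herm_sym.
Qed.

Lemma hermZl alpha a x y : alpha (a *: x) y = a^* * alpha x y.
Proof.
by rewrite herm_sym (linZ (herm_linear alpha y)) rmorphM /= -herm_sym.
Qed.

Lemma hermZr alpha a x y : alpha x (a *: y) = a * alpha x y.
Proof. by rewrite (linZ (herm_linear alpha x)). Qed.

Lemma herm_sumr alpha (I : Type) (r : seq I) (F : I -> V) x :
  alpha x (\sum_(i <- r) F i) = \sum_(i <- r) alpha x (F i).
Proof. exact: (lin_sum (herm_linear alpha x)). Qed.

Lemma psd_herm alpha : psd (alpha : V -> V -> C).
Proof.
split=> [x y|l]; first exact: herm_sym.
by rewrite -(sesqui_qform (herm_linear alpha) (@herm_sym _ _ alpha)) herm_ge0.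
Qed.

Lemma herm_wordE alpha s t :
  herm_word alpha s t = (size s)`!%:R * word_ker alpha s t.
Proof.
rewrite /herm_word; case: eqP => [st|/eqP/word_ker_size ->]; last by rewrite mulr0.
congr (_ * _); elim: s t st => [|x s IH] [|y t] //=; first by rewrite big_nil.
by move=> [st]; rewrite big_cons IH.
Qed.

Lemma tensor_herm_lincomb alpha (l : seq (C * tensor V)) :
  tensor_herm alpha (lincomb l) (lincomb l) = qform (tensor_herm alpha) l.
Proof.
exact: (sesqui_qform (tensor_herm_linear alpha) (tensor_herm_sym alpha)).
Qed.

Lemma tensor_herm_tens alpha (l : seq (C * seq V)) :
  tensor_herm alpha (tens l) (tens l) = qform (herm_word alpha) l.
Proof.
rewrite tensor_herm_lincomb /qform big_map; apply: eq_bigr => p _.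
by rewrite big_map; apply: eq_bigr => q _; rewrite /= tensor_herm_word.
Qed.

Lemma psd_weighted_herm alpha (h : nat -> C) : (forall n, 0 <= h n) ->
  psd (fun s t => h (size s) * word_ker alpha s t).
Proof.
apply: psd_weighted => [s t /word_ker_size -> //|].
by apply: psd_word_ker; [exact: 0|exact: psd_herm].
Qed.

Lemma psd_herm_word alpha : psd (herm_word alpha).
Proof.
apply: (eq_psd _ (psd_weighted_herm alpha (h := fun n => n`!%:R) _)) => [s t|n].
  by rewrite herm_wordE.
exact: ler0n.
Qed.

Lemma psd_tensor_herm alpha : psd (tensor_herm alpha).
Proof.
split=> [X Y|l]; first exact: tensor_herm_sym.
rewrite -tensor_herm_lincomb; have [m ->] := tens_surj (lincomb l).
by rewrite tensor_herm_tens; exact: (psd_herm_word alpha).2.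
Qed.

Lemma tensor_herm_ge0 alpha X : 0 <= tensor_herm alpha X X.
Proof. exact: (psd_diag_ge0 X (psd_tensor_herm alpha)). Qed.

Section LaplaceBound.
Variables (b : {biscalar V}) (alpha : herm_form V).

(** The functional b has norm at most 1 on the tensor square of (V, alpha): on a
    combination of pairs the second kernel evaluates to |b(X)|^2, the first one
    to the square of the norm of X. *)
Definition bounds_bilinear := psd (fun p q : V * V =>
  alpha p.1 q.1 * alpha p.2 q.2 - (b p.1 p.2)^* * b q.1 q.2).

Hypothesis ab : bounds_bilinear.

(** The bound on b concerns the first two letters; by the Schur product theorem it
    may be multiplied by the kernel of the other letters. *)
Lemma qform_laplace_le (h : nat -> C) (l : seq (C * seq V)) :
  (forall n, 0 <= h n) ->
  qform (fun s t => h (size s) * word_ker alpha s t) (map (laplace_pair b) l) <=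
  qform (fun s t => laplace_weight h (size s) * word_ker alpha s t) l.
Proof.
move=> h0; pose rest (s : seq V) := behead (behead s).
have -> : qform (fun s t => h (size s) * word_ker alpha s t) (map (laplace_pair b) l) =
  qform (fun s t => (laplace_coef b s)^* * laplace_coef b t *
     (h (size (rest s)) * word_ker alpha (rest s) (rest t))) l.
  rewrite /qform big_map; apply: eq_bigr => p _; rewrite big_map; apply: eq_bigr => q _.
  by rewrite /= rmorphM /=; ring.
apply: psdB_le.
pose u (s : seq V) : C := (size s * (size s).-1)%:R / 2.
pose pr (s : seq V) := (head 0 s, head 0 (behead s)).
have pW := psd_weighted_herm alpha h0.
apply: eq_psd (psd_scale u (psdM (psd_pull pr ab) (psd_pull rest pW))) => s t /=.
have uJ w : (u w)^* = u w.
  by apply: conj_Creal; rewrite ger0_real// divr_ge0.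
have coefE w : laplace_coef b w = u w * b (pr w).1 (pr w).2 by [].
rewrite uJ !coefE [(u s * _)^*]rmorphM /= uJ.
have [st|st] := eqVneq (size s) (size t); last first.
  rewrite [word_ker alpha s t]word_ker_size// mulr0 sub0r.
  case: s st => [|x1 [|x2 s]] st; rewrite ?[u [::]]mul0r ?[u [:: _]]mul0r ?(mul0r, oppr0)//.
  case: t st => [|y1 [|y2 t]] st; rewrite ?[u [::]]mul0r ?[u [:: _]]mul0r ?(mul0r, mulr0, oppr0)//.
  by rewrite [word_ker _ _ _]word_ker_size ?(mulr0, oppr0).
rewrite /laplace_weight -/(u s).
have -> : u t = u s by rewrite /u st.
case: s t st => [|x1 [|x2 s]] [|y1 [|y2 t]] //= st;
  rewrite ?[u [::]]mul0r ?[u [:: _]]mul0r ?(mul0r, expr0n, oppr0, subr0)//=.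
by ring.
Qed.

End LaplaceBound.

End HermForms.

(** * Seminorms on the tensor algebra *)

Section Norms.
Variables (R : realType) (V : tvsType R[i]).
Local Notation C := R[i].
Local Notation "x %:C" := (real_complex R x).
Implicit Types (alpha beta gamma : herm_form V) (X Y : tensor V).

Section Forms.
Variables alpha beta : herm_form V.

Let add_fun (v w : V) : C := alpha v w + beta v w.

Let add_fun_linear v : linear (add_fun v : V -> C^o).
Proof.
move=> a x y; rewrite /add_fun !herm_linear /GRing.scale /=; ring.
Qed.

Let add_fun_sym v w : add_fun w v = (add_fun v w)^*.
Proof. by rewrite /add_fun rmorphD /= -!herm_sym. Qed.

Let add_fun_ge0 v : 0 <= add_fun v v.
Proof. by rewrite addr_ge0// herm_ge0. Qed.

Let add_fun_continuous : continuous (fun p : V * V => add_fun p.1 p.2 : C^o).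
Proof.
move=> p; apply: (@cvgD C C^o).
  exact: (@herm_continuous _ _ alpha).
exact: (@herm_continuous _ _ beta).
Qed.

Definition herm_add : herm_form V :=
  HermForm add_fun_linear add_fun_sym add_fun_ge0 add_fun_continuous.

Variable c : R.
Hypothesis c0 : 0 <= c.

Let scale_fun (v w : V) : C := c%:C * alpha v w.

Let scale_fun_linear v : linear (scale_fun v : V -> C^o).
Proof.
move=> a x y; rewrite /scale_fun !herm_linear /GRing.scale /=; ring.
Qed.

Let scale_fun_sym v w : scale_fun w v = (scale_fun v w)^*.
Proof.
rewrite /scale_fun rmorphM /= -herm_sym; congr (_ * _).
by rewrite conj_Creal// ger0_real// ler0c.
Qed.

Let scale_fun_ge0 v : 0 <= scale_fun v v.
Proof. by rewrite mulr_ge0 ?ler0c// herm_ge0. Qed.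

Let scale_fun_continuous : continuous (fun p : V * V => scale_fun p.1 p.2 : C^o).
Proof.
move=> p; apply: (@cvgM C); [exact: cvg_cst|exact: (@herm_continuous _ _ alpha)].
Qed.

Definition herm_scale : herm_form V :=
  HermForm scale_fun_linear scale_fun_sym scale_fun_ge0 scale_fun_continuous.

End Forms.

Lemma tensor_norm_ge0 alpha X : 0 <= tensor_norm alpha X.
Proof. exact: sqrtr_ge0. Qed.

Lemma tensor_norm_sqr alpha X : (tensor_norm alpha X ^+ 2)%:C = tensor_herm alpha X X.
Proof.
have h0 := tensor_herm_ge0 alpha X.
by rewrite /tensor_norm sqr_sqrtr ?RRe_real ?ger0_real// -ler0c RRe_real// ger0_real.
Qed.

Lemma tensor_norm_le alpha gamma X Y c : 0 <= c ->
  tensor_herm alpha X X <= (c ^+ 2)%:C * tensor_herm gamma Y Y ->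
  tensor_norm alpha X <= c * tensor_norm gamma Y.
Proof.
move=> c0; rewrite -!tensor_norm_sqr -rmorphM /= lecR -exprMn.
by rewrite ler_pXn2r// nnegrE ?mulr_ge0// tensor_norm_ge0.
Qed.

Lemma tensor_normD alpha X Y :
  tensor_norm alpha (X + Y) <= tensor_norm alpha X + tensor_norm alpha Y.
Proof.
have n0 := tensor_norm_ge0 alpha.
rewrite -(@ler_pXn2r _ 2)// ?nnegrE ?addr_ge0// -lecR tensor_norm_sqr.
have -> : tensor_herm alpha (X + Y) (X + Y) =
   tensor_herm alpha X X + tensor_herm alpha Y Y +
   (tensor_herm alpha X Y + (tensor_herm alpha X Y)^*).
  rewrite -{1}[X]scale1r tensor_herm_antilinear conjC1 mul1r.
  rewrite !(linD (tensor_herm_linear alpha _)) -tensor_herm_sym; ring.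
rewrite sqrrD !rmorphD /= !tensor_norm_sqr [leRHS]addrAC lerD2l.
have /= CS := psd_cauchy_schwarz X Y (psd_tensor_herm alpha).
have {}CS : `|tensor_herm alpha X Y| <= (tensor_norm alpha X * tensor_norm alpha Y)%:C.
  rewrite -(@ler_pXn2r _ 2)// ?nnegrE ?normr_ge0 ?ler0c ?mulr_ge0//.
  by rewrite (le_trans CS)// -rmorphXn /= exprMn rmorphM /= !tensor_norm_sqr.
apply: (@le_trans _ _ (`|tensor_herm alpha X Y| *+ 2)); last first.
  by rewrite -mulr2n lerMn2r CS orbT.
have -> : tensor_herm alpha X Y + (tensor_herm alpha X Y)^* =
    'Re (tensor_herm alpha X Y) *+ 2.
  by rewrite -mulr_natr ReE divfK// pnatr_eq0.
rewrite lerMn2r /=.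
by rewrite (leif_Re_Creal _).
Qed.

Lemma tensor_normZ alpha a X :
  tensor_norm alpha (a *: X) = complex.Re `|a| * tensor_norm alpha X.
Proof.
have nE : (complex.Re `|a|)%:C = `|a| by rewrite RRe_real// normr_real.
have a0 : 0 <= complex.Re `|a| by rewrite -ler0c nE.
move: (complex.Re _) nE a0 => r nE r0.
apply/eqP; rewrite -(@eqrXn2 _ 2)// ?mulr_ge0 ?tensor_norm_ge0//; apply/eqP/complexI.
rewrite tensor_norm_sqr exprMn rmorphM /= tensor_norm_sqr rmorphXn /= nE.
have := tensor_herm_lincomb alpha [:: (a, X)].
by rewrite /lincomb /qform !big_seq1 /= normCKC.
Qed.

Definition form_le alpha gamma := psd (fun x y => gamma x y - alpha x y).

Lemma form_le_addl alpha beta : form_le alpha (herm_add alpha beta).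
Proof. by apply: eq_psd (psd_herm beta) => x y /=; rewrite addrC addKr. Qed.

Lemma form_le_addr alpha beta : form_le beta (herm_add alpha beta).
Proof. by apply: eq_psd (psd_herm alpha) => x y /=; rewrite addrK. Qed.

Lemma tensor_norm_mono alpha gamma X :
  form_le alpha gamma -> tensor_norm alpha X <= tensor_norm gamma X.
Proof.
move=> ag; rewrite -[leRHS]mul1r; apply: tensor_norm_le => //.
rewrite expr1n mul1r; have [l ->] := tens_surj X; rewrite !tensor_herm_tens.
apply: psdB_le.
have pB := psd_word_kerB 0 (psd_herm alpha) (psd_herm gamma) ag.
have sz (s t : seq V) : size s != size t -> word_ker gamma s t - word_ker alpha s t = 0.
  by move=> st; rewrite !word_ker_size// subrr.
apply: eq_psd (psd_weighted (h := fun n => n`!%:R) sz pB _) => [s t|n]; last exact: ler0n.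
by rewrite !herm_wordE mulrBr.
Qed.

Lemma herm_word_scale c (c0 : 0 <= c) alpha s t :
  herm_word (herm_scale alpha c0) s t =
    (size s)`!%:R * c%:C ^+ size s * word_ker alpha s t.
Proof. by rewrite herm_wordE (word_kerZ alpha) mulrA. Qed.

(** Absorb the t Laplace steps into the weight of the degrees and bound this
    weight; the factor (1 + s)^n on words of length n is what rescaling alpha by
    1 + s amounts to. *)
Lemma iter_laplace_le (b : {biscalar V}) alpha s (s0 : 0 < s) (s1 : 0 <= 1 + s) t X :
  bounds_bilinear b alpha ->
  tensor_norm alpha (iter t (laplace b) X) <=
    t`!%:R / s ^+ t * tensor_norm (herm_scale alpha s1) X.
Proof.
move=> ab; apply: tensor_norm_le.
  by rewrite divr_ge0// exprn_ge0// ltW.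
have [l ->] := tens_surj X; rewrite iter_laplace_tens !tensor_herm_tens.
pose h : nat -> C := fun n => n`!%:R.
have it m g : (forall n, 0 <= g n) ->
   qform (fun u v => g (size u) * word_ker alpha u v) (iter m (map (laplace_pair b)) l) <=
   qform (fun u v => iter m (@laplace_weight C) g (size u) * word_ker alpha u v) l.
  elim: m g => [|m IH] g g0 //.
  rewrite iterS iterSr; apply: (le_trans (qform_laplace_le ab _ g0)).
  by apply: IH; exact: laplace_weight_ge0.
rewrite (eq_qform _ (herm_wordE alpha)).
apply: (le_trans (it t h _)) => [n|]; first exact: ler0n.
rewrite -qformZ; apply: psdB_le.
pose k (n : nat) : C := (t`!%:R / s%:C ^+ t) ^+ 2 * (n`!%:R * (1 + s%:C) ^+ n)
   - iter t (@laplace_weight C) h n.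
have k0 n : 0 <= k n.
  by rewrite subr_ge0; apply: iter_laplace_weight_le; rewrite -[0]/(0%:C) ltcR.
apply: eq_psd (psd_weighted_herm alpha k0) => u v.
rewrite herm_word_scale /k mulrBl; congr (_ - _).
by rewrite !rmorphXn !rmorphM fmorphV rmorphXn rmorph_nat rmorphD rmorph1 /= !mulrA.
Qed.

End Norms.

(** * Hilbert-Schmidt forms as bounded functionals on tensors of degree two *)

Section FiniteCauchySchwarz.
Variables (K : numClosedFieldType) (I : finType).

Lemma psd_dot (r : seq I) : psd (fun f g : I -> K => \sum_(i <- r) (f i)^* * g i).
Proof.
elim: r => [|i r IH].
  apply: eq_psd (psd_rank1 (fun=> 0 : K)) => f g.
  by rewrite big_nil mulr0.
apply: eq_psd (psdD (psd_rank1 (fun f : I -> K => f i)) IH) => f g.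
by rewrite big_cons.
Qed.

Lemma sum_cauchy_schwarz (f g : I -> K) :
  `|\sum_i f i * g i| ^+ 2 <= (\sum_i `|f i| ^+ 2) * (\sum_i `|g i| ^+ 2).
Proof.
have := psd_cauchy_schwarz (fun i => (f i)^*) g (psd_dot (index_enum I)).
under eq_bigr do rewrite conjCK.
under [X in _ <= X * _]eq_bigr do rewrite conjCK -normCK.
by under [X in _ <= _ * X]eq_bigr do rewrite -normCKC.
Qed.

End FiniteCauchySchwarz.

Section HilbertSchmidt.
Variables (R : realType) (V : tvsType R[i]).
Local Notation C := R[i].
Local Notation "x %:C" := (real_complex R x).
Implicit Types (alpha beta gamma : herm_form V).

Lemma herm_normE alpha v : (herm_norm alpha v ^+ 2)%:C = alpha v v.
Proof.
have h0 := herm_ge0 alpha v.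
by rewrite /herm_norm sqr_sqrtr ?RRe_real ?ger0_real// -ler0c RRe_real// ger0_real.
Qed.

Lemma herm_norm0 alpha v : herm_norm alpha v = 0 <-> alpha v v = 0.
Proof.
rewrite -herm_normE; split=> [->|]; first by rewrite expr0n.
by move=> /complexI/eqP; rewrite sqrf_eq0 => /eqP.
Qed.

Definition orthonormal_seq alpha (es : seq V) :=
  forall i j, (i < size es)%N -> (j < size es)%N ->
    alpha es`_i es`_j = (i == j)%:R.

Definition residue alpha (es : seq V) (x : V) : V :=
  x - \sum_(e <- es) alpha e x *: e.

Lemma residue_orth alpha es x i : orthonormal_seq alpha es -> (i < size es)%N ->
  alpha es`_i (residue alpha es x) = 0.
Proof.
move=> es1 ies; rewrite /residue (linB (herm_linear alpha _)) herm_sumr.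
rewrite (big_nth 0) big_mkord (bigD1 (Ordinal ies))//= hermZr es1// eqxx mulr1.
rewrite big1 ?addr0 ?subrr// => j ji.
rewrite hermZr es1// (_ : (i == j :> nat) = false) ?mulr0//.
by apply: contraNF ji => /eqP ij; apply/eqP/val_inj.
Qed.

(** The form may be degenerate, so vectors are only recovered up to null vectors.
    Normalizing the residue of p leaves the other residues null, because null
    vectors are orthogonal to everything. *)
Lemma gram_schmidt alpha (L : seq V) : exists2 es, orthonormal_seq alpha es &
  forall x, x \in L -> alpha (residue alpha es x) (residue alpha es x) = 0.
Proof.
elim: L => [|p L [es es1 esL]]; first by exists [::].
pose q := residue alpha es p.
have [q0|q0] := eqVneq (alpha q q) 0.
  by exists es => // x; rewrite inE => /orP[/eqP -> //|/esL].
have Q0 : 0 < alpha q q by rewrite lt_def q0 herm_ge0.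
pose c := (sqrtC (alpha q q))^-1.
have cr : c^* = c.
  by apply: conj_Creal; rewrite ger0_real// invr_ge0 sqrtC_ge0 ltW.
have cc : c * c * alpha q q = 1.
  by rewrite -invfM -expr2 sqrtCK mulVf.
pose e0 := c *: q.
have e01 : alpha e0 e0 = 1 by rewrite hermZl hermZr cr mulrA.
have e0r i : (i < size es)%N -> alpha es`_i e0 = 0.
  by move=> ies; rewrite hermZr residue_orth// mulr0.
have e0l i : (i < size es)%N -> alpha e0 es`_i = 0.
  by move=> ies; rewrite herm_sym e0r// conjC0.
have pK := psd_herm alpha.
exists (e0 :: es).
  move=> [|i] [|j] //= ies jes.
  - by rewrite e0l.
  - by rewrite e0r.
  - by rewrite es1.
have resE x : residue alpha (e0 :: es) x = residue alpha es x - alpha e0 x *: e0.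
  by rewrite /residue big_cons opprD addrA addrAC.
have e0x x : alpha e0 x = alpha e0 (residue alpha es x).
  rewrite /residue (linB (herm_linear alpha _)) herm_sumr big_seq big1 ?subr0// => e.
  by move=> /(nthP 0)[i ies <-]; rewrite hermZr e0l// mulr0.
move=> x; rewrite inE => /orP[/eqP ->|xL]; last first.
  have ex0 : alpha e0 x = 0.
    by rewrite e0x herm_sym (psd_null e0 pK (esL _ xL)) conjC0.
  by rewrite resE ex0 scale0r subr0 esL.
have -> : residue alpha (e0 :: es) p = 0.
  rewrite resE e0x -/q /e0 hermZl cr scalerA mulrAC cc scale1r.
  by rewrite subrr.
by rewrite (lin0 (herm_linear alpha 0)).
Qed.

(** Parseval's identity. *)
Lemma orthonormal_expand alpha es x y :
  alpha (residue alpha es x) (residue alpha es x) = 0 ->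
  alpha x y = \sum_(e <- es) (alpha e x)^* * alpha e y.
Proof.
move=> x0; have -> : alpha x y =
    alpha (residue alpha es x + \sum_(e <- es) alpha e x *: e) y.
  by rewrite subrK.
rewrite herm_sym (linD (herm_linear alpha _)) rmorphD /= -!herm_sym.
rewrite (psd_null _ (psd_herm alpha) x0) add0r herm_suml.
by apply: eq_bigr => e _; rewrite hermZl.
Qed.

Variable b : {biscalar V}.

Lemma biscalar_sum (I J : Type) (r : seq I) (s : seq J) (F : I -> V) (G : J -> V)
    (x : I -> C) (y : J -> C) :
  b (\sum_(i <- r) x i *: F i) (\sum_(j <- s) y j *: G j) =
  \sum_(i <- r) \sum_(j <- s) x i * y j * b (F i) (G j).
Proof.
rewrite linear_sumlz /=; apply: eq_bigr => i _.
rewrite linearZl_LR /= linear_sumr mulr_sumr; apply: eq_bigr => j _.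
by rewrite linearZr_LR /= mulrA.
Qed.

(** On finitely many pairs both b and alpha can be expressed in one orthonormal
    tuple e, up to null vectors, which b ignores. What remains is the
    Cauchy-Schwarz inequality for the matrix b(e_i, e_j), of norm at most 1,
    and the matrix T of the tensor. *)
Lemma hilbert_schmidt_bounds : hilbert_schmidt b -> exists alpha, bounds_bilinear b alpha.
Proof.
move=> [alpha [b0 bHS]]; exists alpha.
pose K2 (p q : V * V) := alpha p.1 q.1 * alpha p.2 q.2.
pose Kb (p q : V * V) := (b p.1 p.2)^* * b q.1 q.2.
split=> [p q|l].
  by rewrite rmorphB !rmorphM /= conjCK -!herm_sym [b p.1 _ * _]mulrC.
suff: qform Kb l <= qform K2 l.
  rewrite -subr_ge0 => /le_trans; apply; rewrite le_eqVlt; apply/orP; left; apply/eqP.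
  have -> : qform K2 l = qform (fun p q => (K2 p q - Kb p q) + Kb p q) l.
    by apply: eq_qform => p q; rewrite subrK.
  by rewrite qformD addrK.
have [es es1 esL] := gram_schmidt alpha ([seq q.2.1 | q <- l] ++ [seq q.2.2 | q <- l]).
have es0l q : q \in l -> alpha (residue alpha es q.2.1) (residue alpha es q.2.1) = 0.
  by move=> ql; apply: esL; rewrite mem_cat (map_f (fun q => q.2.1)).
have es0r q : q \in l -> alpha (residue alpha es q.2.2) (residue alpha es q.2.2) = 0.
  by move=> ql; apply: esL; rewrite mem_cat (map_f (fun q => q.2.2)) ?orbT.
pose d := size es; pose e (i : 'I_d) := es`_i.
have sumE (M : nmodType) (F : V -> M) : \sum_(v <- es) F v = \sum_(i < d) F (e i).
  by rewrite (big_nth 0) big_mkord.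
pose T (p : 'I_d * 'I_d) : C :=
  \sum_(q <- l) q.1 * (alpha (e p.1) q.2.1 * alpha (e p.2) q.2.2).
have K2E : qform K2 l = \sum_p `|T p| ^+ 2.
  have -> : qform K2 l = \sum_p qform (fun x y : V * V =>
     (alpha (e p.1) x.1 * alpha (e p.2) x.2)^* * (alpha (e p.1) y.1 * alpha (e p.2) y.2)) l.
    rewrite /qform [RHS]exchange_big /= !big_seq; apply: eq_bigr => p pl.
    rewrite [RHS]exchange_big /= !big_seq; apply: eq_bigr => q ql.
    rewrite -mulr_sumr; congr (_ * _).
    rewrite /K2 (orthonormal_expand _ (es0l _ pl)) (orthonormal_expand _ (es0r _ pl)).
    rewrite !sumE -(pair_bigA _ (fun i j => (alpha (e i) p.2.1 * alpha (e j) p.2.2)^* *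
      (alpha (e i) q.2.1 * alpha (e j) q.2.2))) /=.
    rewrite mulr_suml; apply: eq_bigr => i _; rewrite mulr_sumr; apply: eq_bigr => j _.
    by rewrite rmorphM /= mulrACA.
  by apply: eq_bigr => p _; rewrite qform_rank1.
have bE q : q \in l -> b q.2.1 q.2.2 =
    \sum_p (alpha (e p.1) q.2.1 * alpha (e p.2) q.2.2) * b (e p.1) (e p.2).
  move=> ql; rewrite -(pair_bigA _ (fun i j => (alpha (e i) q.2.1 * alpha (e j) q.2.2) *
      b (e i) (e j))) /= -(biscalar_sum (index_enum _) (index_enum _)).
  rewrite -(sumE _ (fun v => alpha v q.2.1 *: v)) -(sumE _ (fun v => alpha v q.2.2 *: v)).
  set x := \sum_(v <- _) _; set y := \sum_(v <- _) _.
  rewrite -[in LHS](subrK x q.2.1) linearDl /=.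
  rewrite [b (q.2.1 - x) _]b0 ?add0r; last by left; apply/herm_norm0; exact: es0l.
  rewrite -[in LHS](subrK y q.2.2) linearDr /=.
  by rewrite [b x (q.2.2 - y)]b0 ?add0r//; right; apply/herm_norm0; exact: es0r.
have -> : qform Kb l = `|\sum_p T p * b (e p.1) (e p.2)| ^+ 2.
  rewrite /Kb (qform_rank1 (fun p : V * V => b p.1 p.2)); congr (`|_| ^+ 2).
  rewrite big_seq (eq_bigr _ (fun q ql => congr1 _ (bE q ql))) -big_seq.
  under eq_bigr do rewrite mulr_sumr.
  rewrite exchange_big /=; apply: eq_bigr => p _; rewrite mulr_suml.
  by apply: eq_bigr => q _; rewrite !mulrA.
apply: (le_trans (sum_cauchy_schwarz T (fun p => b (e p.1) (e p.2)))).
rewrite -K2E ler_piMr//.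
  by rewrite K2E; apply: sumr_ge0 => p _; rewrite exprn_ge0.
rewrite -(pair_bigA _ (fun i j => `|b (e i) (e j)| ^+ 2)) /=.
by apply: bHS => i j; rewrite es1.
Qed.

Lemma bounds_bilinear_mono alpha gamma :
  form_le alpha gamma -> bounds_bilinear b alpha -> bounds_bilinear b gamma.
Proof.
move=> ag ba.
have pag := psd_pull (fst : V * V -> V) ag.
have pa := psd_pull (fst : V * V -> V) (psd_herm alpha).
have pag2 := psd_pull (snd : V * V -> V) ag.
have pg2 := psd_pull (snd : V * V -> V) (psd_herm gamma).
apply: eq_psd (psdD (psdD (psdM pag pg2) (psdM pa pag2)) ba) => p q /=.
ring.
Qed.

Lemma bounds_bilinearP alpha v w : bounds_bilinear b alpha ->
  `|b v w| ^+ 2 <= alpha v v * alpha w w.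
Proof.
move=> /(psd_diag_ge0 (v, w)) /=; rewrite subr_ge0.
by rewrite -normCKC.
Qed.

End HilbertSchmidt.

(** * Neighbourhoods in the tensor algebra *)

Section TensorTopology.
Variables (R : realType) (V : tvsType R[i]).
Local Notation C := R[i].
Implicit Types (alpha beta gamma : herm_form V) (X Y : tensor V).

Definition tball alpha X (r : R) : set (tensor V) := [set Y | tensor_norm alpha (Y - X) < r].

Lemma tensor_norm0 alpha : tensor_norm alpha 0 = 0.
Proof.
have := tensor_normZ alpha 0 0.
by rewrite scaler0 normr0 /= mul0r.
Qed.

Lemma tballxx alpha X r : 0 < r -> tball alpha X r X.
Proof. by move=> r0; rewrite /tball /= subrr tensor_norm0. Qed.

Lemma open_tball alpha X r : 0 < r -> open (tball alpha X r).
Proof.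
move=> r0.
exists [set tball alpha X r]; last by rewrite bigcup_set1.
move=> _ ->; exists [fset tball alpha X r]%fset; last first.
  by rewrite set_fset1 bigcap_set1.
by move=> A; rewrite inE => /eqP ->; apply/mem_set; exists alpha, X, r.
Qed.

Definition herm_zero : herm_form V.
Proof.
refine (@HermForm R V (fun _ _ => 0) _ _ _ _) => [v a x y|v w|v|].
- by rewrite scaler0 addr0.
- by rewrite conjC0.
- exact: lexx.
- by move=> p; exact: cvg_cst.
Defined.

Lemma tball_sub alpha X Y r : tball alpha X r Y ->
  exists2 s, 0 < s & tball alpha Y s `<=` tball alpha X r.
Proof.
rewrite /tball /= => XY; exists (r - tensor_norm alpha (Y - X)).
  by rewrite subr_gt0.
move=> Z /=; rewrite ltrBrDr; apply: le_lt_trans.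
by rewrite -[Z in leLHS](subrK Y) -addrA tensor_normD.
Qed.

Lemma tball_mono alpha gamma X r s : form_le alpha gamma -> s <= r ->
  tball gamma X s `<=` tball alpha X r.
Proof.
move=> ag sr Y /= Ys; apply: (le_lt_trans (tensor_norm_mono _ ag)).
exact: lt_le_trans sr.
Qed.

(** The subbase of balls is a base, because the forms are directed: a ball for
    the sum of two forms lies in the balls for both. *)
Lemma nbhs_tensorP X (A : set (tensor V)) :
  nbhs X A <-> exists alpha r, 0 < r /\ tball alpha X r `<=` A.
Proof.
split; last first.
  move=> [alpha [r [r0 rA]]]; apply: (filterS rA).
  by apply: open_nbhs_nbhs; split; [exact: open_tball|exact: tballxx].
rewrite nbhsE => -[B [[D DB <-] [U DU UX]] BA].
have [F FB FE] := DB _ DU.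
suff [alpha [r [r0 rF]]] : exists alpha r, 0 < r /\
    forall W, W \in enum_fset F -> tball alpha X r `<=` W.
  exists alpha, r; split => //; apply: (subset_trans _ BA) => Y XY.
  by exists U => //; rewrite /= -FE => W /= WF; exact: rF XY.
have {}FB W : W \in enum_fset F -> tensor_balls W /\ W X.
  move=> WF; split; first exact/set_mem/FB.
  by move: UX; rewrite -FE => /(_ W); apply.
elim: (enum_fset F) FB => [|W s IH] FB.
  by exists herm_zero, 1; split.
have [|alpha [r [r0 rs]]] := IH; first by move=> Z Zs; apply: FB; rewrite inE Zs orbT.
have [[beta [Z [q [q0 WE]]]] WX] := FB W (mem_head _ _).
move: WX; rewrite WE => /tball_sub[p p0 Zp].
exists (herm_add alpha beta), (Num.min r p); split; first by rewrite lt_min r0.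
move=> U'; rewrite inE => /orP[/eqP ->|U's].
  apply: subset_trans Zp; apply: tball_mono (form_le_addr _ _) _.
  by rewrite ge_min lexx orbT.
apply: subset_trans (rs _ U's); apply: tball_mono (form_le_addl _ _) _.
by rewrite ge_min lexx.
Qed.

Lemma nbhs_symtensorP (X : symtensor V) (A : set (symtensor V)) :
  nbhs X A <-> exists alpha r, 0 < r /\
    [set Y : symtensor V | tensor_norm alpha (val Y - val X) < r] `<=` A.
Proof.
split.
  rewrite nbhsE => -[B [[U oU <-] UX] BA].
  have /nbhs_tensorP[alpha [r [r0 rU]]] : nbhs (val X) U by exact: open_nbhs_nbhs.
  by exists alpha, r; split => //; apply: (subset_trans _ BA) => Y /= /rU.
move=> [alpha [r [r0 rA]]]; apply: (filterS rA).
apply: open_nbhs_nbhs; split; last exact: tballxx.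
by exists (tball alpha (val X) r) => //; exact: open_tball.
Qed.

Lemma linear_continuous_tensor (f : tensor V -> tensor V) : linear f ->
  (forall beta, exists alpha (M : R), 0 < M /\
     forall X, tensor_norm beta (f X) <= M * tensor_norm alpha X) ->
  continuous f.
Proof.
move=> fl fb X A /nbhs_tensorP[beta [r [r0 rA]]].
have [alpha [M [M0 fM]]] := fb beta.
apply/nbhs_tensorP; exists alpha, (r / M); split; first by rewrite divr_gt0.
move=> Y /= XY; apply: rA => /=; rewrite /tball /= -(linB fl).
by apply: (le_lt_trans (fM _)); rewrite mulrC -ltr_pdivlMr.
Qed.

Lemma linear_continuous_symtensor (f : symtensor V -> symtensor V) : linear f ->
  (forall beta, exists alpha (M : R), 0 < M /\
     forall X : symtensor V,
       tensor_norm beta (val (f X)) <= M * tensor_norm alpha (val X)) ->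
  continuous f.
Proof.
move=> fl fb X A /nbhs_symtensorP[beta [r [r0 rA]]].
have [alpha [M [M0 fM]]] := fb beta.
apply/nbhs_symtensorP; exists alpha, (r / M); split; first by rewrite divr_gt0.
move=> Y XY; apply: rA; have := fM (Y - X); rewrite (linB fl) !linearB => h.
by apply: (le_lt_trans h); rewrite mulrC -ltr_pdivlMr.
Qed.

End TensorTopology.

(** * Exponentials of locally nilpotent operators *)

Section Exponential.
Variables (K : numFieldType).

Lemma fsbig_nat (M : zmodType) (F : nat -> M) n :
  (forall t, (n <= t)%N -> F t = 0) ->
  \sum_(t \in [set: nat]) F t = \sum_(t < n) F t.
Proof.
move=> F0; rewrite fsbig_ord; apply/esym/fsbig_widen => // t [_ /= nt].
by apply: F0; rewrite leqNgt; apply/negP.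
Qed.

Lemma exp_opE (M : lmodType K) (f : M -> M) X n :
  (forall t, (n <= t)%N -> iter t f X = 0) ->
  exp_op f X = \sum_(t < n) t`!%:R^-1 *: iter t f X.
Proof. by move=> fX; apply: fsbig_nat => t nt; rewrite fX// scaler0. Qed.

Lemma iter_linear (M : lmodType K) (f : M -> M) t : linear f -> linear (iter t f).
Proof. by move=> fl; elim: t => [//|t IH] a x y /=; rewrite IH fl. Qed.

Lemma iter_scale (M : lmodType K) (f : M -> M) z t X : linear f ->
  iter t (fun Y => z *: f Y) X = z ^+ t *: iter t f X.
Proof.
move=> fl; elim: t => [|t IH]; first by rewrite scale1r.
by rewrite /= IH (linZ fl) scalerA exprS.
Qed.

Definition exp_term (M : lmodType K) (f : M -> M) X t : M := t`!%:R^-1 *: iter t f X.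

Definition exp_partial (M : lmodType K) (f : M -> M) n X : M :=
  \sum_(t < n) exp_term f X t.

Lemma exp_term_scale (M : lmodType K) (f : M -> M) z X t : linear f ->
  exp_term (fun Y => z *: f Y) X t = (t`!%:R^-1 * z ^+ t) *: iter t f X.
Proof. by move=> fl; rewrite /exp_term iter_scale// scalerA. Qed.

Definition nilpotent_on (M : lmodType K) (D : M -> Prop) (f : M -> M) :=
  forall X, D X -> exists n, forall t, (n <= t)%N -> iter t f X = 0.

Definition locally_nilpotent (M : lmodType K) (f : M -> M) :=
  forall X, exists n, forall t, (n <= t)%N -> iter t f X = 0.

Lemma exp_remainderE (M : lmodType K) (f : M -> M) X n m :
  (forall t, (m <= t)%N -> iter t f X = 0) ->
  exp_op f X - exp_partial f n X = \sum_(n <= t < n + m) exp_term f X t.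
Proof.
move=> mX; rewrite (@exp_opE _ _ _ (n + m)); last first.
  by move=> t nmt; apply: mX; rewrite (leq_trans _ nmt)// leq_addl.
rewrite /exp_partial -!(big_mkord xpredT (exp_term f X)).
rewrite (@big_cat_nat _ _ _ n) ?leq_addr//=.
by rewrite addrAC subrr add0r.
Qed.

Lemma exp_linear (M : lmodType K) (f : M -> M) : linear f -> locally_nilpotent f ->
  linear (exp_op f).
Proof.
move=> fl fn a X Y; have [n nX] := fn X; have [m mY] := fn Y.
have it t := iter_linear t fl.
rewrite (@exp_opE _ _ X (maxn n m)); last first.
  by move=> t; rewrite geq_max => /andP[/nX].
rewrite (@exp_opE _ _ Y (maxn n m)); last first.
  by move=> t; rewrite geq_max => /andP[_ /mY].
rewrite (@exp_opE _ _ _ (maxn n m)); last first.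
  by move=> t; rewrite geq_max => /andP[nt mt]; rewrite it nX// mY// scaler0 addr0.
rewrite scaler_sumr -big_split /=; apply: eq_bigr => t _.
by rewrite it scalerDr !scalerA mulrC.
Qed.

Lemma scale_linear (M : lmodType K) (f : M -> M) z : linear f -> linear (fun X => z *: f X).
Proof. by move=> fl a X Y; rewrite fl scalerDr !scalerA mulrC. Qed.

Lemma scale_locally_nilpotent (M : lmodType K) (f : M -> M) z : linear f ->
  locally_nilpotent f -> locally_nilpotent (fun X => z *: f X).
Proof.
move=> fl fn X; have [n nX] := fn X; exists n => t nt.
by rewrite iter_scale// nX// scaler0.
Qed.

Lemma exp_op_scale1 (M : lmodType K) (f : M -> M) : exp_op f = exp_op (fun X => 1 *: f X).
Proof. by congr exp_op; apply/funext => X; rewrite scale1r. Qed.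

Section Intertwine.
Variables (M N : lmodType K) (f : M -> M) (g : N -> N) (h : M -> N) (D : M -> Prop).
Hypothesis fD : forall X, D X -> D (f X).
Hypothesis hf : forall X, D X -> h (f X) = g (h X).

Lemma intertwine_iter_on X t : D X -> h (iter t f X) = iter t g (h X).
Proof.
move=> DX; elim: t => //= t <-; apply: hf.
by elim: t => //= t; exact: fD.
Qed.

Lemma exp_intertwine_on X : linear h -> nilpotent_on D f -> D X ->
  h (exp_op f X) = exp_op g (h X).
Proof.
move=> hl fn DX; have [n nX] := fn X DX.
rewrite (exp_opE nX) (@exp_opE _ _ _ n); last first.
  by move=> t nt; rewrite -(intertwine_iter_on t DX) nX// (lin0 hl).
rewrite (lin_sum hl); apply: eq_bigr => t _.
by rewrite (linZ hl) intertwine_iter_on.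
Qed.

End Intertwine.

Lemma intertwine_iter (M N : lmodType K) (f : M -> M) (g : N -> N) (h : M -> N) X t :
  (forall Y, h (f Y) = g (h Y)) -> h (iter t f X) = iter t g (h X).
Proof. by move=> hf; apply: (@intertwine_iter_on _ _ f g h (fun=> True)). Qed.

Lemma exp_intertwine (M N : lmodType K) (f : M -> M) (g : N -> N) (h : M -> N) X :
  linear h -> locally_nilpotent f -> (forall Y, h (f Y) = g (h Y)) ->
  h (exp_op f X) = exp_op g (h X).
Proof.
move=> hl fn hf.
by apply: (@exp_intertwine_on _ _ f g h (fun=> True)) => // Y _; exact: fn.
Qed.

End Exponential.

Section ExpAdd.
Variables (K : numFieldType) (M : lmodType K) (f g : M -> M) (D : M -> Prop).
Hypotheses (fl : linear f) (gl : linear g).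
Hypotheses (fD : forall X, D X -> D (f X)) (gD : forall X, D X -> D (g X)).
Hypothesis fg : forall X, D X -> f (g X) = g (f X).
Hypotheses (fn : nilpotent_on D f) (gn : nilpotent_on D g).

Let iterD k m X : D X -> D (iter k f (iter m g X)).
Proof.
move=> DX; elim: k => [|k IH]; last exact: fD.
by elim: m => [//|m IH]; exact: gD.
Qed.

Let iter_comm k m X : D X -> g (iter k f (iter m g X)) = iter k f (iter m.+1 g X).
Proof.
move=> DX; elim: k => [//|k IH]; rewrite !iterS -fg ?IH//; exact: iterD.
Qed.

Lemma iter_add_binomial n X : D X ->
  iter n (fun Y => f Y + g Y) X =
  \sum_(k < n.+1) 'C(n, k)%:R *: iter k f (iter (n - k) g X).
Proof.
move=> DX; elim: n => [|n IH].
  by rewrite big_ord1 subnn scale1r.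
have -> : iter n.+1 (fun Y => f Y + g Y) X =
    f (iter n (fun Y => f Y + g Y) X) + g (iter n (fun Y => f Y + g Y) X) by [].
rewrite IH (lin_sum fl) (lin_sum gl).
have -> : \sum_(k < n.+1) g ('C(n, k)%:R *: iter k f (iter (n - k) g X)) =
    \sum_(k < n.+1) 'C(n, k)%:R *: iter k f (iter (n.+1 - k) g X).
  by apply: eq_bigr => k _; rewrite (linZ gl) iter_comm// subSn// -ltnS.
have -> : \sum_(k < n.+1) f ('C(n, k)%:R *: iter k f (iter (n - k) g X)) =
    \sum_(k < n.+1) 'C(n, k)%:R *: iter k.+1 f (iter (n - k) g X).
  by apply: eq_bigr => k _; rewrite (linZ fl).
rewrite [in RHS]big_ord_recl bin0 subn0.
under [in RHS]eq_bigr do rewrite lift0 binS natrD scalerDl subSS.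
rewrite big_split /= addrA addrC; congr (_ + _).
rewrite big_ord_recl bin0 subn0 [in RHS]big_ord_recr /= bin_small// scale0r addr0.
by congr (_ + _); apply: eq_bigr => k _; rewrite lift0.
Qed.

Lemma nilpotent_pair X : D X -> exists N, forall k m, (N <= k + m)%N ->
  iter k f (iter m g X) = 0.
Proof.
move=> DX; have [n gX] := gn DX.
have [N fX] : exists N, forall m k, (m < n)%N -> (N <= k)%N -> iter k f (iter m g X) = 0.
  elim: n {gX} => [|n [N IH]]; first by exists 0%N.
  have [N' H] := fn (iterD 0 n DX); exists (maxn N N') => m k.
  rewrite geq_max ltnS leq_eqVlt => /orP[/eqP -> /andP[_ /H //]|mn /andP[Nk _]].
  exact: IH.
exists (N + n)%N => k m Nkm; have [mn|nm] := ltnP m n; last first.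
  by rewrite gX// (lin0 (iter_linear k fl)).
apply: fX => //; rewrite -(leq_add2r n) (leq_trans Nkm)// leq_add2l ltnW//.
Qed.

(** Commutation and nilpotency are required on a stable domain only, because the
    contractions P_Lambda commute with each other and with Delta on symmetric
    tensors but not on all tensors. *)
Lemma exp_add X : D X ->
  exp_op (fun Y => f Y + g Y) X = exp_op f (exp_op g X).
Proof.
move=> DX; have [N H] := nilpotent_pair DX.
pose a k m : M := (k`!%:R^-1 * m`!%:R^-1) *: iter k f (iter m g X).
have a0 k m : (N <= k + m)%N -> a k m = 0 by move=> km; rewrite /a H// scaler0.
rewrite (@exp_opE _ _ _ X N); last first.
  move=> t Nt; rewrite iter_add_binomial// big1// => k _.
  by rewrite H ?scaler0// subnKC// -ltnS.
rewrite (@exp_opE _ _ g X N); last by move=> t Nt; exact: (H 0%N).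
have -> : exp_op f (\sum_(t < N) t`!%:R^-1 *: iter t g X) =
    \sum_(k < N) \sum_(m < N) a k m.
  rewrite (@exp_opE _ _ _ _ N); last first.
    move=> k Nk; rewrite (lin_sum (iter_linear k fl)) big1// => m _.
    by rewrite (linZ (iter_linear k fl)) H ?scaler0// (leq_trans Nk)// leq_addr.
  apply: eq_bigr => k _; rewrite (lin_sum (iter_linear k fl)) scaler_sumr.
  by apply: eq_bigr => m _; rewrite (linZ (iter_linear k fl)) scalerA.
transitivity (\sum_(n < N) \sum_(k < N | (k <= n)%N) a k (n - k)%N).
  apply: eq_bigr => n _; rewrite iter_add_binomial// scaler_sumr.
  rewrite (big_ord_widen N (fun k =>
    n`!%:R^-1 *: ('C(n, k)%:R *: iter k f (iter (n - k) g X))))//.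
  apply: eq_bigr => k; rewrite ltnS => kn; rewrite /a scalerA; congr (_ *: _).
  rewrite -(bin_fact kn) !natrM !invfM mulrAC mulVf ?mul1r//.
  by rewrite pnatr_eq0 -lt0n bin_gt0.
rewrite (exchange_big_dep xpredT)//=; apply: eq_bigr => k _.
rewrite -(big_mkord (fun n => (k <= n)%N) (fun n => a k (n - k)%N)).
rewrite -(big_mkord xpredT (a k)).
rewrite (@big_cat_nat _ _ _ k) ?(ltnW (ltn_ord k))//=.
rewrite [X in X + _]big_nat_cond big_pred0 ?add0r; last first.
  by move=> n; rewrite andbC; case: leqP => //=; rewrite ltnNge => ->.
rewrite [RHS](@big_cat_nat _ _ _ (N - k)) ?leq_subr//=.
rewrite [X in _ = _ + X]big_nat_cond [X in _ = _ + X]big1 ?addr0; last first.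
  by move=> m /andP[/andP[Nkm _] _]; apply: a0; rewrite -leq_subLR.
rewrite -[X in \sum_(X <= _ < _ | _) _]add0n big_addn.
by apply: eq_big => [n|n _]; rewrite ?leq_addl ?addnK.
Qed.

Lemma nilpotent_on_add : nilpotent_on D (fun Y => f Y + g Y).
Proof.
move=> X DX; have [N H] := nilpotent_pair DX; exists N => t Nt.
rewrite iter_add_binomial// big1// => k _.
by rewrite H ?scaler0// subnKC// -ltnS.
Qed.

End ExpAdd.

(** * Continuity of the exponential of the Laplace operator *)

Section LaplaceOnSymmetric.
Variables (K : numFieldType) (V : lmodType K) (b : {biscalar V}).

Lemma laplaceS_linear : linear (laplaceS b).
Proof.
move=> a X Y; apply: val_inj.
by rewrite linearP /= -laplace_is_linear.
Qed.

Lemma val_linear : linear (val : symtensor V -> tensor V).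
Proof. by move=> a X Y; rewrite linearP. Qed.

Lemma laplaceS_nilpotent : locally_nilpotent (laplaceS b).
Proof.
move=> X; have [n nX] := laplace_nilpotent b (val X); exists n => t nt.
by apply: val_inj; rewrite (intertwine_iter (g := laplace b))// nX// (lin0 val_linear).
Qed.

Definition zlaplace z := scale_linear z (laplace_is_linear b).
Definition zlaplaceS z := scale_linear z laplaceS_linear.
Definition zlaplace_nilpotent z := scale_locally_nilpotent z (laplace_is_linear b)
  (laplace_nilpotent b).
Definition zlaplaceS_nilpotent z := scale_locally_nilpotent z laplaceS_linear
  laplaceS_nilpotent.

Definition explap z (X : tensor V) : tensor V :=
  exp_op (fun Y : tensor V => z *: laplace b Y) X.

Definition explapS z (X : symtensor V) : symtensor V :=
  exp_op (fun Y : symtensor V => z *: laplaceS b Y) X.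

Definition lap_term z (X : tensor V) t : tensor V :=
  exp_term (fun Y : tensor V => z *: laplace b Y) X t.

Definition lap_partial z n (X : tensor V) : tensor V :=
  exp_partial (fun Y : tensor V => z *: laplace b Y) n X.

Lemma lap_termE z (X : tensor V) t :
  lap_term z X t = (t`!%:R^-1 * z ^+ t) *: iter t (laplace b) X.
Proof. exact/exp_term_scale/laplace_is_linear. Qed.

Lemma explap_remainder z n (X : tensor V) : exists m,
  explap z X - lap_partial z n X = \sum_(n <= t < n + m) lap_term z X t.
Proof.
by have [m mX] := zlaplace_nilpotent z X; exists m; exact: exp_remainderE.
Qed.

Lemma lap_partial0 z (X : tensor V) : lap_partial z 0 X = 0.
Proof. exact: big_ord0. Qed.

Lemma val_explapS z (X : symtensor V) : val (explapS z X) = explap z (val X).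
Proof.
apply: (exp_intertwine _ val_linear); first exact: zlaplaceS_nilpotent.
by move=> Y; rewrite (linZ val_linear).
Qed.

Lemma explap_linear z : linear (explap z).
Proof. exact: exp_linear (zlaplace z) (zlaplace_nilpotent z). Qed.

Lemma explapS_linear z : linear (explapS z).
Proof. exact: exp_linear (zlaplaceS z) (zlaplaceS_nilpotent z). Qed.

Lemma explap1 : exp_op (laplace b) = explap 1.
Proof. exact: exp_op_scale1. Qed.

Lemma explapS1 : exp_op (laplaceS b) = explapS 1.
Proof. exact: exp_op_scale1. Qed.

End LaplaceOnSymmetric.

Section Estimates.
Variables (R : realType) (V : tvsType R[i]) (b : {biscalar V}).
Local Notation C := R[i].
Local Notation "x %:C" := (real_complex R x).
Implicit Types (alpha beta gamma : herm_form V) (X Y : tensor V).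

Definition modulus (z : C) : R := complex.Re `|z|.

Lemma modulusE z : (modulus z)%:C = `|z|.
Proof. by rewrite RRe_real// normr_real. Qed.

Lemma modulus_ge0 z : 0 <= modulus z.
Proof. by rewrite -ler0c modulusE. Qed.

Lemma modulusX z t : modulus (z ^+ t) = modulus z ^+ t.
Proof. by apply: complexI; rewrite rmorphXn /= !modulusE normrX. Qed.

Lemma modulusM z w : modulus (z * w) = modulus z * modulus w.
Proof. by apply: complexI; rewrite rmorphM /= !modulusE normrM. Qed.

Lemma modulusV z : modulus z^-1 = (modulus z)^-1.
Proof. by apply: complexI; rewrite fmorphV /= !modulusE normfV. Qed.

Lemma modulus_nat n : modulus n%:R = n%:R.
Proof. by apply: complexI; rewrite modulusE normr_nat rmorph_nat. Qed.

Lemma modulus1 : modulus 1 = 1.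
Proof. exact: modulus_nat 1%N. Qed.

Hypothesis hsb : exists alpha, bounds_bilinear b alpha.

(** The seminorm beta need not bound b; the sum of beta and a form that bounds b
    dominates beta and does. *)
Lemma lap_term_le beta s : 0 < s -> exists gamma, forall z t X,
  tensor_norm beta (lap_term b z X t) <= (modulus z / s) ^+ t * tensor_norm gamma X.
Proof.
move=> s0; have [alpha ab] := hsb.
have s1 : 0 <= 1 + s by rewrite addr_ge0// ltW.
have ab' := bounds_bilinear_mono (form_le_addl alpha beta) ab.
exists (herm_scale (herm_add alpha beta) s1) => z t X.
apply: (le_trans (tensor_norm_mono _ (form_le_addr alpha beta))).
rewrite lap_termE tensor_normZ -/(modulus _).
rewrite modulusM modulusV modulus_nat modulusX.
apply: (le_trans (ler_wpM2l _ (iter_laplace_le s0 s1 t X ab'))).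
  by rewrite mulr_ge0 ?invr_ge0// exprn_ge0// modulus_ge0.
rewrite mulrA ler_wpM2r ?tensor_norm_ge0// expr_div_n mulrA [_^-1 * _]mulrC.
by rewrite divfK// pnatr_eq0 -lt0n fact_gt0.
Qed.

Lemma tensor_norm_sum alpha (I : Type) (r : seq I) (F : I -> tensor V) :
  tensor_norm alpha (\sum_(i <- r) F i) <= \sum_(i <- r) tensor_norm alpha (F i).
Proof.
elim: r => [|i r IH]; first by rewrite !big_nil tensor_norm0.
by rewrite !big_cons (le_trans (tensor_normD _ _ _))// lerD2l.
Qed.

Lemma geometric_tail_le (q : R) n m : 0 <= q -> q <= 1 / 2 ->
  \sum_(n <= t < n + m) q ^+ t <= 2 * q ^+ n.
Proof.
move=> q0 q2; elim: m n => [|m IH] n.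
  by rewrite addn0 big_geq// mulr_ge0// exprn_ge0.
rewrite big_ltn ?addnS ?ltnS ?leq_addr//; have := IH n.+1; rewrite addSn exprS.
have := exprn_ge0 n q0.
move: (\sum_(_ <= _ < _) _) (q ^+ n) => S x x0 Sx.
have : q * x <= 1 / 2 * x by rewrite ler_wpM2r.
lra.
Qed.

(** For |z| <= s / 2 the bounds on the terms decrease at least like 2^-t, so their
    sum is at most twice the first one. *)
Lemma explap_remainder_le beta s : 0 < s -> exists gamma, forall z n X,
  modulus z / s <= 1 / 2 ->
  tensor_norm beta (explap b z X - lap_partial b z n X) <=
  2 * (modulus z / s) ^+ n * tensor_norm gamma X.
Proof.
move=> s0; have [gamma H] := lap_term_le beta s0; exists gamma => z n X zs.
have [m ->] := explap_remainder b z n X.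
apply: (le_trans (tensor_norm_sum _ _ _)).
apply: (@le_trans _ _ (\sum_(n <= t < n + m) (modulus z / s) ^+ t * tensor_norm gamma X)).
  by apply: ler_sum => t _; exact: H.
rewrite -mulr_suml ler_wpM2r ?tensor_norm_ge0// geometric_tail_le//.
by rewrite divr_ge0 ?modulus_ge0// ltW.
Qed.

Lemma explap_le beta rho : 0 <= rho -> exists gamma, forall z X, modulus z <= rho ->
  tensor_norm beta (explap b z X) <= 2 * tensor_norm gamma X.
Proof.
move=> rho0; have s0 : 0 < 2 * rho + 1 by lra.
have [gamma H] := explap_remainder_le beta s0; exists gamma => z X zr.
have := H z 0%N X; rewrite lap_partial0 subr0 expr0 mulr1; apply.
by rewrite ler_pdivrMr//; lra.
Qed.

Lemma explap_continuous z : continuous (explap b z : tensor V -> tensor V).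
Proof.
apply: linear_continuous_tensor; first exact: explap_linear.
move=> beta; have [gamma H] := explap_le beta (modulus_ge0 z).
by exists gamma, 2; split => // X; exact: H.
Qed.

Lemma explapS_continuous z : continuous (explapS b z : symtensor V -> symtensor V).
Proof.
apply: linear_continuous_symtensor; first exact: explapS_linear.
move=> beta; have [gamma H] := explap_le beta (modulus_ge0 z).
by exists gamma, 2; split => // X; rewrite val_explapS; exact: H.
Qed.

Lemma laplaceS_continuous : continuous (laplaceS b : symtensor V -> symtensor V).
Proof.
apply: linear_continuous_symtensor; first exact: laplaceS_linear.
move=> beta; have [gamma H] := lap_term_le beta ltr01.
exists gamma, 1; split => // X; have := H 1 1%N (val X).
by rewrite lap_termE modulus1 divr1 !expr1 invr1 mulr1 scale1r !mul1r; exact.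
Qed.

End Estimates.

(** * Continuity forces the Hilbert-Schmidt property *)

Section SymPower.
Variables (K : numFieldType) (V : lmodType K).

Lemma Sym_power n (v : V) : Sym (word (nseq n v)) = word (nseq n v).
Proof.
rewrite Sym_word size_nseq (eq_bigr (fun=> word (nseq n v))); last first.
  move=> sigma _; congr word; apply: (@eq_from_nth _ 0).
    by rewrite size_map size_enum_ord size_nseq.
  move=> i; rewrite size_map size_enum_ord => ik.
  by rewrite (nth_map (Ordinal ik)) ?size_enum_ord// !nth_nseq ltn_ord ik.
rewrite sumr_const card_Sn -[X in _ *: X]scaler_nat scalerA mulVf ?scale1r//.
by rewrite pnatr_eq0 -lt0n fact_gt0.
Qed.

Lemma power_symmetric n (v : V) : word (nseq n v) \in @Defs.symmetric K V.
Proof. by rewrite -Sym_power; exact: Sym_symmetric. Qed.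

(** Polarization of the square of x + y. *)
Lemma word2_symmetric (x y : V) :
  word [:: x; y] + word [:: y; x] \in @Defs.symmetric K V.
Proof.
have -> : word [:: x; y] + word [:: y; x] =
    word (nseq 2 (x + y)) - word (nseq 2 x) - word (nseq 2 y).
  have E (z : V) : word [:: x + y; z] = word [:: x; z] + word [:: y; z].
    by have := @word_multilinear K V [::] [:: z] 1 x y; rewrite !scale1r.
  have E' (z : V) : word [:: z; x + y] = word [:: z; x] + word [:: z; y].
    by have := @word_multilinear K V [:: z] [::] 1 x y; rewrite !scale1r.
  rewrite /= E !E' -addrA -opprD; apply/eqP; rewrite eq_sym subr_eq.
  by rewrite [word [:: x; x] + _]addrC addrACA.
by rewrite !rpredB// power_symmetric.
Qed.

End SymPower.

Section DegreeTwo.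
Variables (K : numFieldType) (V : lmodType K) (b : {biscalar V}).

Definition pair_words (l : seq (K * (V * V))) : seq (K * seq V) :=
  [seq (q.1, [:: q.2.1; q.2.2]) | q <- l].

Definition flip (l : seq (K * (V * V))) := [seq (q.1, (q.2.2, q.2.1)) | q <- l].

Lemma tens_cat (l m : seq (K * seq V)) : tens (l ++ m) = tens l + tens m.
Proof. by rewrite /tens /lincomb map_cat big_cat. Qed.

Definition contraction (l : seq (K * (V * V))) : K :=
  \sum_(q <- l) q.1 * b q.2.1 q.2.2.

Lemma laplace_pair_words l :
  laplace b (tens (pair_words l)) = contraction l *: word [::].
Proof.
rewrite laplace_tens /tens /lincomb !big_map scaler_suml; apply: eq_bigr => q _.
by rewrite /= /laplace_coef /= divff ?pnatr_eq0// mul1r.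
Qed.

Lemma pair_words_symmetric l :
  tens (pair_words l ++ pair_words (flip l)) \in @Defs.symmetric K V.
Proof.
rewrite tens_cat /tens /lincomb !big_map -big_split /=.
by apply: rpred_sum => q _; rewrite -scalerDr rpredZ// word2_symmetric.
Qed.

Definition pair_symtensor l : symtensor V :=
  exist (fun X : tensor V => X \in @Defs.symmetric K V) _ (pair_words_symmetric l).

Lemma val_scale_sub0 a (X : symtensor V) :
  val (a *: X) - val (0 : symtensor V) = a *: val X.
Proof. by rewrite (linZ (@val_linear _ V)) (lin0 (@val_linear _ V)) subr0. Qed.

Lemma val_linear_scale_sub0 (f : symtensor V -> symtensor V) a X : linear f ->
  val (f (a *: X)) - val (f 0) = a *: val (f X).
Proof. by move=> fl; rewrite (linZ fl) (lin0 fl) val_scale_sub0. Qed.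

(** In degree two the Laplace operator produces a scalar, which it then kills. *)
Lemma explap_pair_words l :
  explap b 1 (tens (pair_words l)) = tens (pair_words l) + contraction l *: word [::].
Proof.
have it2 t : (2 <= t)%N ->
    iter t (fun Y : tensor V => 1 *: laplace b Y) (tens (pair_words l)) = 0.
  case: t => [//|[//|t]] _; rewrite iter_scale; last exact: laplace_is_linear.
  rewrite !iterSr laplace_pair_words (linZ (laplace_is_linear b)) laplace_word_small//.
  by rewrite scaler0 (lin0 (iter_linear _ (laplace_is_linear b))) scaler0.
rewrite /explap (exp_opE it2) !big_ord_recl big_ord0 /=.
by rewrite laplace_pair_words !invr1 !scale1r addr0.
Qed.

End DegreeTwo.

Section Converse.
Variables (R : realType) (V : tvsType R[i]) (b : {biscalar V}).
Local Notation C := R[i].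
Local Notation "x %:C" := (real_complex R x).
Implicit Types (alpha beta gamma : herm_form V).

Lemma continuous_linear_bounded (f : symtensor V -> symtensor V) : linear f -> continuous f ->
  forall beta, exists alpha (M : R), 0 < M /\
    forall X : symtensor V, tensor_norm beta (val (f X)) <= M * tensor_norm alpha (val X).
Proof.
move=> fl fc beta.
have : nbhs (f 0) [set Y : symtensor V | tensor_norm beta (val Y - val (f 0)) < 1].
  by apply/nbhs_symtensorP; exists beta, 1; split => //; exact: ltr01.
move=> /(fc 0)/nbhs_symtensorP[alpha [r [r0 rf]]].
exists alpha, r^-1; split; first by rewrite invr_gt0.
move=> X; rewrite -ler_pdivrMl ?invr_gt0// invrK leNgt; apply/negP => Xr.
set m := tensor_norm beta _ in Xr.
have m0 : 0 < m by rewrite -(pmulr_rgt0 _ r0) (le_lt_trans _ Xr)// tensor_norm_ge0.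
have mC : modulus (m%:C^-1) = m^-1.
  by apply: complexI; rewrite modulusE normfV fmorphV /= ger0_norm// ler0c ltW.
have /rf : tensor_norm alpha (val (m%:C^-1 *: X) - val (0 : symtensor V)) < r.
  rewrite val_scale_sub0 tensor_normZ.
  by rewrite -/(modulus _) mC mulrC ltr_pdivrMr.
move=> h; have {h} : tensor_norm beta (m%:C^-1 *: val (f X)) < 1.
  by rewrite -(val_linear_scale_sub0 (m%:C^-1) X fl); exact: h.
by rewrite tensor_normZ -/(modulus _) mC mulVf ?ltxx// gt_eqF.
Qed.

Lemma explapS_continuous_of : continuous (explap b 1 : tensor V -> tensor V) ->
  continuous (explapS b 1 : symtensor V -> symtensor V).
Proof.
move=> ec X A /nbhs_symtensorP[beta [r [r0 rA]]].
have : nbhs (explap b 1 (val X)) (tball beta (explap b 1 (val X)) r).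
  by apply/nbhs_tensorP; exists beta, r; split => // ?.
move=> /ec/nbhs_tensorP[alpha [q [q0 qe]]].
apply/nbhs_symtensorP; exists alpha, q; split => // Y /qe XY; apply: rA.
by rewrite /mkset !val_explapS.
Qed.

Lemma tensor_herm_pair_words alpha l :
  tensor_herm alpha (tens (pair_words l)) (tens (pair_words l)) =
  2 * qform (fun p q : V * V => alpha p.1 q.1 * alpha p.2 q.2) l.
Proof.
rewrite tensor_herm_tens -qformZ /qform big_map; apply: eq_bigr => p _.
rewrite big_map; apply: eq_bigr => q _; congr (_ * _).
by rewrite herm_wordE /= mulr1.
Qed.

Lemma tensor_norm_flip alpha l :
  tensor_norm alpha (tens (pair_words (flip l))) = tensor_norm alpha (tens (pair_words l)).
Proof.
rewrite /tensor_norm !tensor_herm_pair_words; congr (Num.sqrt (complex.Re (_ * _))).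
rewrite /qform big_map; apply: eq_bigr => p _; rewrite big_map; apply: eq_bigr => q _ /=.
by rewrite [alpha _ _ * _]mulrC.
Qed.

(** The seminorm of the zero form is the modulus of the component of degree 0, which
    is how the scalar created by the exponential is read off. *)
Lemma tensor_norm_degree0 (l : seq (C * (V * V))) c :
  tensor_norm (herm_zero V) (tens (pair_words l) + c *: word [::]) = modulus c.
Proof.
have -> : tens (pair_words l) + c *: word [::] = tens ((c, [::]) :: pair_words l).
  by rewrite addrC /tens /lincomb big_cons.
apply/eqP; rewrite -(@eqrXn2 _ 2)// ?modulus_ge0 ?tensor_norm_ge0//; apply/eqP/complexI.
rewrite tensor_norm_sqr tensor_herm_tens qform_cons rmorphXn /= modulusE.
have w0 x : herm_word (herm_zero V) [::] x = (nilp x)%:R.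
  by rewrite herm_wordE /= mul1r; case: x.
have -> : qform (herm_word (herm_zero V)) (pair_words l) = 0.
  rewrite /qform big_map big1// => p _; rewrite big_map big1// => q _.
  by rewrite herm_wordE /= mul0r !mulr0.
have -> : \sum_(q <- pair_words l) q.1 * herm_word (herm_zero V) [::] q.2 = 0.
  by rewrite big_map big1// => q _; rewrite w0 mulr0.
have -> : \sum_(q <- pair_words l) q.1^* * herm_word (herm_zero V) q.2 [::] = 0.
  by rewrite big_map big1// => q _; rewrite herm_word_sym w0 conjC0 mulr0.
by rewrite mulr0 mul0r !addr0 w0 mulr1 normCKC.
Qed.

Hypothesis b_sym : forall v w, b v w = b w v.

Lemma contraction_flip l : contraction b (flip l) = contraction b l.
Proof. by rewrite /contraction big_map; apply: eq_bigr => q _; rewrite /= b_sym. Qed.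

(** Applied to the symmetric tensor X + flip X, continuity for the seminorm of
    [tensor_norm_degree0] gives 2 |b(X)| <= M |X + flip X| <= 2 M |X|. As |X|^2 is
    2! times the value of the product kernel, rescaling alpha by sqrt 2 M makes
    it bound b. *)
Lemma explapS_continuous_bounds : continuous (explapS b 1 : symtensor V -> symtensor V) ->
  exists alpha, bounds_bilinear b alpha.
Proof.
move=> ec.
have [alpha [M [M0 eM]]] := continuous_linear_bounded (explapS_linear b 1) ec (herm_zero V).
have c0 : 0 <= Num.sqrt 2 * M by rewrite mulr_ge0 ?sqrtr_ge0// ltW.
exists (herm_scale alpha c0).
pose K2 (p q : V * V) := alpha p.1 q.1 * alpha p.2 q.2.
have pK2 : psd K2 := psdM (psd_pull fst (psd_herm alpha)) (psd_pull snd (psd_herm alpha)).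
have key l : qform (fun p q : V * V => (b p.1 p.2)^* * b q.1 q.2) l <=
    (2 * M ^+ 2)%:C * qform K2 l.
  rewrite (qform_rank1 (fun p : V * V => b p.1 p.2)) -/(contraction b l).
  pose Y := pair_symtensor l.
  have YE : val Y = tens (pair_words (l ++ flip l)).
    by rewrite /pair_words map_cat.
  have := eM Y; rewrite val_explapS YE explap_pair_words tensor_norm_degree0.
  have -> : contraction b (l ++ flip l) = contraction b l * 2%:R.
    rewrite mulr_natr mulr2n -[X in _ + X]contraction_flip.
    by rewrite /contraction big_cat.
  rewrite modulusM modulus_nat => h.
  have {h} : modulus (contraction b l) <= M * tensor_norm alpha (tens (pair_words l)).
    rewrite -(@ler_pM2r _ 2)// (le_trans h)// -mulrA ler_wpM2l ?(ltW M0)//.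
    rewrite /pair_words map_cat tens_cat (le_trans (tensor_normD _ _ _))//.
    by rewrite -/(pair_words l) -/(pair_words (flip l)) tensor_norm_flip mulr_natr.
  rewrite -(@ler_pXn2r _ 2)// ?nnegrE ?modulus_ge0 ?mulr_ge0 ?tensor_norm_ge0 ?(ltW M0)//.
  rewrite -lecR rmorphXn /= modulusE exprMn rmorphM /= tensor_norm_sqr.
  rewrite tensor_herm_pair_words => /le_trans; apply.
  have -> : (2 * M ^+ 2)%:C = (M ^+ 2)%:C * 2.
    by rewrite mulrC [LHS]rmorphM; congr (_ * _); exact: (rmorph_nat (real_complex R) 2).
  by rewrite mulrA.
split=> [p q|l].
  move: (herm_scale alpha c0) => gamma.
  by rewrite rmorphB !rmorphM /= conjCK -!herm_sym [b p.1 _ * _]mulrC.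
pose Kb (p q : V * V) := (b p.1 p.2)^* * b q.1 q.2.
have -> : qform (fun p q : V * V => herm_scale alpha c0 p.1 q.1 *
    herm_scale alpha c0 p.2 q.2 - (b p.1 p.2)^* * b q.1 q.2) l =
  (2 * M ^+ 2)%:C * qform K2 l - qform Kb l.
  rewrite -mulN1r -!qformZ -qformD; apply: eq_qform => p q /=.
  rewrite mulN1r; congr (_ - _).
  rewrite mulrACA -rmorphM /= mulrACA -!expr2 sqr_sqrtr//.
by rewrite subr_ge0 key.
Qed.

(** For N the sum of all |b(e_i, e_j)|^2, the tensor with coefficients
    conj(b(e_i, e_j)) has functional value N and squared norm N, so that the bound
    reads N^2 <= N. *)
Lemma bounds_hilbert_schmidt alpha : bounds_bilinear b alpha -> hilbert_schmidt b.
Proof.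
move=> ab; exists alpha; split.
  move=> v w vw; apply/eqP; rewrite -normr_eq0 -sqrf_eq0 eq_le exprn_ge0// andbT.
  apply: (le_trans (bounds_bilinearP v w ab)).
  by case: vw => /herm_norm0 ->; rewrite ?mul0r ?mulr0.
move=> d e e1; pose bb (p : 'I_d * 'I_d) := b (e p.1) (e p.2).
rewrite (pair_bigA _ (fun i j => `|b (e i) (e j)| ^+ 2)) /= -/bb.
pose N := \sum_p `|bb p| ^+ 2; rewrite -/N.
have N0 : 0 <= N by apply: sumr_ge0 => p _; rewrite exprn_ge0.
pose l : seq (C * (V * V)) :=
  [seq ((bb p)^*, (e p.1, e p.2)) | p <- index_enum ('I_d * 'I_d)%type].
have bl : qform (fun p q : V * V => (b p.1 p.2)^* * b q.1 q.2) l = N ^+ 2.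
  rewrite (qform_rank1 (fun p : V * V => b p.1 p.2)) big_map.
  rewrite (eq_bigr (fun p => `|bb p| ^+ 2)) => [|p _]; last by rewrite normCKC.
  by rewrite -/N ger0_norm.
have al : qform (fun p q : V * V => alpha p.1 q.1 * alpha p.2 q.2) l = N.
  rewrite /qform big_map; apply: eq_bigr => p _; rewrite big_map (bigD1 p)//=.
  rewrite !e1 !eqxx !mulr1 conjCK -normCK big1 ?addr0// => q qp.
  rewrite !e1 -natrM mulnb -[_ && _]/((p.1, p.2) == (q.1, q.2)) -!surjective_pairing.
  by rewrite eq_sym (negbTE qp) mulr0.
have := psdB_le l ab; rewrite bl al.
have [->|Nn0] := eqVneq N 0; first by rewrite ler01.
by rewrite expr2 ger_pMr// lt_def Nn0.
Qed.

End Converse.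

(** * Extension of operators to a completion *)

Section TvsBasics.
Variables (K : numFieldType) (E : tvsType K).

Lemma nbhs0_sub (U : set E) : nbhs (0 : E) U ->
  exists2 W, nbhs (0 : E) W & forall x y, W x -> W y -> U (x - y).
Proof.
move=> U0; have := @sub_continuous E (0, 0); rewrite /continuous_at /= subr0 => /(_ _ U0).
case=> -[W1 W2] /= [W10 W20] WU; exists (W1 `&` W2); first exact: filterI.
by move=> x y [x1 _] [_ y2]; exact: (WU (x, y)).
Qed.

Lemma nbhs_translate (X : E) (U : set E) : nbhs (0 : E) U -> nbhs X [set Y | U (Y - X)].
Proof.
move=> U0; have := @sub_continuous E (X, X); rewrite /continuous_at /= subrr => /(_ _ U0).
case=> -[W1 W2] /= [W10 W20] WU; apply: filterS W10 => Y Y1.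
by apply: (WU (Y, X)); split => //; exact: nbhs_singleton.
Qed.

Lemma nbhs_translateN (X : E) (U : set E) : nbhs X U -> nbhs (0 : E) [set Y | U (X + Y)].
Proof.
move=> UX; have := @add_continuous E (X, 0); rewrite /continuous_at /= addr0 => /(_ _ UX).
case=> -[W1 W2] /= [W10 W20] WU; apply: filterS W20 => Y Y1.
by apply: (WU (X, Y)); split => //; exact: nbhs_singleton.
Qed.

Lemma tvs_addl (T : topologicalType) (f g : T -> E) :
  continuous f -> continuous g -> continuous (fun x => f x + g x).
Proof.
move=> fc gc x; apply: (@continuous_comp T (E * E)%type E (fun x => (f x, g x))
  (fun p => p.1 + p.2)); last exact: add_continuous.
by apply: cvg_pair; [exact: fc|exact: gc].
Qed.

Lemma tvs_scale (T : topologicalType) (f : T -> E) (c : K) :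
  continuous f -> continuous (fun x => c *: f x).
Proof.
move=> fc x; apply: (@continuous_comp T (K^o * E)%type E (fun x => (c : K^o, f x))
  (fun p => p.1 *: p.2)); last exact: scale_continuous.
by apply: (@cvg_pair _ _ _ _ (nbhs (c : K^o))); [exact: cvg_cst|exact: fc].
Qed.

End TvsBasics.

Section Extension.
Variables (R : realType) (S : preTopologicalLmodType R[i]) (E : tvsType R[i]).
Variable iota : S -> E.
Hypothesis iotaP : is_completion iota.

Lemma iota_linear : linear iota. Proof. by case: iotaP. Qed.

Lemma iota_nbhs X A : nbhs X A <-> exists2 B, nbhs (iota X) B & iota @^-1` B `<=` A.
Proof. by case: iotaP. Qed.

Lemma iota_dense (X : E) (B : set E) : nbhs X B -> exists Y, B (iota Y).
Proof.
case: iotaP => _ _ _ dense _ BX.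
have : closure (range iota) X by rewrite dense.
by move=> /(_ B BX)[_ [[Y _ <-] BY]]; exists Y.
Qed.

Lemma iota_nbhs0 (U : set E) : nbhs (0 : E) U -> nbhs (0 : S) (iota @^-1` U).
Proof. by move=> U0; apply/iota_nbhs; exists U => //; rewrite (lin0 iota_linear). Qed.

Lemma linear_small (f : S -> S) (U : set E) : linear f -> continuous f ->
  nbhs (0 : E) U -> exists2 B, nbhs (0 : E) B & forall Y, B (iota Y) -> U (iota (f Y)).
Proof.
move=> fl fc /iota_nbhs0 U0.
have : nbhs (f 0) (iota @^-1` U) by rewrite (lin0 fl).
move=> /fc/iota_nbhs[B]; rewrite (lin0 iota_linear) => B0 BU.
by exists B => // Y /BU.
Qed.

(** The value at X is the limit of f along the trace on S of the neighbourhoods of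
    X; this filter is Cauchy because f is linear and continuous at 0. *)
Lemma extension (f : S -> S) : linear f -> continuous f ->
  exists g : E -> E, extends_to iota f g.
Proof.
move=> fl fc; have il := iota_linear.
pose lim X l := forall U, nbhs (l : E) U ->
  exists2 B, nbhs (X : E) B & forall Y, B (iota Y) -> U (iota (f Y)).
have limit X : exists l, lim X l.
  pose F : set_system E := [set A | exists2 B, nbhs X B &
    forall Y, B (iota Y) -> A (iota (f Y))].
  have PF : ProperFilter F.
    split.
      by move=> [B /iota_dense[Y BY] /(_ Y BY)].
    split.
    - by exists setT => //; exact: filterT.
    - move=> P Q [B BX BP] [B' BX' BQ]; exists (B `&` B'); first exact: filterI.
      by move=> Y [/BP ? /BQ ?].
    - by move=> P Q PQ [B BX BP]; exists B => // Y /BP /PQ.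
  case: iotaP => _ _ _ _ [_ /(_ F PF)]; case.
    move=> U /(linear_small fl fc)[B B0 BU].
    have [W W0 WB] := nbhs0_sub B0.
    exists (iota @` (f @` [set Y | W (iota Y - X)])).
      exists [set Z | W (Z - X)]; first exact: nbhs_translate.
      by move=> Y YW; exists (f Y) => //; exists Y.
    move=> _ _ [_ [Y WY <-] <-] [_ [Z WZ <-] <-].
    rewrite -(linB il) -(linB fl); apply: BU.
    have := WB _ _ WY WZ; rewrite (linB il).
    by rewrite opprB addrA subrK.
  by move=> l Fl; exists l => U /Fl.
pose g X := proj1_sig (cid (limit X)).
have gP X : lim X (g X) by rewrite /g; case: cid.
exists g; split; last first.
  move=> Y; case: iotaP => _ _ _ _ [hE _]; apply/esym/hE => A B.
  move=> /nbhs_singleton A1 /gP[D DY DB]; exists (iota (f Y)); split => //.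
  by apply: DB; exact: nbhs_singleton.
(* for Z near X, compare g X and g Z with f at a common approximant *)
move=> X U /nbhs_translateN U0; have [W W0 WU] := nbhs0_sub U0.
have [B BX BW] := gP X _ (nbhs_translate _ W0).
apply: filterS (nbhs_interior BX) => Z BZ.
have [B' BZ' BW'] := gP Z _ (nbhs_translate _ W0).
have [Y [YB YB']] := iota_dense (filterI BZ BZ').
have := WU _ _ (BW _ YB) (BW' _ YB').
have -> : iota (f Y) - g X - (iota (f Y) - g Z) = g Z - g X.
  by rewrite opprB addrC addrA subrK.
by rewrite /= addrC subrK.
Qed.

Lemma extends_add f1 f2 g1 g2 : extends_to iota f1 g1 -> extends_to iota f2 g2 ->
  extends_to iota (fun X => f1 X + f2 X) (fun X => g1 X + g2 X).
Proof.
move=> [c1 e1] [c2 e2]; split; first exact: tvs_addl.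
by move=> X; rewrite e1 e2 (linD iota_linear).
Qed.

Lemma extends_scale c f g : extends_to iota f g ->
  extends_to iota (fun X => c *: f X) (fun X => c *: g X).
Proof.
move=> [gc e]; split; first exact: tvs_scale.
by move=> X; rewrite e (linZ iota_linear).
Qed.

Lemma extends_sub f1 f2 g1 g2 : extends_to iota f1 g1 -> extends_to iota f2 g2 ->
  extends_to iota (fun X => f1 X - f2 X) (fun X => g1 X - g2 X).
Proof.
move=> e1 /(extends_scale (-1)) e2; have := extends_add e1 e2.
have -> : (fun X => f1 X - f2 X) = (fun X => f1 X + -1 *: f2 X).
  by apply/funext => X; rewrite scaleN1r.
suff -> : (fun X => g1 X - g2 X) = (fun X => g1 X + -1 *: g2 X) by [].
by apply/funext => X; rewrite scaleN1r.
Qed.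

Lemma extends_comp f1 f2 g1 g2 : extends_to iota f1 g1 -> extends_to iota f2 g2 ->
  extends_to iota (fun X => f1 (f2 X)) (fun X => g1 (g2 X)).
Proof.
move=> [c1 e1] [c2 e2]; split; last by move=> X; rewrite e2 e1.
by move=> X; apply: continuous_comp; [exact: c2|exact: c1].
Qed.

Lemma extends_id : extends_to iota id id.
Proof. by split=> // X; exact: cvg_id. Qed.

Lemma extends_iter f g t : extends_to iota f g -> extends_to iota (iter t f) (iter t g).
Proof.
move=> e; elim: t => [|t IH]; first exact: extends_id.
exact: extends_comp e IH.
Qed.

Lemma extends_sum (F : nat -> S -> S) (G : nat -> E -> E) n :
  (forall t, extends_to iota (F t) (G t)) ->
  extends_to iota (fun X => \sum_(t < n) F t X) (fun X => \sum_(t < n) G t X).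
Proof.
move=> e; elim: n => [|n IH].
  have -> : (fun X => \sum_(t < 0) G t X) = (fun=> 0) by apply/funext => X; rewrite big_ord0.
  split=> X; last by rewrite big_ord0 (lin0 iota_linear).
  exact: cvg_cst.
have := extends_add IH (e n).
have -> : (fun X => \sum_(t < n.+1) F t X) = (fun X => \sum_(t < n) F t X + F n X).
  by apply/funext => X; rewrite big_ord_recr.
suff -> : (fun X => \sum_(t < n.+1) G t X) = (fun X => \sum_(t < n) G t X + G n X) by [].
by apply/funext => X; rewrite big_ord_recr.
Qed.

End Extension.

(** * The exponential series on a completion *)

Section SymmetricTerms.
Variables (K : numFieldType) (V : lmodType K) (b : {biscalar V}).

Definition lap_termS z (X : symtensor V) t : symtensor V :=
  exp_term (fun Y : symtensor V => z *: laplaceS b Y) X t.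

Lemma val_lap_termS z (X : symtensor V) t : val (lap_termS z X t) = lap_term b z (val X) t.
Proof.
rewrite /lap_termS /lap_term /exp_term (linZ (@val_linear _ V)); congr (_ *: _).
apply: (intertwine_iter (h := val : symtensor V -> tensor V)) => Y.
by rewrite (linZ (@val_linear _ V)).
Qed.

Lemma val_lap_partialS z n (X : symtensor V) :
  val (\sum_(t < n) lap_termS z X t) = lap_partial b z n (val X).
Proof.
by rewrite (lin_sum (@val_linear _ V)); apply: eq_bigr => t _; rewrite val_lap_termS.
Qed.

Lemma explapS_add z h (X : symtensor V) : explapS b (z + h) X = explapS b z (explapS b h X).
Proof.
have zn w := zlaplaceS_nilpotent b w.
have := exp_add (D := fun=> True) (zlaplaceS b z) (zlaplaceS b h) (fun _ _ => I) (fun _ _ => I)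
  _ (fun X _ => zn z X) (fun X _ => zn h X) (X := X) I.
rewrite /explapS => <-.
  by congr (exp_op _ X); apply/funext => Y; rewrite scalerDl.
by move=> Y _; rewrite !(linZ (laplaceS_linear b)) !scalerA mulrC.
Qed.

Lemma explapS0 (X : symtensor V) : explapS b 0 X = X.
Proof.
rewrite /explapS (@exp_opE _ _ _ _ 1) ?big_ord1 ?invr1 ?scale1r//.
move=> [//|t] _; rewrite iter_scale; last exact: laplaceS_linear.
by rewrite expr0n scale0r.
Qed.

(** As exp (z + h) = exp z exp h, the error of the difference quotient is the image
    under exp z of the remainder of order 2 of exp h, divided by h. *)
Lemma derivative_quotientE z h (X : symtensor V) : h != 0 ->
  h^-1 *: (explapS b (z + h) X - explapS b z X) - explapS b z (laplaceS b X) =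
  explapS b z (h^-1 *: (explapS b h X - \sum_(t < 2) lap_termS h X t)).
Proof.
move=> h0; have el := explapS_linear b z.
rewrite (linZ el) (linB el) explapS_add.
have -> : \sum_(t < 2) lap_termS h X t = X + h *: laplaceS b X.
  by rewrite !big_ord_recl big_ord0 addr0 /lap_termS /exp_term /= !invr1 !scale1r.
by rewrite (linD el) (linZ el) opprD addrA !scalerBr scalerA mulVf// scale1r.
Qed.

Lemma val_sub0 (X : symtensor V) : val X - val (0 : symtensor V) = val X.
Proof. by rewrite (lin0 (@val_linear _ V)) subr0. Qed.

Lemma val_sub (X Y : symtensor V) : val (X - Y) = val X - val Y.
Proof. exact: (linB (@val_linear _ V)). Qed.

Lemma val_scale a (X : symtensor V) : val (a *: X) = a *: val X.
Proof. exact: (linZ (@val_linear _ V)). Qed.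

End SymmetricTerms.

Section Completed.
Variables (R : realType) (V : tvsType R[i]) (b : {biscalar V}).
Local Notation C := R[i].
Local Notation "x %:C" := (real_complex R x).
Implicit Types (alpha beta gamma : herm_form V).

Variables (E : tvsType R[i]) (iota : symtensor V -> E).
Hypothesis iotaP : is_completion iota.

Lemma tensor_norm_distC beta (X Y : tensor V) :
  tensor_norm beta (X - Y) = tensor_norm beta (Y - X).
Proof.
by rewrite -[X - Y]opprB -scaleN1r tensor_normZ -/(modulus _) /modulus normrN1 /= mul1r.
Qed.

(** These sets stand in for the balls of the seminorms extended to E. *)
Definition hull beta (r : R) (X : E) := forall B, nbhs X B ->
  exists Y : symtensor V, B (iota Y) /\ tensor_norm beta (val Y) <= r.

Lemma hull_le beta r s X : r <= s -> hull beta r X -> hull beta s X.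
Proof.
move=> rs H B /H[Y [BY Yr]]; exists Y; split => //; exact: le_trans rs.
Qed.

(** A small neighbourhood of X in E meets the image of S in a set of bounded
    seminorm. *)
Lemma hull_exists beta X : exists r, 0 < r /\ hull beta r X.
Proof.
have il := iota_linear iotaP.
have : nbhs (0 : symtensor V)
    [set Y : symtensor V | tensor_norm beta (val Y - val (0 : symtensor V)) < 1].
  by apply/nbhs_symtensorP; exists beta, 1; split => //; exact: ltr01.
move=> /(iota_nbhs iotaP)[B]; rewrite (lin0 il) => /nbhs0_sub[W W0 WB] BE.
have [Y0 WY0] := iota_dense iotaP (nbhs_translate X W0).
exists (tensor_norm beta (val Y0) + 1); split.
  by rewrite ltr_wpDl// tensor_norm_ge0.
move=> U UX; have [Y [UY WY]] := iota_dense iotaP (filterI UX (nbhs_translate X W0)).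
exists Y; split => //.
have /BE h : B (iota (Y - Y0)).
  have := WB _ _ WY WY0; rewrite (linB il).
  by rewrite opprB addrA subrK.
have {h} YY0 : tensor_norm beta (val Y - val Y0) < 1.
  by rewrite -val_sub -val_sub0; exact: h.
rewrite -[val Y](subrK (val Y0)) (le_trans (tensor_normD _ _ _))// addrC lerD2l.
exact: ltW.
Qed.

Lemma hull_map beta gamma c f g r X : extends_to iota f g -> 0 <= c ->
  (forall Y, tensor_norm beta (val (f Y)) <= c * tensor_norm gamma (val Y)) ->
  hull gamma r X -> hull beta (c * r) (g X).
Proof.
move=> [gc e] c0 fc H B /gc/H[Y [BY Yr]]; exists (f Y); split; first by rewrite -e.
by apply: (le_trans (fc Y)); rewrite ler_wpM2l.
Qed.

(** Every neighbourhood of 0 contains the closure of a smaller one. *)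
Lemma hull_nbhs0 (U : set E) : nbhs (0 : E) U ->
  exists beta (r : R), 0 < r /\ forall X, hull beta r X -> U X.
Proof.
have il := iota_linear iotaP.
move=> /nbhs0_sub[W W0 WU].
have /nbhs_symtensorP[beta [r [r0 rW]]] := iota_nbhs0 iotaP W0.
exists beta, (r / 2); split; first by rewrite divr_gt0.
move=> X /(_ _ (nbhs_translate X W0))[Y [/= WYX Yr]].
have WY : W (iota Y).
  apply: rW; suff : tensor_norm beta (val Y) < r by rewrite -(val_sub0 Y); apply.
  by rewrite (le_lt_trans Yr)// ltr_pdivrMr// ltr_pMr// ltr1n.
by have := WU _ _ WY WYX; rewrite opprB addrC subrK.
Qed.

Lemma hull_seminorm (p : E -> R) : seminorm p -> continuous p ->
  exists beta (c : R), 0 < c /\ forall m X, 0 < m -> hull beta m X -> p X <= c * m.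
Proof.
move=> [pD pZ] pc.
have p0 : p 0 = 0 by have := pZ 0 0; rewrite scale0r normr0 /= mul0r.
have : nbhs (0 : E) [set X | p X < 1].
  have := pc 0; rewrite /continuous_at p0 => /cvgr_lt; apply; exact: ltr01.
move=> /hull_nbhs0[beta [r [r0 rp]]]; exists beta, r^-1; split; first by rewrite invr_gt0.
move=> m X m0 Xm.
pose a := (r / m)%:C; have ra : 0 < r / m by rewrite divr_gt0.
have ma : complex.Re `|a| = r / m.
  by rewrite -/(modulus a); apply: complexI; rewrite modulusE ger0_norm// ler0c ltW.
have : hull beta (r / m * m) (a *: X).
  have ext := extends_scale iotaP a (extends_id iota).
  apply: (hull_map ext (ltW ra)) Xm => Y.
  by rewrite val_scale tensor_normZ ma.
rewrite divfK ?gt_eqF// => /rp /=; rewrite pZ ma => /ltW.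
by rewrite mulrAC ler_pdivrMr// mul1r mulrC -ler_pdivlMr// mulrC.
Qed.

Hypothesis hsb : exists alpha, bounds_bilinear b alpha.

Variables (D : E -> E) (eD : C -> E -> E).
Hypothesis extD : extends_to iota (laplaceS b) D.
Hypothesis exteD : forall z, extends_to iota (explapS b z) (eD z).

Definition cterm (X : E) z t : E := t`!%:R^-1 *: iter t (fun Y : E => z *: D Y) X.

Lemma extends_cterm z t :
  extends_to iota (fun Y => lap_termS b z Y t) (fun X => cterm X z t).
Proof.
have h1 := extends_scale iotaP z extD.
have h2 := extends_iter t h1.
have h3 := extends_scale iotaP (t`!%:R^-1) h2.
exact: h3.
Qed.

Lemma cterm_hull beta s : 0 < s -> exists gamma, forall z t X r, hull gamma r X ->
  hull beta ((modulus z / s) ^+ t * r) (cterm X z t).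
Proof.
move=> s0; have [gamma H] := lap_term_le hsb beta s0; exists gamma => z t X r.
apply: (hull_map (extends_cterm z t)).
  by rewrite exprn_ge0// divr_ge0 ?modulus_ge0// ltW.
by move=> Y; rewrite val_lap_termS; exact: H.
Qed.

Lemma cterm_absolute_cvg X z : absolute_cvg (cterm X z).
Proof.
move=> p sp pc; have [beta [c [c0 pb]]] := hull_seminorm sp pc.
have m0 := modulus_ge0 z; have s0 : 0 < 2 * modulus z + 1 by lra.
have [gamma H] := cterm_hull beta s0.
have [M [M0 XM]] := hull_exists gamma X.
have q2 : modulus z / (2 * modulus z + 1) <= 1 / 2 by rewrite ler_pdivrMr//; lra.
have pt t : p (cterm X z t) <= geometric (c * M) (1 / 2) t.
  rewrite /geometric /= mulrAC -mulrA; apply: pb.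
    by rewrite mulr_gt0// exprn_gt0// divr_gt0.
  apply: hull_le (H z t X M XM); rewrite ler_wpM2r ?(ltW M0)//.
  by rewrite lerXn2r// nnegrE ?divr_ge0// ltW.
have p_ge0 Y : 0 <= p Y.
  have [pD pZ] := sp; have := pD Y (- 1 *: Y); rewrite pZ scaleN1r subrr.
  have -> : p 0 = 0 by have := pZ 0 0; rewrite scale0r normr0 /= mul0r.
  rewrite normrN1 /= mul1r; lra.
apply: (series_le_cvg _ _ pt) => [t|t|]; first exact: p_ge0.
  by rewrite /geometric /= mulr_ge0 ?mulr_ge0 ?exprn_ge0 ?(ltW c0) ?(ltW M0)// divr_ge0.
apply: is_cvg_geometric_series.
by rewrite ger0_norm ?divr_ge0// ltr_pdivrMr// mul1r ltr1n.
Qed.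

Lemma nbhs_modulus (z0 : C) (r : R) : 0 < r -> nbhs (z0 : C^o) [set z | modulus (z - z0) < r].
Proof.
move=> r0; have rC : 0 < r%:C by rewrite ltcR.
have := @nbhsx_ballx C C^o z0 _ rC; apply: filterS => z.
by rewrite /ball /= distrC -modulusE ltcR.
Qed.

Lemma cterm_locally_uniform_cvg X :
  locally_uniform_cvg (fun n z => series (cterm X z) n) (fun z => eD z X).
Proof.
move=> z0; have m0 := modulus_ge0 z0.
exists [set z | modulus (z - z0) < 1]; first exact/nbhs_modulus/ltr01.
move=> U /hull_nbhs0[beta [r [r0 rU]]].
pose s := 2 * (modulus z0 + 1); have s0 : 0 < s by rewrite /s; lra.
have [gamma H] := explap_remainder_le hsb beta s0.
have [M [M0 XM]] := hull_exists gamma X.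
have : (fun n => geometric (2 * M) (1 / 2) n) @ \oo --> (0 : R).
  by apply: cvg_geometric; rewrite ger0_norm ?divr_ge0// ltr_pdivrMr// mul1r ltr1n.
move=> /cvgrPdist_lt/(_ _ r0); apply: filterS => n; rewrite sub0r normrN.
move=> /(le_lt_trans (ler_norm _)) nr z /= zz0.
have zs : modulus z / s <= 1 / 2.
  rewrite ler_pdivrMr// /s.
  have -> : 1 / 2 * (2 * (modulus z0 + 1)) = modulus z0 + 1 by field.
  rewrite -lecR rmorphD /= rmorph1 !modulusE -[z in leLHS](subrK z0) addrC.
  rewrite (le_trans (ler_normD _ _))// lerD2l -modulusE -(rmorph1 (real_complex R)) lecR ltW//.
apply: rU; rewrite /series /= big_mkord.
apply: (hull_le (ltW nr)).
have ext := extends_sub iotaP (extends_sum iotaP n (extends_cterm z)) (exteD z).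
have -> : geometric (2 * M) (1 / 2) n = 2 * (1 / 2) ^+ n * M by rewrite /geometric /= mulrAC.
apply: (hull_map ext) XM.
  by rewrite mulr_ge0// exprn_ge0// divr_ge0.
move=> Y; rewrite val_sub val_lap_partialS val_explapS.
rewrite tensor_norm_distC.
apply: (le_trans (H z n (val Y) zs)); rewrite ler_wpM2r ?tensor_norm_ge0//.
rewrite ler_wpM2l// lerXn2r// nnegrE divr_ge0 ?modulus_ge0//; exact: ltW.
Qed.

Lemma eD_holomorphic X : holomorphic (fun z => eD z X).
Proof.
move=> z; exists (eD z (D X)) => U /nbhs_translateN/hull_nbhs0[beta [r [r0 rU]]].
have [gamma' H'] := explap_le hsb beta (modulus_ge0 z).
have [gamma H] := explap_remainder_le hsb gamma' ltr01.
have [M [M0 XM]] := hull_exists gamma X.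
(* with s = 1 the error at h is at most 4 |h| M, provided that |h| <= 1 / 2 *)
pose d := Num.min (1 / 2) (r / (4 * M)).
have d0 : 0 < d by rewrite lt_min divr_gt0//= divr_gt0// mulr_gt0.
suff : nbhs (0 : C^o) [set h | h != 0 -> U (h^-1 *: (eD (z + h) X - eD z X))] by [].
apply: filterS (nbhs_modulus 0 d0) => h /=; rewrite subr0 => mh h0.
have [h2 hr] : modulus h <= 1 / 2 /\ modulus h * (4 * M) <= r.
  move: mh; rewrite lt_min => /andP[/ltW h2 /ltW]; rewrite ler_pdivlMr//.
  by rewrite mulr_gt0.
rewrite -[X in U X](subrK (eD z (D X))) addrC; apply: rU.
apply: (hull_le hr); rewrite mulrA.
have ext := extends_sub iotaP (extends_scale iotaP h^-1
   (extends_sub iotaP (exteD (z + h)) (exteD z))) (extends_comp (exteD z) extD).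
apply: (hull_map ext) XM.
  by rewrite mulr_ge0// modulus_ge0.
move=> Y; rewrite derivative_quotientE// val_explapS.
apply: (le_trans (H' _ _ (lexx _))).
rewrite val_scale val_sub val_lap_partialS val_explapS.
rewrite tensor_normZ -/(modulus _) modulusV.
have hh : 0 < modulus h.
  rewrite lt_def modulus_ge0 andbT; apply: contra h0 => /eqP h00.
  by rewrite -normr_eq0 -modulusE h00.
have := H h 2%N (val Y); rewrite divr1 => /(_ h2) HY.
have -> : modulus h * 4 * tensor_norm gamma (val Y) =
   2 * ((modulus h)^-1 * (2 * modulus h ^+ 2 * tensor_norm gamma (val Y))).
  by field; rewrite gt_eqF.
by rewrite ler_wpM2l// ler_wpM2l// invr_ge0 ltW.
Qed.

End Completed.

(** * Polarization of symmetric tensors *)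

Section Polarization.
Variables (K : numFieldType) (V : lmodType K).
Local Notation T := (tensor V).

(** If p is the polynomial with coefficients c, then p(2t) - 2^n p(t) has no
    coefficient of degree n, and the others are multiplied by the non-zero
    numbers 2^j - 2^n. *)
Lemma polynomial_coef (M : lmodType K) (P : M -> Prop) n (c : nat -> M) :
  P 0 -> (forall a x y, P x -> P y -> P (a *: x + y)) ->
  (forall t : nat, P (\sum_(j < n) t%:R ^+ j *: c j)) ->
  forall j, (j < n)%N -> P (c j).
Proof.
move=> P0 Plin; have PZ a x : P x -> P (a *: x).
  by move=> Px; rewrite -[_ *: _]addr0; exact: Plin.
elim: n c => [//|n IH] c Pc.
have cn j : (j < n)%N -> P (c j).
  move=> jn; have := IH (fun j => (2 ^+ j - 2 ^+ n) *: c j) _ j jn.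
  have d0 : (2 ^+ j - 2 ^+ n : K) != 0.
    by rewrite subr_eq0 -!natrX eqr_nat eqn_exp2l// ltn_eqF.
  move=> H; rewrite -[c j](scalerK d0); apply: PZ; apply: H => t.
  have := Plin (- 2 ^+ n) _ _ (Pc t) (Pc (2 * t)%N).
  rewrite !big_ord_recr /= scalerDr scaler_sumr addrACA -big_split /=.
  rewrite natrM exprMn scalerA mulNr -scalerDl addNr scale0r addr0.
  congr P; apply: eq_bigr => i _; rewrite exprMn !scalerA -scalerDl.
  by congr (_ *: _); ring.
move=> j; rewrite ltnS leq_eqVlt => /orP[/eqP ->|]; last exact: cn.
have := Pc 1%N; rewrite big_ord_recr /= expr1n scale1r => H.
have -> : c n = -1 *: (\sum_(j < n) 1 ^+ j *: c j) + (\sum_(j < n) 1 ^+ j *: c j + c n).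
  by rewrite scaleN1r addKr.
apply: (Plin) => //; apply: (big_ind P) => // [x y Px Py|i _].
  by rewrite -[x]scale1r; exact: Plin.
by apply: PZ; exact: cn.
Qed.

Lemma Sym_perm (s t : seq V) : perm_eq s t -> Sym (word s) = Sym (word t).
Proof.
move=> st; have szt := perm_size st.
have /tuple_permP[p tE] : perm_eq t (in_tuple s) by rewrite perm_sym.
have {}tE : t = permute p s.
  rewrite tE /permute; apply: eq_map => i.
  by rewrite (tnth_nth 0).
rewrite !Sym_word -szt tE; congr (_ *: _).
rewrite (reindex_inj (mulIg p)) /=.
have sz : size (permute p s) = size s by rewrite size_map size_enum_ord.
apply: eq_bigr => sigma _; congr word; rewrite /permute.
apply: eq_map => i; rewrite permM.
rewrite (nth_map i) ?size_enum_ord//; congr (_`_ (p _)).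
by apply/val_inj; rewrite /= nth_enum_ord.
Qed.

Lemma Sym_expand (s : seq V) v w (t : K) n :
  Sym (word (s ++ nseq n (t *: w + v))) =
  \sum_(j < n.+1) ('C(n, j)%:R * t ^+ j) *: Sym (word (s ++ nseq (n - j) v ++ nseq j w)).
Proof.
pose u := t *: w + v.
pose F a b c := Sym (word (s ++ nseq a v ++ nseq b w ++ nseq c u)).
have FS a b c : F a b c.+1 = F a.+1 b c + t *: F a b.+1 c.
  have E x : Sym (word ((s ++ nseq a v ++ nseq b w) ++ x :: nseq c u)) =
    sym_word ((s ++ nseq a v ++ nseq b w) ++ x :: nseq c u).
    exact: (tlift_word (@sym_word_multilinear K V)).
  have -> : F a b c.+1 = Sym (word ((s ++ nseq a v ++ nseq b w) ++ u :: nseq c u)).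
    by rewrite /F -!catA.
  rewrite E sym_word_multilinear -!E addrC; congr (_ + _ *: _); apply: Sym_perm.
    rewrite -!catA perm_cat2l -[nseq a.+1 v]cat1s -!catA perm_sym.
    rewrite perm_catCA perm_cat2l perm_catCA perm_cat2l.
    by rewrite perm_refl.
  rewrite -!catA !perm_cat2l -[nseq b.+1 w]cat1s -catA perm_sym perm_catCA.
  by rewrite perm_refl.
have FE c a b : F a b c = \sum_(j < c.+1)
    ('C(c, j)%:R * t ^+ j) *: F (a + (c - j))%N (b + j)%N 0%N.
  elim: c a b => [|c IH] a b.
    by rewrite big_ord1 subnn !addn0 expr0 mulr1 scale1r.
  rewrite FS !IH scaler_sumr [in RHS]big_ord_recl bin0 subn0 expr0 mulr1 scale1r.
  under [in RHS]eq_bigr do rewrite lift0 binS natrD mulrDl scalerDl subSS.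
  rewrite big_split /= addrA; congr (_ + _); last first.
    by apply: eq_bigr => j _; rewrite scalerA addnS addSn exprS mulrCA.
  rewrite big_ord_recl bin0 subn0 expr0 mulr1 scale1r addSnnS; congr (_ + _).
  rewrite [in RHS]big_ord_recr /= bin_small// mul0r scale0r addr0.
  apply: eq_bigr => j _; rewrite /bump add1n; congr (_ *: F _ _ _).
  by rewrite addSnnS subnSK.
have -> : Sym (word (s ++ nseq n (t *: w + v))) = F 0 0 n by [].
by rewrite FE; apply: eq_bigr => j _; rewrite /F !add0n cats0.
Qed.

(** Divided powers: in terms of them Delta and P_Lambda are shifts of degree
    without degree-dependent factors. *)
Definition dpow (v : V) n : T := n`!%:R^-1 *: word (nseq n v).

Lemma fact_neq0 n : (n`!%:R : K) != 0.
Proof. by rewrite pnatr_eq0 -lt0n fact_gt0. Qed.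

(** Polarization: up to a non-zero factor, the symmetric product of s, x and v^m is
    the coefficient of t in the product of s and (v + t x)^(m + 1), so letters can be
    merged into powers one after the other. *)
Lemma symmetric_span (X : T) : X \in @Defs.symmetric K V ->
  X \in linear_span [set dpow v n | v in [set: V] & n in [set: nat]].
Proof.
set N := (X in linear_span X).
have word_span s m v : Sym (word (s ++ nseq m v)) \in linear_span N.
  elim: s m v => [|x s IH] m v.
    rewrite Sym_power (_ : word _ = m`!%:R *: dpow v m).
      by rewrite rpredZ//; apply: linear_span_sub; exists v => //; exists m.
    by rewrite /dpow scalerA divff ?fact_neq0// scale1r.
  have H := @polynomial_coef _ (fun Y : T => Y \in linear_span N) m.+2
    (fun j => 'C(m.+1, j)%:R *: Sym (word (s ++ nseq (m.+1 - j) v ++ nseq j x))).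
  have /= : 'C(m.+1, 1)%:R *: Sym (word (s ++ nseq (m.+1 - 1) v ++ nseq 1 x))
      \in linear_span N.
    apply: (H _ _ _ 1%N) => //; first exact: rpred0.
    - by move=> a Y Z YN ZN; rewrite rpredD// rpredZ.
    - move=> t; rewrite (eq_bigr (fun j : 'I_m.+2 => ('C(m.+1, j)%:R * t%:R ^+ j) *:
          Sym (word (s ++ nseq (m.+1 - j) v ++ nseq j x)))).
        by rewrite -Sym_expand; exact: IH.
      by move=> j _; rewrite scalerA mulrC.
  have -> : Sym (word ((x :: s) ++ nseq m v)) = Sym (word (s ++ nseq m v ++ nseq 1 x)).
    by apply: Sym_perm; rewrite perm_sym catA cats1 perm_rcons.
  rewrite bin1 subSS subn0 => /(rpredZ (m.+1%:R^-1)).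
  by rewrite scalerA mulVf ?pnatr_eq0// scale1r.
move=> /in_symmetric[Y _ <-]; elim/tensor_ind: Y => [|a s Y IH].
  by rewrite linear0 rpred0.
rewrite linearP rpredD// rpredZ//.
by have := word_span s 0%N 0; rewrite cats0.
Qed.

End Polarization.

(** * Product rule and star products *)

Section OuterOperators.
Variables (K : numFieldType) (V : lmodType K).
Local Notation T := (tensor V).
Local Notation O := (outer T T).
Implicit Types (b L : {biscalar V}) (v w : V) (X Y : T) (Z : O).

Lemma outer_ind (P : O -> Prop) : P 0 ->
  (forall a X Y Z, P Z -> P (a *: otimes X Y + Z)) -> forall Z, P Z.
Proof. by move=> P0 Pg; apply: presented_ind => // a [X Y] Z; exact: Pg. Qed.

Lemma otimesZl a X Y : otimes (a *: X) Y = a *: otimes X Y :> O.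
Proof. exact: (linZ (otimes_linearl Y)). Qed.

Lemma otimesZr a X Y : otimes X (a *: Y) = a *: otimes X Y :> O.
Proof. exact: (linZ (otimes_linearr X)). Qed.

Lemma otimes0l Y : otimes 0 Y = 0 :> O.
Proof. exact: (lin0 (otimes_linearl Y)). Qed.

Lemma otimes0r X : otimes X 0 = 0 :> O.
Proof. exact: (lin0 (otimes_linearr X)). Qed.

Section LeftRight.
Variables (f : T -> T) (fl : linear f).

Definition op_left : O -> O := Defs.olift (fun X Y : T => otimes (f X) Y).
Definition op_right : O -> O := Defs.olift (fun X Y : T => otimes X (f Y)).

Let left_l (Y : T) : linear (fun X : T => otimes (f X) Y).
Proof. by move=> a X X'; rewrite fl otimes_linearl. Qed.
Let left_r (X : T) : linear (fun Y : T => otimes (f X) Y).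
Proof. exact: otimes_linearr. Qed.
Let right_l (Y : T) : linear (fun X : T => otimes X (f Y)).
Proof. exact: otimes_linearl. Qed.
Let right_r (X : T) : linear (fun Y : T => otimes X (f Y)).
Proof. by move=> a Y Y'; rewrite fl otimes_linearr. Qed.

Lemma op_left_linear : linear op_left. Proof. exact: olift_is_linear left_l left_r. Qed.
Lemma op_right_linear : linear op_right. Proof. exact: olift_is_linear right_l right_r. Qed.

Lemma op_left_otimes X Y : op_left (otimes X Y) = otimes (f X) Y.
Proof. exact: (olift_otimes left_l left_r). Qed.
Lemma op_right_otimes X Y : op_right (otimes X Y) = otimes X (f Y).
Proof. exact: (olift_otimes right_l right_r). Qed.

End LeftRight.

Lemma nilpotent_outer (f : O -> O) : linear f ->
  (forall X Y, exists n, forall t, (n <= t)%N -> iter t f (otimes X Y) = 0) ->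
  locally_nilpotent f.
Proof.
move=> fl fn; elim/outer_ind => [|a X Y Z [n nZ]].
  by exists 0%N => t _; exact: (lin0 (iter_linear t fl)).
have [m mXY] := fn X Y; exists (maxn n m) => t; rewrite geq_max => /andP[nt mt].
by rewrite (iter_linear t fl) nZ// mXY// scaler0 addr0.
Qed.

Lemma contract_locally_nilpotent L : locally_nilpotent (contract L).
Proof. exact: nilpotent_outer (contract_is_linear L) (contract_nilpotent L). Qed.

Section LaplaceOuter.
Variable b : {biscalar V}.

Definition lapl := op_left (laplace b).
Definition lapr := op_right (laplace b).

Lemma lapl_linear : linear lapl. Proof. exact/op_left_linear/laplace_is_linear. Qed.
Lemma lapr_linear : linear lapr. Proof. exact/op_right_linear/laplace_is_linear. Qed.

Lemma lapl_otimes X Y : lapl (otimes X Y) = otimes (laplace b X) Y.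
Proof. exact/op_left_otimes/laplace_is_linear. Qed.
Lemma lapr_otimes X Y : lapr (otimes X Y) = otimes X (laplace b Y).
Proof. exact/op_right_otimes/laplace_is_linear. Qed.

Lemma lapl_nilpotent : locally_nilpotent lapl.
Proof.
apply: nilpotent_outer lapl_linear _ => X Y.
have [n nX] := laplace_nilpotent b X; exists n => t nt.
rewrite -(intertwine_iter (f := laplace b) (h := fun X : T => otimes X Y)) ?nX//.
  exact: (lin0 (otimes_linearl Y)).
by move=> Z; rewrite lapl_otimes.
Qed.

Lemma lapr_nilpotent : locally_nilpotent lapr.
Proof.
apply: nilpotent_outer lapr_linear _ => X Y.
have [n nY] := laplace_nilpotent b Y; exists n => t nt.
rewrite -(intertwine_iter (f := laplace b) (h := otimes X)) ?nY//.
  exact: (lin0 (otimes_linearr X)).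
by move=> Z; rewrite lapr_otimes.
Qed.

Lemma laplr_comm Z : lapl (lapr Z) = lapr (lapl Z).
Proof.
elim/outer_ind: Z => [|a X Y Z IH].
  by rewrite (lin0 lapr_linear) (lin0 lapl_linear) (lin0 lapr_linear).
rewrite lapr_linear lapl_linear (lapl_linear a) lapr_linear IH.
by rewrite lapr_otimes !lapl_otimes lapr_otimes.
Qed.

Definition lap2 (Z : O) : O := lapl Z + lapr Z.

Lemma lap2_linear : linear lap2.
Proof.
by move=> a X Y; rewrite /lap2 lapl_linear lapr_linear scalerDr addrACA.
Qed.

Lemma lap2_nilpotent : locally_nilpotent lap2.
Proof.
move=> Z; have n1 : nilpotent_on (fun=> True) lapl by move=> X _; exact: lapl_nilpotent.
have n2 : nilpotent_on (fun=> True) lapr by move=> X _; exact: lapr_nilpotent.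
have h := @nilpotent_on_add K O lapl lapr (fun=> True) lapl_linear lapr_linear
  (fun _ _ => I) (fun _ _ => I) (fun Z _ => laplr_comm Z) n1 n2.
exact: (h Z I).
Qed.

Lemma exp_lap2_otimes X Y :
  exp_op lap2 (otimes X Y) = otimes (exp_op (laplace b) X) (exp_op (laplace b) Y).
Proof.
have n1 : nilpotent_on (fun=> True) lapl by move=> Z _; exact: lapl_nilpotent.
have n2 : nilpotent_on (fun=> True) lapr by move=> Z _; exact: lapr_nilpotent.
have -> := @exp_add K O lapl lapr (fun=> True) lapl_linear lapr_linear
  (fun _ _ => I) (fun _ _ => I) (fun Z _ => laplr_comm Z) n1 n2 (otimes X Y) I.
rewrite -(exp_intertwine (f := laplace b) (h := otimes X)); last 3 first.
- exact: otimes_linearr.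
- exact: laplace_nilpotent.
- by move=> Z; rewrite lapr_otimes.
rewrite -(exp_intertwine (f := laplace b) (h := fun X : T => otimes X _))//.
- exact: otimes_linearl.
- exact: laplace_nilpotent.
- by move=> Z; rewrite lapl_otimes.
Qed.

End LaplaceOuter.

(** Divided powers of degree n - 1 and, below, n - 2, which are 0 in negative
    degrees. *)
Definition dpow1 v n : T := if n is n'.+1 then dpow v n' else 0.
Definition dpow2 v n : T := if n is n'.+1 then dpow1 v n' else 0.

Lemma laplace_dpow b v n : laplace b (dpow v n) = (b v v / 2) *: dpow2 v n.
Proof.
have l0 s : (size s < 2)%N -> laplace b (n`!%:R^-1 *: word s) = 0.
  by move=> s2; rewrite (linZ (laplace_is_linear b)) laplace_word_small// scaler0.
case: n l0 => [|[|n]] l0; rewrite /= ?scaler0; [exact: l0|exact: l0|].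
rewrite /dpow /=.
rewrite (linZ (laplace_is_linear b)) laplace_word_cons2 size_nseq /dpow !scalerA.
congr (_ *: _); rewrite 2!factS !natrM; field.
by rewrite fact_neq0 nat1r -(natrD _ 2 n) !pnatr_eq0.
Qed.

Lemma contract_dpow L v w k l :
  contract L (otimes (dpow v k) (dpow w l)) = L v w *: otimes (dpow1 v k) (dpow1 w l).
Proof.
rewrite /dpow otimesZl otimesZr !(linZ (contract_is_linear L)) contract_otimes_word.
case: l => [|l].
  by rewrite contract_word_nilr !scaler0 otimes0r scaler0.
case: k => [|k].
  by rewrite /= !scaler0 otimes0l scaler0.
have -> : nseq k.+1 v = rcons (nseq k v) v.
  by elim: k => //= k <-.
rewrite contract_word_rcons !size_nseq /= /dpow otimesZl otimesZr !scalerA; congr (_ *: _).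
rewrite !factS !natrM; field.
by rewrite !fact_neq0 !nat1r !pnatr_eq0.
Qed.

Definition dpow_tensors : set O :=
  [set Z | exists v w k l, Z = otimes (dpow v k) (dpow w l)].

Local Notation sym_outer := (linear_span dpow_tensors).

Lemma sym_outer_ind (P : O -> Prop) : P 0 ->
  (forall a x y, P x -> P y -> P (a *: x + y)) ->
  (forall v w k l, P (otimes (dpow v k) (dpow w l))) ->
  forall Z, Z \in sym_outer -> P Z.
Proof.
move=> P0 Plin Pgen Z /in_linear_span; apply => //.
by move=> _ [v [w [k [l ->]]]]; exact: Pgen.
Qed.

Lemma sym_outer_gen v w k l : otimes (dpow v k) (dpow w l) \in sym_outer.
Proof. by apply: linear_span_sub; exists v, w, k, l. Qed.

Lemma sym_outer0l (Y : T) : otimes 0 Y \in sym_outer.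
Proof. by rewrite otimes0l rpred0. Qed.

Lemma sym_outer0r (X : T) : otimes X 0 \in sym_outer.
Proof. by rewrite otimes0r rpred0. Qed.

Lemma otimes_sym_outer X Y : X \in @Defs.symmetric K V -> Y \in @Defs.symmetric K V ->
  otimes X Y \in sym_outer.
Proof.
move=> /symmetric_span/in_linear_span XN /symmetric_span/in_linear_span YN.
apply: (XN [set X | otimes X Y \in sym_outer]) => /=.
- exact: sym_outer0l.
- by move=> a X1 X2 h1 h2; rewrite otimes_linearl rpredD// rpredZ.
move=> _ [v _ [k _ <-]]; apply: (YN [set Y | otimes (dpow v k) Y \in sym_outer]) => /=.
- exact: sym_outer0r.
- by move=> a Y1 Y2 h1 h2; rewrite otimes_linearr rpredD// rpredZ.
by move=> _ [w _ [l _ <-]]; exact: sym_outer_gen.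
Qed.

Lemma sym_outer_stable (f : O -> O) : linear f ->
  (forall v w k l, f (otimes (dpow v k) (dpow w l)) \in sym_outer) ->
  forall Z, Z \in sym_outer -> f Z \in sym_outer.
Proof.
move=> fl fg; apply: sym_outer_ind => //; first by rewrite (lin0 fl) rpred0.
by move=> a X Y fX fY; rewrite fl rpredD// rpredZ.
Qed.

Lemma contract_sym_outer L Z : Z \in sym_outer -> contract L Z \in sym_outer.
Proof.
move: Z; apply: (sym_outer_stable (contract_is_linear L)) => v w [|k] [|l];
  rewrite contract_dpow rpredZ//= ?sym_outer0l ?sym_outer0r//.
exact: sym_outer_gen.
Qed.

Lemma lap2_sym_outer b Z : Z \in sym_outer -> lap2 b Z \in sym_outer.
Proof.
move: Z; apply: (sym_outer_stable (lap2_linear b)) => v w k l.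
rewrite /lap2 lapl_otimes lapr_otimes !laplace_dpow.
rewrite (otimesZl (b v v / 2)) (otimesZr (b w w / 2)) rpredD ?rpredZ//.
  by case: k => [|[|k]] /=; rewrite ?sym_outer0l ?sym_outer_gen.
by case: l => [|[|l]] /=; rewrite ?sym_outer0r ?sym_outer_gen.
Qed.

Lemma comm_sym_outer (f g : O -> O) : linear f -> linear g ->
  (forall v w k l, f (g (otimes (dpow v k) (dpow w l))) =
    g (f (otimes (dpow v k) (dpow w l)))) ->
  forall Z, Z \in sym_outer -> f (g Z) = g (f Z).
Proof.
move=> fl gl fg; apply: sym_outer_ind => //.
  by rewrite (lin0 gl) (lin0 fl) (lin0 gl).
by move=> a X Y hX hY; rewrite gl !fl gl hX hY.
Qed.

Lemma contract_comm L L' Z : Z \in sym_outer ->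
  contract L (contract L' Z) = contract L' (contract L Z).
Proof.
move: Z; apply: comm_sym_outer => [||v w k l]; [exact: contract_is_linear..|].
have c0 L0 : contract L0 0 = 0 by exact: (lin0 (contract_is_linear L0)).
rewrite !contract_dpow !(linZ (contract_is_linear _)).
case: k => [|k]; first by rewrite /= otimes0l !c0 !scaler0.
case: l => [|l]; first by rewrite /= otimes0r !c0 !scaler0.
by rewrite !contract_dpow !scalerA mulrC.
Qed.

Lemma lap2_contract_comm b L Z : Z \in sym_outer ->
  lap2 b (contract L Z) = contract L (lap2 b Z).
Proof.
move: Z; apply: comm_sym_outer => [||v w k l]; [exact: lap2_linear|exact: contract_is_linear|].
have lap0 : laplace b 0 = 0 by exact: (lin0 (laplace_is_linear b)).
rewrite contract_dpow (linZ (lap2_linear b)) /lap2 !lapl_otimes !lapr_otimes.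
rewrite (linD (contract_is_linear L)) scalerDr.
rewrite !laplace_dpow (otimesZl (b v v / 2)) (otimesZr (b w w / 2)).
rewrite !(linZ (contract_is_linear L)); congr (_ + _).
  case: k => [|[|k]] /=; rewrite ?lap0 ?otimes0l ?(lin0 (contract_is_linear _)) ?scaler0//.
    by rewrite laplace_dpow scaler0 otimes0l scaler0.
  by rewrite contract_dpow laplace_dpow (otimesZl (b v v / 2)) !scalerA mulrC.
case: l => [|[|l]] /=; rewrite ?lap0 ?otimes0r ?(lin0 (contract_is_linear _)) ?scaler0//.
  by rewrite laplace_dpow scaler0 otimes0r scaler0.
by rewrite contract_dpow laplace_dpow (otimesZr (b w w / 2)) !scalerA mulrC.
Qed.

Definition symmu (Z : O) : T := Sym (mu Z).

Lemma symmu_linear : linear symmu.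
Proof. by move=> a Z Z'; rewrite /symmu (mu_is_linear a Z Z') (Sym_is_linear a). Qed.

Lemma symmu_dpow v w k l : symmu (otimes (dpow v k) (dpow w l)) =
  (k`!%:R * l`!%:R)^-1 *: Sym (word (nseq k v ++ nseq l w)).
Proof.
rewrite /symmu mu_otimes /dpow (linZ (tmul_linearl _)) (linZ (tmul_linearr _)).
by rewrite tmul_word !(linZ (@Sym_is_linear K V)) scalerA invfM.
Qed.

Lemma dpow_expand v w (t : K) n : dpow (t *: w + v) n =
  \sum_(j < n.+1) t ^+ j *: symmu (otimes (dpow v (n - j)) (dpow w j)).
Proof.
rewrite /dpow -Sym_power.
have /= -> := Sym_expand [::] v w t n; rewrite scaler_sumr; apply: eq_bigr => j _.
rewrite symmu_dpow !scalerA; congr (_ *: _).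
have jn : (j <= n)%N by rewrite -ltnS.
rewrite -(bin_fact jn) !natrM; field.
by rewrite !fact_neq0 pnatr_eq0 -lt0n bin_gt0 jn.
Qed.

Section ProductRule.
Variables (v w : V) (t : K).
Local Notation u := (t *: w + v).

Let z0l Y : symmu (otimes 0 Y) = 0.
Proof. by rewrite otimes0l (lin0 symmu_linear). Qed.
Let z0r X : symmu (otimes X 0) = 0.
Proof. by rewrite otimes0r (lin0 symmu_linear). Qed.

Lemma dpow2_expand_left n :
  \sum_(j < n.+1) t ^+ j *: symmu (otimes (dpow2 v (n - j)) (dpow w j)) = dpow2 u n.
Proof.
case: n => [|[|n]].
- by rewrite big_ord1 z0l scaler0.
- by rewrite !big_ord_recr big_ord0 /= !z0l !scaler0 !addr0.
rewrite 2!big_ord_recr /= subnn subSnn !z0l !scaler0 !addr0 dpow_expand.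
apply: eq_bigr => j _; have jn : (j <= n)%N by rewrite -ltnS.
by rewrite !subSn// leqW.
Qed.

Lemma dpow2_expand_middle n :
  \sum_(j < n.+1) t ^+ j *: symmu (otimes (dpow1 v (n - j)) (dpow1 w j)) = t *: dpow2 u n.
Proof.
case: n => [|[|n]].
- by rewrite big_ord1 z0l !scaler0.
- by rewrite !big_ord_recr big_ord0 /= z0l z0r !scaler0 !addr0.
rewrite big_ord_recl /= z0r scaler0 add0r big_ord_recr /= /bump add1n subnn z0l.
rewrite scaler0 addr0 dpow_expand scaler_sumr; apply: eq_bigr => j _.
have jn : (j <= n)%N by rewrite -ltnS.
by rewrite add1n subSS subSn// exprS scalerA.
Qed.

Lemma dpow2_expand_right n :
  \sum_(j < n.+1) t ^+ j *: symmu (otimes (dpow v (n - j)) (dpow2 w j)) = t ^+ 2 *: dpow2 u n.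
Proof.
case: n => [|[|n]].
- by rewrite big_ord1 z0r !scaler0.
- by rewrite !big_ord_recr big_ord0 /= !z0r !scaler0 !addr0.
rewrite 2!big_ord_recl /= !z0r !scaler0 !add0r dpow_expand scaler_sumr.
apply: eq_bigr => j _.
by rewrite /bump !add1n !subSS scalerA -exprD.
Qed.

End ProductRule.

Section StarProduct.
Variable b : {biscalar V}.
Hypothesis b_sym : forall v w, b v w = b w v.

(** Both sides are coefficients of a polynomial identity in t: expand
    Delta u^n = b(u, u) / 2 u^(n - 2), in divided powers, at u = v + t w. *)
Lemma laplace_symmu_dpow v w k l :
  laplace b (symmu (otimes (dpow v k) (dpow w l))) =
  symmu (lap2 b (otimes (dpow v k) (dpow w l)) + contract b (otimes (dpow v k) (dpow w l))).
Proof.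
pose g j := otimes (dpow v (k + l - j)) (dpow w j) : O.
pose c j := laplace b (symmu (g j)) - symmu (lap2 b (g j) + contract b (g j)).
suff : c l = 0 by rewrite /c /g addnK => /subr0_eq.
apply: (@polynomial_coef K T (fun X => X = 0) (k + l).+1 c) => [//|a X Y -> ->|t|].
- by rewrite scaler0 addr0.
- pose N := (k + l)%N; pose u := t%:R *: w + v.
  have cE j : c j = laplace b (symmu (g j)) -
     ((b v v / 2) *: symmu (otimes (dpow2 v (N - j)) (dpow w j)) +
      (b w w / 2) *: symmu (otimes (dpow v (N - j)) (dpow2 w j)) +
      b v w *: symmu (otimes (dpow1 v (N - j)) (dpow1 w j))).
    rewrite /c /g /lap2 lapl_otimes lapr_otimes !laplace_dpow contract_dpow.
    rewrite (otimesZl (b v v / 2)) (otimesZr (b w w / 2)).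
    by rewrite !(linD symmu_linear) !(linZ symmu_linear).
  have -> : \sum_(j < N.+1) t%:R ^+ j *: c j =
     laplace b (dpow u N) - ((b v v / 2) *: dpow2 u N +
       (b w w / 2) *: (t%:R ^+ 2 *: dpow2 u N) + b v w *: (t%:R *: dpow2 u N)).
    rewrite dpow_expand (lin_sum (laplace_is_linear b)).
    rewrite -{1}(dpow2_expand_left v w t%:R N) -(dpow2_expand_right v w t%:R N).
    rewrite -(dpow2_expand_middle v w t%:R N) !scaler_sumr -!big_split -sumrB /=.
    apply: eq_bigr => j _; rewrite cE scalerBr (linZ (laplace_is_linear b)).
    by rewrite !scalerDr !scalerA ![t%:R ^+ j * _]mulrC.
  rewrite laplace_dpow !scalerA -!scalerDl -scalerBl.
  have -> : b u u = b v v + t%:R * b v w + t%:R * b v w + t%:R ^+ 2 * b w w.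
    rewrite /u linearDl /= !linearDr /= !linearZl_LR /= !linearZr_LR /= (b_sym w v).
    by ring.
  by rewrite (_ : _ - _ = 0) ?scale0r//; field.
by rewrite ltnS leq_addl.
Qed.

Lemma laplace_symmu Z : Z \in sym_outer ->
  laplace b (symmu Z) = symmu (lap2 b Z + contract b Z).
Proof.
move: Z; apply: sym_outer_ind => [|a X Y hX hY|]; last exact: laplace_symmu_dpow.
  rewrite (lin0 symmu_linear) (lin0 (laplace_is_linear b)) (lin0 (lap2_linear b)).
  by rewrite (lin0 (contract_is_linear b)) addr0 (lin0 symmu_linear).
rewrite symmu_linear laplace_is_linear hX hY -symmu_linear; congr symmu.
by rewrite lap2_linear contract_is_linear scalerDr addrACA.
Qed.

Definition prod_lap Z : O := lap2 b Z + contract b Z.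

Lemma prod_lap_linear : linear prod_lap.
Proof.
move=> a X Y; rewrite /prod_lap (lap2_linear b a) (contract_is_linear b a).
by rewrite (scalerDr a (lap2 b X)) addrACA.
Qed.

Let D Z : Prop := Z \in sym_outer.
Let lapD Z : D Z -> D (lap2 b Z). Proof. exact: lap2_sym_outer. Qed.
Let conD L Z : D Z -> D (contract L Z). Proof. exact: contract_sym_outer. Qed.
Let prodD Z : D Z -> D (prod_lap Z).
Proof. by move=> DZ; rewrite /D rpredD//; [exact: lapD|exact: conD]. Qed.
Let lapn : nilpotent_on D (lap2 b). Proof. by move=> Z _; exact: lap2_nilpotent. Qed.
Let conn L : nilpotent_on D (contract L).
Proof. by move=> Z _; exact: contract_locally_nilpotent. Qed.

Let prodn : nilpotent_on D prod_lap.
Proof.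
exact: (@nilpotent_on_add K O (lap2 b) (contract b) D (lap2_linear b)
  (contract_is_linear b) lapD (conD b) (lap2_contract_comm b b) lapn (conn b)).
Qed.

Let prod_comm L Z : D Z -> prod_lap (contract L Z) = contract L (prod_lap Z).
Proof.
move=> DZ; rewrite /prod_lap (lap2_contract_comm b L DZ) (contract_comm b L DZ).
by rewrite [RHS](linD (contract_is_linear L)).
Qed.

Lemma contract_add_form L Z : D Z ->
  contract (add_form L b) Z = contract L Z + contract b Z.
Proof.
move: Z; apply: sym_outer_ind => [|a X Y hX hY|v w k l].
- by rewrite !(lin0 (contract_is_linear _)) addr0.
- by rewrite !contract_is_linear hX hY scalerDr addrACA.
by rewrite !contract_dpow scalerDl.
Qed.

(** Behind the symmetric product Delta is lap2 b + contract b. This operator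
    commutes with contract L, so the two exponentials merge into the one of
    lap2 b + contract (L + b), which splits in the other order. *)
Lemma exp_laplace_symmu L Z : D Z ->
  exp_op (laplace b) (symmu (exp_op (contract L) Z)) =
  symmu (exp_op (contract (add_form L b)) (exp_op (lap2 b) Z)).
Proof.
move=> DZ.
have DE : D (exp_op (contract L) Z).
  have [n nZ] := conn L DZ; rewrite (exp_opE nZ) /D rpred_sum// => t _.
  by rewrite rpredZ//; elim: (nat_of_ord t) => //= m; exact: conD.
rewrite -(@exp_intertwine_on _ _ _ prod_lap (laplace b) symmu D)//; last 2 first.
- by move=> X DX; rewrite laplace_symmu.
- exact: symmu_linear.
congr symmu.
rewrite -(@exp_add K O prod_lap (contract L) D prod_lap_linear (contract_is_linear L)
  prodD (conD L) (prod_comm L) prodn (conn L) Z DZ).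
rewrite -(@exp_add K O (contract (add_form L b)) (lap2 b) D (contract_is_linear _)
  (lap2_linear b) (conD _) lapD
  (fun Z DZ => esym (lap2_contract_comm b (add_form L b) DZ)) (conn _) lapn Z DZ).
apply: (@exp_intertwine_on _ _ _ _ _ id D) => //.
- by move=> X DX; rewrite /D rpredD//; [exact: prodD|exact: conD].
- by move=> X DX; rewrite /= contract_add_form// /prod_lap addrC [lap2 b X + _]addrC addrA.
exact: (@nilpotent_on_add K O prod_lap (contract L) D prod_lap_linear (contract_is_linear L)
  prodD (conD L) (prod_comm L) prodn (conn L)).
Qed.

End StarProduct.

Lemma val_star L (X Y : symtensor V) :
  val (star L X Y) = symmu (exp_op (contract L) (otimes (val X) (val Y))).
Proof.
have [n nXY] := contract_nilpotent L (val X) (val Y).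
rewrite (exp_opE nXY) /star (@fsbig_nat _ _ n); last first.
  move=> t nt; rewrite nXY//; apply: val_inj.
  rewrite (linZ (@val_linear _ V)) (lin0 (@val_linear _ V)).
  by rewrite [X in _ *: X](lin0 symmu_linear) scaler0.
rewrite (lin_sum (@val_linear _ V)) (lin_sum symmu_linear); apply: eq_bigr => t _.
by rewrite (linZ (@val_linear _ V)) (linZ symmu_linear).
Qed.

Lemma exp_laplace_star b L (X Y : symtensor V) : (forall v w, b v w = b w v) ->
  exp_op (laplaceS b) (star L X Y) =
  star (add_form L b) (exp_op (laplaceS b) X) (exp_op (laplaceS b) Y).
Proof.
move=> b_sym; apply: val_inj.
have vE (W : symtensor V) : val (exp_op (laplaceS b) W) = exp_op (laplace b) (val W).
  by rewrite explapS1 val_explapS -explap1.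
have DXY : otimes (val X) (val Y) \in sym_outer.
  by apply: otimes_sym_outer; exact: valP.
transitivity (exp_op (laplace b) (symmu
    (exp_op (contract L) (otimes (val X) (val Y))))).
  by rewrite vE val_star.
rewrite (exp_laplace_symmu b_sym L DXY) exp_lap2_otimes.
by rewrite val_star vE vE.
Qed.

End OuterOperators.

(** * Continuity of bounded bilinear forms, and the theorem *)

Section BilinearContinuity.
Variables (R : realType) (V : tvsType R[i]) (b : {biscalar V}) (alpha : herm_form V).
Local Notation C := R[i].
Hypothesis ab : bounds_bilinear b alpha.

(** By the Cauchy-Schwarz inequality for b, as one of the two factors on its right
    tends to 0. *)
Lemma bounds_cvg0 (T : topologicalType) (f g : T -> V) (x : T) :
  {for x, continuous f} -> {for x, continuous g} -> f x = 0 \/ g x = 0 ->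
  (fun y => b (f y) (g y) : C^o) @ x --> (0 : C^o).
Proof.
move=> fc gc fg0.
have hc (h : T -> V) : {for x, continuous h} ->
    (fun y => alpha (h y) (h y) : C^o) @ x --> (alpha (h x) (h x) : C^o).
  move=> hx; apply: (@continuous_comp T (V * V)%type C^o (fun y => (h y, h y))
    (fun p => alpha p.1 p.2)); last exact: (@herm_continuous _ _ alpha).
  exact: (cvg_pair hx hx).
have FC : (fun y => alpha (f y) (f y) * alpha (g y) (g y) : C^o) @ x --> (0 : C^o).
  have -> : (0 : C^o) = alpha (f x) (f x) * alpha (g x) (g x).
    by case: fg0 => ->; rewrite (lin0 (herm_linear alpha 0)) ?mul0r ?mulr0.
  exact: (@cvgM C _ _ _ _ _ _ _ (hc f fc) (hc g gc)).
apply/(@cvgrPdist_lt C C^o) => e e0.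
move/(@cvgrPdist_lt C C^o) : FC => FC.
have := FC (e ^+ 2) (exprn_gt0 2 e0); apply: filterS => y; rewrite !sub0r !normrN /= => Fy.
rewrite -(@ltr_pXn2r _ 2)// ?nnegrE ?normr_ge0 ?(ltW e0)//.
apply: le_lt_trans Fy; apply: (le_trans (bounds_bilinearP (f y) (g y) ab)).
by rewrite ger0_norm// mulr_ge0 ?herm_ge0.
Qed.

Lemma bounds_continuous_bilinear : continuous_bilinear b.
Proof.
move=> [v0 w0].
have c1 : {for (v0, w0), continuous (fun p : V * V => p.1 - v0)}.
  apply: (@continuous_comp (V * V)%type (V * V)%type V (fun p => (p.1, v0)) (fun p => p.1 - p.2)).
    by apply: cvg_pair; [exact: cvg_fst|exact: cvg_cst].
  exact: sub_continuous.
have c2 : {for (v0, w0), continuous (fun p : V * V => p.2 - w0)}.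
  apply: (@continuous_comp (V * V)%type (V * V)%type V (fun p => (p.2, w0)) (fun p => p.1 - p.2)).
    by apply: cvg_pair; [exact: cvg_snd|exact: cvg_cst].
  exact: sub_continuous.
have k1 : {for (v0, w0), continuous (fun _ : V * V => v0)} by exact: cvg_cst.
have k2 : {for (v0, w0), continuous (fun _ : V * V => w0)} by exact: cvg_cst.
have z1 := bounds_cvg0 c1 c2 (or_introl (subrr v0)).
have z2 := bounds_cvg0 c1 k2 (or_introl (subrr v0)).
have z3 := bounds_cvg0 k1 c2 (or_intror (subrr w0)).
have z4 : (fun _ : V * V => b v0 w0 : C^o) @ (v0, w0) --> (b v0 w0 : C^o) by exact: cvg_cst.
have H := @cvgD C C^o _ _ _ _ _ _ _ (cvgD (cvgD z1 z2) z3) z4.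
have E : (fun p : V * V => b p.1 p.2 : C^o) = (fun p : V * V =>
    b (p.1 - v0) (p.2 - w0) + b (p.1 - v0) w0 + b v0 (p.2 - w0) + b v0 w0).
  by apply/funext => -[v w] /=; rewrite !linearBl !linearBr /=; ring.
rewrite !add0r in H; rewrite E /continuous_at.
have -> : b ((v0, w0).1 - v0) ((v0, w0).2 - w0) + b ((v0, w0).1 - v0) w0 +
  b v0 ((v0, w0).2 - w0) + b v0 w0 = b v0 w0 by rewrite /= !subrr !linear0l linear0r !add0r.
exact: H.
Qed.

End BilinearContinuity.

Lemma add_form_continuous (R : realType) (V : tvsType R[i]) (L b : {biscalar V}) :
  continuous_bilinear L -> continuous_bilinear b -> continuous_bilinear (add_form L b).
Proof. by move=> Lc bc p; apply: (@cvgD R[i] R[i]^o); [exact: Lc|exact: bc]. Qed.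

Theorem theorem3p10 (R : realType) (V : tvsType R[i])
    (V_hausdorff : hausdorff_space V)
    (V_hilbert : hilbert_seminorms_cofinal V)
    (b : {biscalar V}) (b_sym : forall v w : V, b v w = b w v) :
  [/\ continuous (exp_op (laplace b) : tensor V -> tensor V)
        <-> hilbert_schmidt b,
      continuous (exp_op (laplaceS b) : symtensor V -> symtensor V)
        <-> hilbert_schmidt b
    & hilbert_schmidt b ->
      [/\ forall L : {biscalar V}, continuous_bilinear L ->
            forall X Y : symtensor V,
              exp_op (laplaceS b) (star L X Y) =
              star (add_form L b) (exp_op (laplaceS b) X)
                (exp_op (laplaceS b) Y),
          forall L : {biscalar V}, continuous_bilinear L ->
            continuous_bilinear (add_form L b) /\
            lc_algebra_iso (star L) (star (add_form L b))
              (exp_op (laplaceS b))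
        & forall (E : tvsType R[i]) (iota : symtensor V -> E),
            is_completion iota ->
            exists (D : E -> E) (eD : R[i] -> E -> E),
              [/\ extends_to iota (laplaceS b) D,
                  forall z, extends_to iota
                    (exp_op (fun Y : symtensor V => z *: laplaceS b Y)) (eD z)
                & forall X : E,
                    let term z t :=
                      t`!%:R^-1 *: iter t (fun Y : E => z *: D Y) X in
                    [/\ forall z, absolute_cvg (term z),
                        locally_uniform_cvg (fun n z => series (term z) n)
                          (fun z => eD z X)
                      & holomorphic (fun z => eD z X)]]]].
Proof.
have symHS : continuous (explapS b 1 : symtensor V -> symtensor V) -> hilbert_schmidt b.
  by move=> /(explapS_continuous_bounds b_sym)[alpha]; exact: bounds_hilbert_schmidt.
rewrite explap1 explapS1; split.
- split=> [/explapS_continuous_of/symHS //|/hilbert_schmidt_bounds hsb].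
  exact: explap_continuous.
- split=> [/symHS //|/hilbert_schmidt_bounds hsb].
  exact: explapS_continuous.
move=> /hilbert_schmidt_bounds hsb.
have mult (L : {biscalar V}) (X Y : symtensor V) : explapS b 1 (star L X Y) =
    star (add_form L b) (explapS b 1 X) (explapS b 1 Y).
  by rewrite -explapS1; exact: exp_laplace_star.
have [alpha ab] := hsb.
split=> [L _ X Y|L Lc|E iota iotaP].
- exact: mult.
- split; first exact: add_form_continuous Lc (bounds_continuous_bilinear ab).
  split; [exact: explapS_linear|exact: mult|exact: explapS_continuous|].
  exists (explapS b (-1)); split; last exact: explapS_continuous.
    by move=> X; rewrite -explapS_add addNr explapS0.
  by move=> X; rewrite -explapS_add subrr explapS0.
have [D extD] := extension iotaP (laplaceS_linear b) (laplaceS_continuous hsb).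
have ex (z : R[i]) : exists g : E -> E, extends_to iota (explapS b z) g.
  have [g gP] := extension iotaP (explapS_linear b z) (@explapS_continuous R V b hsb z).
  by exists g.
have [eD exteD] := choice ex.
exists D, eD; split=> [//|//|X term]; split.
- by move=> z; exact: (cterm_absolute_cvg iotaP hsb extD).
- exact: (cterm_locally_uniform_cvg iotaP hsb extD exteD).
- exact: (eD_holomorphic iotaP hsb extD exteD).
Qed.
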